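(* Let $\mathcal{F}_q(N)$ denote the quotient $\mathcal{F}_q(G)$-comodule algebra of $\mathcal{L}_q(M)$ modulo the ideal generated by $\mathrm{Tr}_q(L^d)$, $d=1,\dots,n$. Then $\mathcal{F}_q(N)$ is a quantum deformation of the affine $G$-variety $N$ of nilpotent $n\times n$ complex matrices.
   Context: Fix a positive integer $n$; $G=SL(n,\mathbb{C})$ acts from the right on $M=M(n,\mathbb{C})$, and on the closed subvariety $N$ of nilpotent matrices, by $(\xi,g)\mapsto g^{-1}\xi g$. $\mathcal{F}(V)$ is the coordinate ring of an affine variety $V$; for an affine $G$-variety it is a right $\mathcal{F}(G)$-comodule algebra. $\mathbb{K}=\mathbb{C}[q]_{(q-1)}\subset\mathbb{C}(q)$ is the ring of rational functions in the indeterminate $q$ with no pole at $1$. Repeated indices are summed. R-matrix: $R\in\mathrm{End}_{\mathbb K}(\mathbb{K}^n\otimes\mathbb{K}^n)$, $R(e_j\otimes e_t)=R^{is}_{jt}e_i\otimes e_s$, where $R^{is}_{jt}=q$ if $i=j=s=t$; $=1$ if $i=j$, $s=t$, $i\ne s$; $=q-q^{-1}$ if $i>j$, $i=t$, $j=s$; $=0$ otherwise. $\widehat R=\phi\circ R$ with $\phi(a\otimes b)=b\otimes a$. $\mathcal{F}_q(M)$ is the $\mathbb{K}$-algebra generated by the entries of $X=[x^i_j]_{i,j=1}^n$ subject to $\widehat R(X\otimes I)(I\otimes X)=(X\otimes I)(I\otimes X)\widehat R$, a bialgebra with $\Delta(x^i_j)=x^i_s\otimes x^s_j$, $\varepsilon(x^i_j)=\delta^i_j$.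 $\det_q=\sum_{\sigma\in \mathrm{Sym}_n}(-q)^{\mathrm{length}(\sigma)}x^1_{\sigma(1)}\cdots x^n_{\sigma(n)}$. $\mathcal{F}_q(G)=\mathcal{F}_q(M)/(\det_q-1)$ is a Hopf algebra with antipode $S$; $t^i_j$ is the image of $x^i_j$. One has $\mathcal{F}_q(G)/(q-1)\mathcal{F}_q(G)\cong\mathcal{F}(G)$, with $t^i_j$ mapping to the coordinate functions. $\mathcal{L}_q(M)$ (reflection equation algebra) is the $\mathbb{K}$-algebra generated by the entries of $L=[l^i_j]_{i,j=1}^n$ subject to $\widehat R(I\otimes L)\widehat R(I\otimes L)=(I\otimes L)\widehat R(I\otimes L)\widehat R$. It is a right $\mathcal{F}_q(G)$-comodule algebra via the algebra homomorphism $\beta(l^i_j)=l^a_b\otimes S(t^i_a)t^b_j$. The quantum trace of an $n\times n$ matrix $A=[a^i_j]$ with entries in a $\mathbb{K}$-module is $\mathrm{Tr}_q(A)=\sum_{i=1}^nq^{n+1-2i}a^i_i$. The elements $\mathrm{Tr}_q(L^d)$ are coinvariant ($\beta(\mathrm{Tr}_q(L^d))=\mathrm{Tr}_q(L^d)\otimes1$), so the ideal they generate is a subcomodule and the quotient inherits the coaction. A quantum deformation of an affine $G$-variety $V$ is a right $\mathcal{F}_q(G)$-comodule algebra $(\mathcal{F}_q(V),\varphi)$ such that: (i) $\mathcal{F}_q(V)$ is a free $\mathbb{K}$-module; (ii) $\mathcal{F}_q(V)/(q-1)\mathcal{F}_q(V)\cong\mathcal{F}(V)$ (as algebras); (iii)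 the square formed by $\varphi:\mathcal{F}_q(V)\to\mathcal{F}_q(V)\otimes_{\mathbb K}\mathcal{F}_q(G)$, the coaction $\mathcal{F}(V)\to\mathcal{F}(V)\otimes_{\mathbb C}\mathcal{F}(G)$, and the natural surjections with kernel generated by $q-1$, commutes. *)

(* Defs.v *)
From HB Require Import structures.
From mathcomp Require Import monalg mpoly.
From mathcomp Require Import all_boot all_order all_algebra fingroup perm.
From mathcomp Require Import fraction generic_quotient.
From mathcomp Require Import boolp classical_sets reals complex mxtens.

Set Implicit Arguments.
Unset Strict Implicit.
Unset Printing Implicit Defensive.

Import GRing.Theory.
Local Open Scope ring_scope.
Local Open Scope quotient_scope.

(* monalg.v rebinds this notation in type_scope *)
Notation "{ 'mpoly' T [ n ] }" := (mpoly n T) : type_scope.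

(* Unital associative K-algebras.  Unlike MathComp's algType, the zero algebra
   is allowed, since a quotient by an arbitrary two-sided ideal may vanish. *)
Record pzAlg (K : comNzRingType) := PzAlg {
  pz_ring : pzRingType;
  pz_scale : K -> pz_ring -> pz_ring;
  pz_scaleA : forall a b v, pz_scale a (pz_scale b v) = pz_scale (a * b) v;
  pz_scale1 : left_id 1 pz_scale;
  pz_scaleDr : right_distributive pz_scale +%R;
  pz_scaleDl : forall v, {morph pz_scale^~ v : a b / a + b};
  pz_scaleMl : forall k x y, pz_scale k (x * y) = pz_scale k x * y;
  pz_scaleMr : forall k x y, pz_scale k (x * y) = x * pz_scale k y
}.

Definition pz_sort (K : comNzRingType) (A : pzAlg K) : Type := pz_ring A.
Coercion pz_sort : pzAlg >-> Sortclass.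

HB.instance Definition _ (K : comNzRingType) (A : pzAlg K) :=
  GRing.PzRing.copy (pz_sort A) (pz_ring A).
HB.instance Definition _ (K : comNzRingType) (A : pzAlg K) :=
  GRing.Zmodule_isLmodule.Build K (pz_sort A)
    (@pz_scaleA K A) (@pz_scale1 K A) (@pz_scaleDr K A) (@pz_scaleDl K A).

Section PzAlgTheory.
Variables (K : comNzRingType) (A : pzAlg K).
Lemma pz_scalerAl (k : K) (x y : A) : k *: (x * y) = (k *: x) * y.
Proof. exact: (@pz_scaleMl K A). Qed.
Lemma pz_scalerAr (k : K) (x y : A) : k *: (x * y) = x * (k *: y).
Proof. exact: (@pz_scaleMr K A). Qed.
End PzAlgTheory.

Definition alg_pzAlg (K : comNzRingType) (A : algType K) : pzAlg K :=
  @PzAlg K A (@GRing.scale K A) (@scalerA K A) (@scale1r K A) (@scalerDr K A)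
    (fun v a b => @scalerDl K A v a b) (@scalerAl K A) (@scalerAr K A).

(* Homomorphisms of algebras along a map sigma of the ground rings. *)
Definition semialg_morphism (K L : comNzRingType) (sigma : K -> L)
    (A : pzAlg K) (B : pzAlg L) (f : A -> B) : Prop :=
  [/\ zmod_morphism f, monoid_morphism f
    & forall (k : K) (x : A), f (k *: x) = sigma k *: f x].

Definition alg_morphism (K : comNzRingType) (A B : pzAlg K) (f : A -> B) :=
  semialg_morphism idfun f.

Definition spans (K : comNzRingType) (V : lmodType K) (B : set V) : Prop :=
  forall v : V, exists (s : seq V) (c : V -> K),
    (forall x, x \in s -> B x) /\ v = \sum_(x <- s) c x *: x.

Definition lin_indep (K : comNzRingType) (V : lmodType K) (B : set V) : Prop :=
  forall (s : seq V) (c : V -> K), uniq s -> (forall x, x \in s -> B x) ->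
    \sum_(x <- s) c x *: x = 0 -> forall x, x \in s -> c x = 0.

Definition free_module (K : comNzRingType) (V : lmodType K) : Prop :=
  exists B : set V, spans B /\ lin_indep B.

Section FreeAlgebra.
Variables (K : comNzRingType) (I : choiceType).

Lemma malg_scalerAr (k : K) (x y : {malg K[{fmonom I}]}) :
  k *: (x * y) = x * (k *: y).
Proof.
suff cC (c : K) (g : {malg K[{fmonom I}]}) : g * mkmalgU (monalg.one : {fmonom I}) c = c *: g.
  by rewrite -!cC mulrA.
rewrite -mul_malgC [LHS]fgmulgU [RHS]fgmulUg.
by apply: eq_bigr => m _; rewrite mulrC mul1m mulm1.
Qed.

Definition free_alg : pzAlg K :=
  @PzAlg K {malg K[{fmonom I}]} (@GRing.scale K {malg K[{fmonom I}]})
    (@scalerA K _) (@scale1r K _) (@scalerDr K _)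
    (fun v a b => @scalerDl K _ v a b)
    (@scalerAl K {malg K[{fmonom I}]}) malg_scalerAr.

Definition free_gen (i : I) : free_alg := << fmu i >>.

End FreeAlgebra.

Section QuotAlg.
Variables (K : comNzRingType) (A : pzAlg K) (S : set A).

Definition ideal_gen : set A := fun x =>
  exists s : seq (A * A * A), (forall t, t \in s -> S t.1.2) /\
    x = \sum_(t <- s) t.1.1 * t.1.2 * t.2.

Lemma ideal_gen0 : ideal_gen 0.
Proof. by exists [::]; rewrite big_nil. Qed.

Lemma ideal_genD x y : ideal_gen x -> ideal_gen y -> ideal_gen (x + y).
Proof.
move=> [s [hs ->]] [t [ht ->]]; exists (s ++ t); rewrite big_cat; split=> //.
by move=> u; rewrite mem_cat => /orP[/hs|/ht].
Qed.

Lemma ideal_genMl a x : ideal_gen x -> ideal_gen (a * x).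
Proof.
move=> [s [hs ->]]; exists [seq (a * t.1.1, t.1.2, t.2) | t <- s]; split.
  by move=> u /mapP[t /hs ? ->].
by rewrite big_map mulr_sumr; apply: eq_bigr => t _; rewrite !mulrA.
Qed.

Lemma ideal_genMr a x : ideal_gen x -> ideal_gen (x * a).
Proof.
move=> [s [hs ->]]; exists [seq (t.1.1, t.1.2, t.2 * a) | t <- s]; split.
  by move=> u /mapP[t /hs ? ->].
by rewrite big_map mulr_suml; apply: eq_bigr => t _; rewrite !mulrA.
Qed.

Lemma ideal_genN x : ideal_gen x -> ideal_gen (- x).
Proof. by rewrite -mulN1r; apply: ideal_genMl. Qed.

Lemma ideal_genZ k x : ideal_gen x -> ideal_gen (k *: x).
Proof. by rewrite -[x]mul1r pz_scalerAl => h; apply: ideal_genMl; rewrite -[x]mul1r. Qed.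

Lemma ideal_gen_sub x : S x -> ideal_gen x.
Proof.
move=> Sx; exists [:: (1, x, 1)]; rewrite big_seq1 /= mul1r mulr1; split=> //.
by move=> t; rewrite inE => /eqP->.
Qed.

Definition ideal_eqv : rel A := fun x y => `[< ideal_gen (x - y) >].

Lemma ideal_eqv_refl : reflexive ideal_eqv.
Proof. by move=> x; apply/asboolP; rewrite subrr; apply: ideal_gen0. Qed.
Lemma ideal_eqv_sym : symmetric ideal_eqv.
Proof.
by move=> x y; apply/asboolP/asboolP => /ideal_genN; rewrite opprB.
Qed.
Lemma ideal_eqv_trans : transitive ideal_eqv.
Proof.
move=> y x z /asboolP hx /asboolP hz; apply/asboolP.
by rewrite -(subrK y x) -addrA; apply: ideal_genD.
Qed.

Canonical ideal_equiv :=
  EquivRel ideal_eqv ideal_eqv_refl ideal_eqv_sym ideal_eqv_trans.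

Definition quot_carrier := {eq_quot ideal_equiv}.
HB.instance Definition _ := Choice.on quot_carrier.
HB.instance Definition _ := EqQuotient.on quot_carrier.

Definition qpi (x : A) : quot_carrier := \pi_quot_carrier x.

Lemma qpiP x y : qpi x = qpi y <-> ideal_gen (x - y).
Proof.
split; first by move/eqquotP/asboolP.
by move=> h; apply/eqquotP/asboolP.
Qed.

Lemma qpiK (x : quot_carrier) : qpi (repr x) = x.
Proof. exact: reprK. Qed.

Lemma repr_qpi x : ideal_gen (repr (qpi x) - x).
Proof. by apply/qpiP; rewrite qpiK. Qed.

Let zero : quot_carrier := qpi 0.
Let one : quot_carrier := qpi 1.
Let add (x y : quot_carrier) : quot_carrier := qpi (repr x + repr y).
Let opp (x : quot_carrier) : quot_carrier := qpi (- repr x).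
Let mul (x y : quot_carrier) : quot_carrier := qpi (repr x * repr y).
Let scl (k : K) (x : quot_carrier) : quot_carrier := qpi (k *: repr x).

Let addE x y : add (qpi x) (qpi y) = qpi (x + y).
Proof.
by apply/qpiP; rewrite opprD addrACA; apply: ideal_genD; apply: repr_qpi.
Qed.
Let oppE x : opp (qpi x) = qpi (- x).
Proof. by apply/qpiP; rewrite -opprD; apply/ideal_genN/repr_qpi. Qed.
Let mulE x y : mul (qpi x) (qpi y) = qpi (x * y).
Proof.
apply/qpiP; set x' := repr _; set y' := repr _.
have -> : x' * y' - x * y = (x' - x) * y' + x * (y' - y).
  by rewrite mulrBl mulrBr addrA subrK.
apply: ideal_genD; first exact/ideal_genMr/repr_qpi.
exact/ideal_genMl/repr_qpi.
Qed.
Let sclE k x : scl k (qpi x) = qpi (k *: x).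
Proof. by apply/qpiP; rewrite -scalerBr; apply/ideal_genZ/repr_qpi. Qed.

Let quot_ind (P : quot_carrier -> Prop) : (forall x, P (qpi x)) -> forall x, P x.
Proof. by move=> h x; rewrite -(qpiK x). Qed.

Let addA : associative add.
Proof. by do 3![elim/quot_ind => ?]; rewrite !addE addrA. Qed.
Let addC : commutative add.
Proof. by do 2![elim/quot_ind => ?]; rewrite !addE addrC. Qed.
Let add0 : left_id zero add.
Proof. by elim/quot_ind => ?; rewrite !addE add0r. Qed.
Let addN : left_inverse zero opp add.
Proof. by elim/quot_ind => ?; rewrite oppE !addE addNr. Qed.
Let mulA : associative mul.
Proof. by do 3![elim/quot_ind => ?]; rewrite !mulE mulrA. Qed.
Let mul1 : left_id one mul.
Proof. by elim/quot_ind => ?; rewrite !mulE mul1r. Qed.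
Let mulr1' : right_id one mul.
Proof. by elim/quot_ind => ?; rewrite !mulE mulr1. Qed.
Let mulDl : left_distributive mul add.
Proof. by do 3![elim/quot_ind => ?]; rewrite !(addE, mulE) mulrDl. Qed.
Let mulDr : right_distributive mul add.
Proof. by do 3![elim/quot_ind => ?]; rewrite !(addE, mulE) mulrDr. Qed.

HB.instance Definition _ := GRing.isPzRing.Build quot_carrier
  addA addC add0 addN mulA mul1 mulr1' mulDl mulDr.

Let sclA a b v : scl a (scl b v) = scl (a * b) v.
Proof. by elim/quot_ind: v => ?; rewrite !sclE scalerA. Qed.
Let scl1 : left_id 1 scl.
Proof. by elim/quot_ind => ?; rewrite !sclE scale1r. Qed.
Let sclDr : right_distributive scl +%R.
Proof.
move=> k; do 2![elim/quot_ind => ?].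
by rewrite /GRing.add /= !(addE, sclE) scalerDr.
Qed.
Let sclDl v : {morph scl^~ v : a b / a + b}.
Proof.
by elim/quot_ind: v => ? a b; rewrite [RHS]/GRing.add /= !(addE, sclE) scalerDl.
Qed.

Let sclAl (k : K) (x y : quot_carrier) : scl k (x * y) = scl k x * y.
Proof.
elim/quot_ind: x => x; elim/quot_ind: y => y.
by rewrite /GRing.mul /= !(mulE, sclE) pz_scalerAl.
Qed.
Let sclAr (k : K) (x y : quot_carrier) : scl k (x * y) = x * scl k y.
Proof.
elim/quot_ind: x => x; elim/quot_ind: y => y.
by rewrite /GRing.mul /= !(mulE, sclE) pz_scalerAr.
Qed.

Definition quot_alg : pzAlg K :=
  @PzAlg K quot_carrier scl sclA scl1 sclDr sclDl sclAl sclAr.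

Definition quot_pi : A -> quot_alg := qpi.

Lemma quot_pi_morphism : alg_morphism quot_pi.
Proof.
split; first by move=> x y; rewrite /GRing.add /GRing.opp /= oppE addE.
  by split=> // x y; rewrite /GRing.mul /= mulE.
by move=> k x; rewrite /GRing.scale /= sclE.
Qed.

Lemma quot_piP x y : quot_pi x = quot_pi y <-> ideal_gen (x - y).
Proof. exact: qpiP. Qed.

Lemma quot_piK (x : quot_alg) : quot_pi (repr (x : quot_carrier)) = x.
Proof. exact: qpiK. Qed.

Lemma quot_pi_surj (x : quot_alg) : exists a, x = quot_pi a.
Proof. by exists (repr (x : quot_carrier)); rewrite quot_piK. Qed.

Lemma quot_piD x y : quot_pi (x + y) = quot_pi x + quot_pi y.
Proof. by rewrite [RHS]/GRing.add /= addE. Qed.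
Lemma quot_piM x y : quot_pi (x * y) = quot_pi x * quot_pi y.
Proof. by rewrite [RHS]/GRing.mul /= mulE. Qed.
Lemma quot_piZ k x : quot_pi (k *: x) = k *: quot_pi x.
Proof. by rewrite [RHS]/GRing.scale /= sclE. Qed.

End QuotAlg.

(* The tensor product over K: formal sums of pairs, modulo the congruence
   generated by bilinearity. *)
Inductive tensor_eqv (K : comNzRingType) (A B : lmodType K) :
    seq (A * B) -> seq (A * B) -> Prop :=
| TensorRefl s : tensor_eqv s s
| TensorSym s t : tensor_eqv s t -> tensor_eqv t s
| TensorTrans s t u : tensor_eqv s t -> tensor_eqv t u -> tensor_eqv s u
| TensorCat s s' t t' :
    tensor_eqv s s' -> tensor_eqv t t' -> tensor_eqv (s ++ t) (s' ++ t')
| TensorCatC s t : tensor_eqv (s ++ t) (t ++ s)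
| TensorZero b : tensor_eqv [:: (0, b)] [::]
| TensorDl a a' b : tensor_eqv [:: (a + a', b)] [:: (a, b); (a', b)]
| TensorDr a b b' : tensor_eqv [:: (a, b + b')] [:: (a, b); (a, b')]
| TensorZ k a b : tensor_eqv [:: (k *: a, b)] [:: (a, k *: b)].

Section TensorModule.
Variables (K : comNzRingType) (A B : lmodType K).

Definition tensor_rel : rel (seq (A * B)) := fun s t => `[< tensor_eqv s t >].

Lemma tensor_rel_refl : reflexive tensor_rel.
Proof. by move=> s; apply/asboolP; apply: TensorRefl. Qed.
Lemma tensor_rel_sym : symmetric tensor_rel.
Proof. by move=> s t; apply/asboolP/asboolP; apply: TensorSym. Qed.
Lemma tensor_rel_trans : transitive tensor_rel.
Proof.
by move=> t s u /asboolP ? /asboolP ?; apply/asboolP; apply: TensorTrans; eauto.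
Qed.

Canonical tensor_equiv :=
  EquivRel tensor_rel tensor_rel_refl tensor_rel_sym tensor_rel_trans.

Definition tensor_carrier := {eq_quot tensor_equiv}.
HB.instance Definition _ := Choice.on tensor_carrier.
HB.instance Definition _ := EqQuotient.on tensor_carrier.

Let tpi (s : seq (A * B)) : tensor_carrier := \pi_tensor_carrier s.

Let tpiP s t : tpi s = tpi t <-> tensor_eqv s t.
Proof.
split; first by move/eqquotP/asboolP.
by move=> h; apply/eqquotP/asboolP.
Qed.
Let tpiK (x : tensor_carrier) : tpi (repr x) = x.
Proof. exact: reprK. Qed.
Let repr_tpi s : tensor_eqv (repr (tpi s)) s.
Proof. by apply/tpiP; rewrite tpiK. Qed.
Let tpi_ind (P : tensor_carrier -> Prop) :
  (forall s, P (tpi s)) -> forall x, P x.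
Proof. by move=> h x; rewrite -(tpiK x). Qed.

Let negs (s : seq (A * B)) := [seq (- p.1, p.2) | p <- s].

Let negs_eqv s t : tensor_eqv s t -> tensor_eqv (negs s) (negs t).
Proof.
elim=> [u|u v _|u v w _ ? _|u u' v v' _ ? _ ?|u v|b|a a' b|a b b'|k a b] /=.
- exact: TensorRefl.
- exact: TensorSym.
- exact: TensorTrans.
- by rewrite /negs !map_cat; apply: TensorCat.
- by rewrite /negs !map_cat; apply: TensorCatC.
- by rewrite oppr0; apply: TensorZero.
- by rewrite opprD; apply: TensorDl.
- exact: TensorDr.
- by rewrite -scalerN; apply: TensorZ.
Qed.

Let zero : tensor_carrier := tpi [::].
Let add (x y : tensor_carrier) : tensor_carrier := tpi (repr x ++ repr y).
Let opp (x : tensor_carrier) : tensor_carrier := tpi (negs (repr x)).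

Let addE s t : add (tpi s) (tpi t) = tpi (s ++ t).
Proof. by apply/tpiP/TensorCat; apply: repr_tpi. Qed.
Let oppE s : opp (tpi s) = tpi (negs s).
Proof. by apply/tpiP/negs_eqv/repr_tpi. Qed.

Let addA : associative add.
Proof. by do 3![elim/tpi_ind => ?]; rewrite !addE catA. Qed.
Let addC : commutative add.
Proof. by do 2![elim/tpi_ind => ?]; rewrite !addE; apply/tpiP/TensorCatC. Qed.
Let add0 : left_id zero add.
Proof. by elim/tpi_ind => ?; rewrite !addE. Qed.
Let addN : left_inverse zero opp add.
Proof.
have addACA w x y z : add (add w x) (add y z) = add (add w y) (add x z).
  by rewrite -!addA; congr add; rewrite !addA [add x y]addC.
elim/tpi_ind => s; rewrite oppE; elim: s => [|[a b] s ih]; first by rewrite addE.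
rewrite -[(a, b) :: s]cat1s /negs map_cat -!addE addACA ih addC add0 addE.
apply/tpiP; apply: (@TensorTrans _ _ _ _ [:: (0, b)]); last exact: TensorZero.
rewrite -(addNr a).
exact/TensorSym/TensorDl.
Qed.

HB.instance Definition _ :=
  GRing.isZmodule.Build tensor_carrier addA addC add0 addN.

Let pure (a : A) (b : B) : tensor_carrier := tpi [:: (a, b)].

Let pureE s : tpi s = \sum_(p <- s) pure p.1 p.2.
Proof.
elim: s => [|[a b] s ih]; first by rewrite big_nil.
by rewrite big_cons -ih /GRing.add /= addE.
Qed.

Definition balanced (U : zmodType) (f : A -> B -> U) : Prop :=
  [/\ forall a a' b, f (a + a') b = f a b + f a' b,
      forall a b b', f a (b + b') = f a b + f a b'
    & forall (k : K) a b, f (k *: a) b = f a (k *: b)].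

Let lift (U : nmodType) (f : A -> B -> U) (x : tensor_carrier) : U :=
  \sum_(p <- repr x) f p.1 p.2.

Let eqv_sum (U : zmodType) (f : A -> B -> U) s t : balanced f ->
  tensor_eqv s t -> \sum_(p <- s) f p.1 p.2 = \sum_(p <- t) f p.1 p.2.
Proof.
case=> fDl fDr fZ.
elim=> [u|u v _ -> //|u v w _ -> _ -> //|u u' v v' _ e _ e'|u v|b|a a' b|a b b'|k a b].
- by [].
- by rewrite !big_cat /= e e'.
- by rewrite !big_cat /= addrC.
- rewrite big_seq1 big_nil /=.
  by apply: (@addrI _ (f 0 b)); rewrite -fDl !addr0.
- by rewrite !big_cons !big_nil !addr0 /= fDl.
- by rewrite !big_cons !big_nil !addr0 /= fDr.
- by rewrite !big_seq1 /= fZ.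
Qed.

Let lift_tpi (U : zmodType) (f : A -> B -> U) s : balanced f ->
  lift f (tpi s) = \sum_(p <- s) f p.1 p.2.
Proof. by move=> fb; apply: eqv_sum => //; apply: repr_tpi. Qed.

Let liftD (U : zmodType) (f : A -> B -> U) x y : balanced f ->
  lift f (x + y) = lift f x + lift f y.
Proof.
move=> fb; elim/tpi_ind: x => s; elim/tpi_ind: y => t.
by rewrite {1}/GRing.add /= addE !lift_tpi // big_cat.
Qed.

Let lift_pure (U : zmodType) (f : A -> B -> U) a b : balanced f ->
  lift f (pure a b) = f a b.
Proof. by move=> fb; rewrite lift_tpi // big_seq1. Qed.

Let balanced_pure : balanced pure.
Proof.
split=> [a a' b|a b b'|k a b].
- by rewrite /GRing.add /= addE; apply/tpiP/TensorDl.
- by rewrite /GRing.add /= addE; apply/tpiP/TensorDr.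
- by apply/tpiP/TensorZ.
Qed.

Let scl (k : K) (x : tensor_carrier) := lift (fun a b => pure (k *: a) b) x.

Let balanced_scl k : balanced (fun a b => pure (k *: a) b).
Proof.
have [pDl pDr pZ] := balanced_pure.
split=> [a a' b|a b b'|l a b]; rewrite ?scalerDr ?pDl ?pDr //.
by rewrite scalerA mulrC -scalerA pZ.
Qed.

Let sclD : right_distributive scl +%R.
Proof. by move=> k x y; apply: liftD. Qed.
Let scl_pure k a b : scl k (pure a b) = pure (k *: a) b.
Proof. exact: lift_pure. Qed.

Let t_ind (P : tensor_carrier -> Prop) : P 0 ->
  (forall x y, P x -> P y -> P (x + y)) -> (forall a b, P (pure a b)) ->
  forall x, P x.
Proof.
move=> P0 PD Pp x; rewrite -(tpiK x) pureE.
by elim/big_ind: _ => // p _; apply: Pp.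
Qed.

Let scl0 k : scl k 0 = 0.
Proof. by apply: (@addrI _ (scl k 0)); rewrite -sclD // !addr0. Qed.

Let sclA a b v : scl a (scl b v) = scl (a * b) v.
Proof.
elim/t_ind: v => [|x y hx hy|c d]; first by rewrite !scl0.
  by rewrite !sclD // hx hy.
by rewrite !scl_pure scalerA.
Qed.
Let scl1 : left_id 1 scl.
Proof.
elim/t_ind => [|x y hx hy|c d]; first by rewrite !scl0.
  by rewrite !sclD // hx hy.
by rewrite !scl_pure scale1r.
Qed.
Let sclDl v : {morph scl^~ v : a b / a + b}.
Proof.
elim/t_ind: v => [|x y hx hy|c d] a b; first by rewrite !scl0 addr0.
  by rewrite !sclD // hx hy addrACA.
by rewrite !scl_pure scalerDl; case: balanced_pure => ->.
Qed.

HB.instance Definition _ := GRing.Zmodule_isLmodule.Build K tensor_carrier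
  sclA scl1 sclD sclDl.

Definition tensor_pure := pure.
Definition tensor_lift := lift.

Lemma tensor_lift_pure (U : zmodType) (f : A -> B -> U) a b : balanced f ->
  tensor_lift f (tensor_pure a b) = f a b.
Proof. exact: lift_pure. Qed.
Lemma tensor_liftD (U : zmodType) (f : A -> B -> U) x y : balanced f ->
  tensor_lift f (x + y) = tensor_lift f x + tensor_lift f y.
Proof. exact: liftD. Qed.
Lemma tensor_pure_balanced : balanced tensor_pure.
Proof. exact: balanced_pure. Qed.
Lemma tensor_scale_pure k a b :
  k *: tensor_pure a b = tensor_pure (k *: a) b.
Proof. exact: scl_pure. Qed.
Lemma tensor_ind (P : tensor_carrier -> Prop) : P 0 ->
  (forall x y, P x -> P y -> P (x + y)) -> (forall a b, P (tensor_pure a b)) ->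
  forall x, P x.
Proof. exact: t_ind. Qed.

End TensorModule.

Section TensorAlgebra.
Variables (K : comNzRingType) (A B : pzAlg K).

Local Notation T := (tensor_carrier A B).
Let pr (a : A) (b : B) : T := tensor_pure a b.

Let prDl a a' b : pr (a + a') b = pr a b + pr a' b.
Proof. by case: (tensor_pure_balanced A B). Qed.
Let prDr a b b' : pr a (b + b') = pr a b + pr a b'.
Proof. by case: (tensor_pure_balanced A B). Qed.
Let prZ (k : K) a b : pr (k *: a) b = pr a (k *: b).
Proof. by case: (tensor_pure_balanced A B). Qed.

Let lmul (a : A) (b : B) (y : T) : T :=
  tensor_lift (fun (c : A) (d : B) => pr (a * c) (b * d)) y.

Let one : T := pr 1 1.
Let mul (x y : T) : T := tensor_lift (fun a b => lmul a b y) x.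

Let balanced_lmul a b : balanced (fun (c : A) (d : B) => pr (a * c) (b * d)).
Proof.
split=> [c c' d|c d d'|k c d]; rewrite ?mulrDr ?prDl ?prDr //.
by rewrite -!pz_scalerAr prZ.
Qed.

Let lmulD a b y z : lmul a b (y + z) = lmul a b y + lmul a b z.
Proof. exact/tensor_liftD/balanced_lmul. Qed.
Let lmul0 a b : lmul a b 0 = 0.
Proof. by apply: (@addrI _ (lmul a b 0)); rewrite -lmulD !addr0. Qed.
Let lmul_pr a b c d : lmul a b (pr c d) = pr (a * c) (b * d).
Proof. exact/tensor_lift_pure/balanced_lmul. Qed.

Let balanced_mul y : balanced (fun (a : A) (b : B) => lmul a b y).
Proof.
split=> [a a' b|a b b'|k a b]; elim/tensor_ind: y => [|y z hy hz|c d];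
  rewrite ?lmul0 ?addr0 ?lmulD ?hy ?hz 1?addrACA // !lmul_pr.
- by rewrite mulrDl prDl.
- by rewrite mulrDl prDr.
- by rewrite -!pz_scalerAl prZ.
Qed.

Let mulDl : left_distributive mul +%R.
Proof. by move=> x y z; apply: tensor_liftD; apply: balanced_mul. Qed.
Let mul_pr a b y : mul (pr a b) y = lmul a b y.
Proof. by apply: tensor_lift_pure; apply: balanced_mul. Qed.
Let mul0 y : mul 0 y = 0.
Proof. by apply: (@addrI _ (mul 0 y)); rewrite -mulDl !addr0. Qed.
Let mulDr : right_distributive mul +%R.
Proof.
move=> x y z; elim/tensor_ind: x => [|u v hu hv|a b].
- by rewrite !mul0 addr0.
- by rewrite !mulDl hu hv addrACA.
- by rewrite !mul_pr lmulD.
Qed.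
Let mulr0' x : mul x 0 = 0.
Proof. by apply: (@addrI _ (mul x 0)); rewrite -mulDr !addr0. Qed.

Let mulA : associative mul.
Proof.
move=> x y z; elim/tensor_ind: x => [|u v hu hv|a b]; rewrite ?mul0 //.
  by rewrite !mulDl hu hv.
elim/tensor_ind: y => [|u v hu hv|c d]; rewrite ?(mul0, mulr0') //.
  by rewrite !(mulDl, mulDr) hu hv.
elim/tensor_ind: z => [|u v hu hv|e f]; rewrite ?(mul0, mulr0') //.
  by rewrite !mulDr hu hv.
by rewrite !mul_pr !lmul_pr !mul_pr !lmul_pr !mulrA.
Qed.
Let mul1 : left_id one mul.
Proof.
elim/tensor_ind => [|u v hu hv|a b]; first by rewrite mulr0'.
  by rewrite mulDr hu hv.
by rewrite mul_pr lmul_pr !mul1r.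
Qed.
Let mulr1' : right_id one mul.
Proof.
elim/tensor_ind => [|u v hu hv|a b]; first by rewrite mul0.
  by rewrite mulDl hu hv.
by rewrite mul_pr lmul_pr !mulr1.
Qed.

HB.instance Definition _ := GRing.Zmodule_isPzRing.Build T
  mulA mul1 mulr1' mulDl mulDr.

Let sclAl (k : K) (x y : T) : k *: (x * y) = (k *: x) * y.
Proof.
elim/tensor_ind: x => [|u v hu hv|a b]; first by rewrite scaler0 !mul0r scaler0.
  by rewrite scalerDr !mulrDl scalerDr hu hv.
elim/tensor_ind: y => [|u v hu hv|c d]; first by rewrite !mulr0 scaler0.
  by rewrite !mulrDr scalerDr hu hv.
rewrite tensor_scale_pure /GRing.mul /= !mul_pr !lmul_pr.
by rewrite tensor_scale_pure pz_scalerAl.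
Qed.
Let sclAr (k : K) (x y : T) : k *: (x * y) = x * (k *: y).
Proof.
elim/tensor_ind: x => [|u v hu hv|a b]; first by rewrite !mul0r scaler0.
  by rewrite !mulrDl scalerDr hu hv.
elim/tensor_ind: y => [|u v hu hv|c d]; first by rewrite !scaler0 mulr0 scaler0.
  by rewrite !(scalerDr, mulrDr) hu hv.
rewrite tensor_scale_pure /GRing.mul /= !mul_pr !lmul_pr.
by rewrite tensor_scale_pure pz_scalerAr.
Qed.

Definition tensor : pzAlg K :=
  @PzAlg K T *:%R (@scalerA K T) (@scale1r K T) (@scalerDr K T)
    (fun v a b => @scalerDl K T v a b) sclAl sclAr.

Definition tens (a : A) (b : B) : tensor := tensor_pure a b.

(* The additive map sending a (x) b to f a b; meaningful when f is balanced. *)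
Definition tlift (U : zmodType) (f : A -> B -> U) (x : tensor) : U :=
  tensor_lift f x.

Lemma tlift_tens (U : zmodType) (f : A -> B -> U) a b :
  balanced f -> tlift f (tens a b) = f a b.
Proof. exact: tensor_lift_pure. Qed.

Lemma tliftD (U : zmodType) (f : A -> B -> U) x y :
  balanced f -> tlift f (x + y) = tlift f x + tlift f y.
Proof. exact: tensor_liftD. Qed.

Lemma tens_balanced : balanced tens.
Proof. exact: tensor_pure_balanced. Qed.

Lemma tens_mul a b c d : tens a b * tens c d = tens (a * c) (b * d).
Proof. by rewrite [LHS]mul_pr lmul_pr. Qed.

Lemma tens_ind (P : tensor -> Prop) : P 0 ->
  (forall x y, P x -> P y -> P (x + y)) -> (forall a b, P (tens a b)) ->
  forall x, P x.
Proof. exact: tensor_ind. Qed.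

End TensorAlgebra.

Notation "a \ox b" := (tens a b) (at level 40, left associativity) : ring_scope.

Definition tmap (K L : comNzRingType) (A B : pzAlg K) (A' B' : pzAlg L)
    (f : A -> A') (g : B -> B') : tensor A B -> tensor A' B' :=
  tlift (fun a b => f a \ox g b).

Definition tassoc (K : comNzRingType) (A B C : pzAlg K) :
    tensor (tensor A B) C -> tensor A (tensor B C) :=
  tlift (fun x c => tlift (fun a b => a \ox (b \ox c)) x).

Section HopfComodule.
Variables (K : comNzRingType) (H : pzAlg K).

Record hopf_algebra (Delta : H -> tensor H H) (eps : H -> K) (S : H -> H) : Prop
    := HopfAlgebra {
  comul_morphism : alg_morphism Delta;
  counit_morphism : @alg_morphism K H (alg_pzAlg K^o) eps;
  antipode_linear : linear S;
  comulA : forall h, tassoc (tmap Delta id (Delta h)) = tmap id Delta (Delta h);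
  counitl : forall h, tlift (fun a b => eps a *: b) (Delta h) = h;
  counitr : forall h, tlift (fun a b => eps b *: a) (Delta h) = h;
  antipodel : forall h, tlift (fun a b => S a * b) (Delta h) = eps h *: (1 : H);
  antipoder : forall h, tlift (fun a b => a * S b) (Delta h) = eps h *: (1 : H)
}.

Record comodule_algebra (Delta : H -> tensor H H) (eps : H -> K)
    (A : pzAlg K) (phi : A -> tensor A H) : Prop := ComoduleAlgebra {
  coaction_morphism : alg_morphism phi;
  coactionA : forall a, tassoc (tmap phi id (phi a)) = tmap id Delta (phi a);
  coaction1 : forall a, tlift (fun b h => eps h *: b) (phi a) = a
}.

End HopfComodule.

Section GroundRing.
Variable C : fieldType.

Definition regular_at1 : {pred {fraction {poly C}}} := fun x =>
  `[< exists p d : {poly C}, d.[1] != 0 /\ x = tofrac p / tofrac d >].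

Fact regular_at1_subring : subring_closed regular_at1.
Proof.
have d0 (d : {poly C}) : d.[1] != 0 -> tofrac d != 0 :> {fraction {poly C}}.
  by rewrite tofrac_eq0; apply: contraNneq => ->; rewrite horner0.
split.
- by apply/asboolP; exists 1, 1; rewrite hornerC oner_eq0 divr1.
- move=> _ _ /asboolP[p [d [hd ->]]] /asboolP[r [e [he ->]]]; apply/asboolP.
  exists (p * e - r * d), (d * e); rewrite hornerM mulf_neq0 //; split=> //.
  rewrite !tofracM !tofracB !tofracM -[- (_ / _)]mulNr addf_div ?d0 //.
  by rewrite mulNr.
- move=> _ _ /asboolP[p [d [hd ->]]] /asboolP[r [e [he ->]]]; apply/asboolP.
  exists (p * r), (d * e); rewrite hornerM mulf_neq0 //; split=> //.
  by rewrite !tofracM mulf_div.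
Qed.

HB.instance Definition _ := GRing.isSubringClosed.Build _ regular_at1
  regular_at1_subring.

(* The ring of rational functions in q with no pole at q = 1. *)
Record Kq := MkKq { kq_val : {fraction {poly C}}; _ : kq_val \in regular_at1 }.

HB.instance Definition _ := [isSub for kq_val].
HB.instance Definition _ := [Choice of Kq by <:].
HB.instance Definition _ := [SubChoice_isSubComNzRing of Kq by <:].

Lemma kq_valB (x y : Kq) : kq_val (x - y) = kq_val x - kq_val y.
Proof. exact: (rmorphB val). Qed.
Lemma kq_valM (x y : Kq) : kq_val (x * y) = kq_val x * kq_val y.
Proof. exact: (rmorphM val). Qed.

Lemma kq_fracP (x : Kq) :
  {pd : {poly C} * {poly C} |
    pd.2.[1] != 0 /\ kq_val x = tofrac pd.1 / tofrac pd.2}.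
Proof.
apply: cid; case: x => x /= /asboolP[p [d h]]; by exists (p, d).
Qed.

(* The value at q = 1; see kq_ev1E for the independence of the fraction. *)
Definition kq_ev1 (x : Kq) : C :=
  (sval (kq_fracP x)).1.[1] / (sval (kq_fracP x)).2.[1].

Lemma kq_ev1E (x : Kq) (p d : {poly C}) : d.[1] != 0 ->
  kq_val x = tofrac p / tofrac d -> kq_ev1 x = p.[1] / d.[1].
Proof.
rewrite /kq_ev1; case: kq_fracP => -[r e] /= [he ->] hd.
have d0 (a : {poly C}) : a.[1] != 0 -> tofrac a != 0 :> {fraction {poly C}}.
  by rewrite tofrac_eq0; apply: contraNneq => ->; rewrite horner0.
move/eqP; rewrite eqr_div ?d0 // -!tofracM tofrac_eq => /eqP h.
by apply/eqP; rewrite eqr_div // -!hornerM h.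
Qed.

Fact kq_ev1_zmod : zmod_morphism kq_ev1.
Proof.
have d0 (a : {poly C}) : a.[1] != 0 -> tofrac a != 0 :> {fraction {poly C}}.
  by rewrite tofrac_eq0; apply: contraNneq => ->; rewrite horner0.
move=> x y; have [[p d] /= [hd ex]] := kq_fracP x.
have [[r e] /= [he ey]] := kq_fracP y.
rewrite (kq_ev1E hd ex) (kq_ev1E he ey).
rewrite (@kq_ev1E _ (p * e - r * d) (d * e)).
- by rewrite !hornerE -[- (_ / _)]mulNr addf_div // mulNr.
- by rewrite hornerM mulf_neq0.
- rewrite kq_valB ex ey.
  by rewrite !tofracM !tofracB !tofracM -[- (_ / _)]mulNr addf_div ?d0 // mulNr.
Qed.

Fact kq_ev1_monoid : monoid_morphism kq_ev1.
Proof.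
split.
  have e1 : kq_val 1 = tofrac (1%:P : {poly C}) / tofrac (1%:P : {poly C}).
    by rewrite polyC1 tofrac1 divr1 [LHS](rmorph1 val).
  by rewrite (kq_ev1E _ e1) !hornerC ?divr1 ?oner_eq0.
move=> x y; have [[p d] /= [hd ex]] := kq_fracP x.
have [[r e] /= [he ey]] := kq_fracP y.
rewrite (kq_ev1E hd ex) (kq_ev1E he ey) (@kq_ev1E _ (p * r) (d * e)).
- by rewrite !hornerM mulf_div.
- by rewrite hornerM mulf_neq0.
- by rewrite kq_valM ex ey !tofracM mulf_div.
Qed.

HB.instance Definition _ := GRing.isZmodMorphism.Build Kq C kq_ev1 kq_ev1_zmod.
HB.instance Definition _ :=
  GRing.isMonoidMorphism.Build Kq C kq_ev1 kq_ev1_monoid.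

Definition kq_unit : {pred Kq} := fun x =>
  (kq_val x != 0) && ((kq_val x)^-1 \in regular_at1).
Definition kq_inv (x : Kq) : Kq := insubd x (kq_val x)^-1.

Fact kq_mulVr : {in kq_unit, left_inverse 1 kq_inv *%R}.
Proof.
move=> x /andP[x0 xV]; apply: val_inj.
rewrite [LHS]kq_valM [RHS](rmorph1 val) /kq_inv.
by rewrite [X in X * _](insubdK x xV) mulVf.
Qed.
Fact kq_unitPl (x y : Kq) : y * x = 1 -> x \in kq_unit.
Proof.
move/(congr1 kq_val); rewrite kq_valM [RHS](rmorph1 val) => yx.
have x0 : kq_val x != 0.
  by apply: contra_eq_neq yx => ->; rewrite mulr0 eq_sym oner_eq0.
apply/andP; split=> //; suff -> : (kq_val x)^-1 = kq_val y by case: y {yx}.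
by rewrite -[LHS]mul1r -yx mulfK.
Qed.
Fact kq_inv_out : {in [predC kq_unit], kq_inv =1 id}.
Proof.
move=> x; rewrite inE /= /kq_unit unfold_in negb_and negbK => /orP[/eqP x0|xV].
  by apply: val_inj; rewrite val_insubd /= x0 invr0 if_same.
by rewrite /kq_inv /insubd insubN.
Qed.

HB.instance Definition _ := GRing.ComNzRing_hasMulInverse.Build Kq
  kq_mulVr kq_unitPl kq_inv_out.

Fact kq_q_subproof : tofrac 'X \in regular_at1.
Proof.
by apply/asboolP; exists 'X, 1; rewrite hornerC oner_eq0 tofrac1 divr1.
Qed.
Definition kq_q : Kq := MkKq kq_q_subproof.

Lemma kq_q_unit : kq_q \is a GRing.unit.
Proof.
rewrite qualifE /= /kq_unit /= tofrac_eq0 polyX_eq0 /=.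
by apply/asboolP; exists 1, 'X; rewrite hornerX oner_eq0 tofrac1 mul1r.
Qed.

End GroundRing.

Definition entries (T : Type) (m p : nat) (M : 'M[T]_(m, p)) : set T :=
  fun z => exists i j, z = M i j.

Section QuantumMatrices.
Variables (C : fieldType) (n : nat).
Local Notation K := (Kq C).
Local Notation q := (kq_q C).

Definition Rcoef (i s j t : 'I_n) : K :=
  if [&& i == j, j == s & s == t] then q
  else if [&& i == j, s == t & i != s] then 1
  else if [&& (j < i)%N, i == t & j == s] then q - q^-1
  else 0.

(* The flip composed with R: the coefficient of e_s (x) e_i in the image of
   e_j (x) e_t is R^{is}_{jt}. *)
Definition Rhat : 'M[K]_(n * n) :=
  \matrix_(u, v) let: (s, i) := mxtens_unindex u in
                 let: (j, t) := mxtens_unindex v in Rcoef i s j t.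

Definition Rhat_in (A : pzAlg K) : 'M[A]_(n * n) :=
  map_mx (fun k : K => k *: (1 : A)) Rhat.

Definition gen_mx : 'M[free_alg K ('I_n * 'I_n)%type]_n :=
  \matrix_(i, j) free_gen K (i, j).

(* The row index (i, s) of a matrix on K^n (x) K^n stands for e_i (x) e_s. *)
Definition FqM_rels : set (free_alg K ('I_n * 'I_n)%type) :=
  let X1 := gen_mx *t 1%:M in let X2 := 1%:M *t gen_mx in
  entries (Rhat_in _ *m X1 *m X2 - X1 *m X2 *m Rhat_in _).

Definition FqM : pzAlg K := quot_alg FqM_rels.

Definition xq (i j : 'I_n) : FqM := quot_pi FqM_rels (gen_mx i j).

Definition perm_length (s : 'S_n) : nat :=
  #|[set p : 'I_n * 'I_n | (p.1 < p.2)%N && (s p.2 < s p.1)%N]|.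

Definition qdet : FqM :=
  \sum_(s : 'S_n) (- q) ^+ perm_length s *: \prod_(i < n) xq i (s i).

Definition FqG_rels : set FqM := [set qdet - 1].

Definition FqG : pzAlg K := quot_alg FqG_rels.

Definition tq (i j : 'I_n) : FqG := quot_pi FqG_rels (xq i j).

(* At most one triple satisfies this: Delta and eps are algebra homomorphisms,
   hence determined on generators, and an antipode is unique. *)
Definition FqG_hopf (Delta : FqG -> tensor FqG FqG) (eps : FqG -> K)
    (S : FqG -> FqG) : Prop :=
  [/\ hopf_algebra Delta eps S,
      forall i j, Delta (tq i j) = \sum_(s < n) tq i s \ox tq s j
    & forall i j, eps (tq i j) = (i == j)%:R].

Definition LqM_rels : set (free_alg K ('I_n * 'I_n)%type) :=
  let L2 := 1%:M *t gen_mx in let Rh := Rhat_in _ in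
  entries (Rh *m L2 *m Rh *m L2 - L2 *m Rh *m L2 *m Rh).

Definition LqM : pzAlg K := quot_alg LqM_rels.

Definition lq : 'M[LqM]_n := \matrix_(i, j) quot_pi LqM_rels (gen_mx i j).

Definition adjoint_coaction (S : FqG -> FqG) (beta : LqM -> tensor LqM FqG) :
    Prop :=
  alg_morphism beta /\
  forall i j, beta (lq i j) =
    \sum_(a < n) \sum_(b < n) lq a b \ox (S (tq i a) * tq b j).

(* Indices start at 0 here, hence i.+1 in the exponent n + 1 - 2 i. *)
Definition qtrace (V : lmodType K) (A : 'M[V]_n) : V :=
  \sum_(i < n) q ^ (n.+1%:Z - (2 * i.+1)%:Z) *: A i i.

Definition FqN_rels : set LqM :=
  fun z => exists d : nat, (1 <= d <= n)%N /\ z = qtrace (lq ^+ d).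

Definition FqN : pzAlg K := quot_alg FqN_rels.

End QuantumMatrices.

Section CoordinateRing.
Variables (C : fieldType) (n : nat).

Definition mx_eval (x : 'M[C]_n) (p : {mpoly C[n * n]}) : C :=
  p.@[fun k => mxvec x 0 k].

Definition vanishing (V : set 'M[C]_n) : set (alg_pzAlg {mpoly C[n * n]}) :=
  fun p => forall x, V x -> mx_eval x p = 0.

(* The coordinate ring of a closed subvariety V of the space of matrices. *)
Definition coord_ring (V : set 'M[C]_n) : pzAlg C := quot_alg (vanishing V).

Definition coord (V : set 'M[C]_n) (i j : 'I_n) : coord_ring V :=
  quot_pi (vanishing V) ('X_(mxvec_index i j) : {mpoly C[n * n]}).

Definition coord_ev (V : set 'M[C]_n) (f : coord_ring V) (x : 'M[C]_n) : C :=
  mx_eval x (repr (f : quot_carrier (vanishing V))).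

Definition SLset : set 'M[C]_n := [set g | \det g = 1].

Definition nilpotent_set : set 'M[C]_n := [set x | exists k : nat, x ^+ k = 0].

(* An element of the tensor product as a function on V x SL_n. *)
Definition coord_ev2 (V : set 'M[C]_n)
    (x : tensor (coord_ring V) (coord_ring SLset)) (v g : 'M[C]_n) : C :=
  tlift (fun a b => coord_ev a v * coord_ev b g) x.

Lemma mx_evalD x p r : mx_eval x (p + r) = mx_eval x p + mx_eval x r.
Proof. exact: mevalD. Qed.
Lemma mx_evalM x p r : mx_eval x (p * r) = mx_eval x p * mx_eval x r.
Proof. exact: mevalM. Qed.
Lemma mx_evalZ x c p : mx_eval x (c *: p) = c * mx_eval x p.
Proof. exact: mevalZ. Qed.
Lemma mx_evalX x i j : mx_eval x 'X_(mxvec_index i j) = x i j.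
Proof. by rewrite /mx_eval mevalXU mxvecE. Qed.

Section Evaluation.
Variables (V : set 'M[C]_n) (x : 'M[C]_n).
Hypothesis Vx : V x.

Lemma coord_ev_pi p : coord_ev (quot_pi (vanishing V) p) x = mx_eval x p.
Proof.
have [s [hs e]] := repr_qpi (vanishing V) p.
apply/eqP; rewrite -subr_eq0 -[_ - _]mevalB [X in meval _ X]e.
rewrite raddf_sum big_seq big1 //= => t /hs /(_ x Vx) et.
rewrite [LHS]mevalM [X in X * _]mevalM.
by rewrite [X in _ * X * _]et mulr0 mul0r.
Qed.

Lemma coord_evD (f g : coord_ring V) :
  coord_ev (f + g) x = coord_ev f x + coord_ev g x.
Proof.
have [p ->] := quot_pi_surj f; have [r ->] := quot_pi_surj g.
by rewrite -quot_piD !coord_ev_pi mx_evalD.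
Qed.
Lemma coord_evM (f g : coord_ring V) :
  coord_ev (f * g) x = coord_ev f x * coord_ev g x.
Proof.
have [p ->] := quot_pi_surj f; have [r ->] := quot_pi_surj g.
by rewrite -quot_piM !coord_ev_pi mx_evalM.
Qed.
Lemma coord_evZ (c : C) (f : coord_ring V) :
  coord_ev (c *: f) x = c * coord_ev f x.
Proof.
by have [p ->] := quot_pi_surj f; rewrite -quot_piZ !coord_ev_pi mx_evalZ.
Qed.
Lemma coord_ev_coord i j : coord_ev (coord V i j) x = x i j.
Proof. by rewrite coord_ev_pi mx_evalX. Qed.
End Evaluation.

Section Coaction.
Variable V : set 'M[C]_n.
Local Notation F2 := (tensor (coord_ring V) (coord_ring SLset)).

Section Evaluation2.
Variables (v g : 'M[C]_n).
Hypotheses (Vv : V v) (SLg : SLset g).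

Let ev_balanced :
  balanced (fun (a : coord_ring V) (b : coord_ring SLset) =>
              coord_ev a v * coord_ev b g).
Proof.
split=> [a a' b|a b b'|k a b]; rewrite ?coord_evD ?coord_evZ //.
- by rewrite mulrDl.
- by rewrite mulrDr.
- by rewrite mulrCA mulrA.
Qed.

Lemma coord_ev2_tens (a : coord_ring V) (b : coord_ring SLset) :
  coord_ev2 (a \ox b) v g = coord_ev a v * coord_ev b g.
Proof. exact: tlift_tens. Qed.

Lemma coord_ev2D (x y : F2) :
  coord_ev2 (x + y) v g = coord_ev2 x v g + coord_ev2 y v g.
Proof. exact: tliftD. Qed.

Lemma coord_ev20 : coord_ev2 (0 : F2) v g = 0.
Proof.
by apply: (@addrI _ (coord_ev2 (0 : F2) v g)); rewrite -coord_ev2D !addr0.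
Qed.

Lemma coord_ev2M (x y : F2) :
  coord_ev2 (x * y) v g = coord_ev2 x v g * coord_ev2 y v g.
Proof.
elim/tens_ind: x => [|x1 x2 h1 h2|a b]; first by rewrite mul0r coord_ev20 mul0r.
  by rewrite mulrDl !coord_ev2D h1 h2 mulrDl.
elim/tens_ind: y => [|y1 y2 h1 h2|c d]; first by rewrite mulr0 coord_ev20 mulr0.
  by rewrite mulrDr !coord_ev2D h1 h2 mulrDr.
rewrite tens_mul !coord_ev2_tens !coord_evM //.
by rewrite mulrACA.
Qed.

Lemma coord_ev2_sum (I : Type) (r : seq I) (F : I -> F2) :
  coord_ev2 (\sum_(i <- r) F i) v g = \sum_(i <- r) coord_ev2 (F i) v g.
Proof.
by elim: r => [|i r ih]; rewrite ?big_nil ?coord_ev20 // !big_cons coord_ev2D ih.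
Qed.
End Evaluation2.

(* The comorphism of the action (v, g) |-> g^-1 v g exists. *)
Lemma conj_comorphism (p : {mpoly C[n * n]}) :
  exists x : F2, forall v g, V v -> SLset g ->
    coord_ev2 x v g = mx_eval (invmx g *m v *m g) p.
Proof.
pose P p := exists x : F2, forall v g, V v -> SLset g ->
  coord_ev2 x v g = mx_eval (invmx g *m v *m g) p.
have Pc c : P c%:MP.
  exists ((c *: (1 : coord_ring V)) \ox (1 : coord_ring SLset)) => v g Vv Sg.
  rewrite coord_ev2_tens //.
  have one1 (W : set 'M[C]_n) x : W x -> coord_ev (1 : coord_ring W) x = 1.
    by move=> Wx; rewrite (coord_ev_pi Wx 1) [LHS]meval1.
  by rewrite coord_evZ // !one1 // !mulr1 [RHS]mevalC.
have PD a b : P a -> P b -> P (a + b).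
  move=> [x hx] [y hy]; exists (x + y) => v g Vv Sg.
  by rewrite coord_ev2D // hx // hy // mx_evalD.
have PM a b : P a -> P b -> P (a * b).
  move=> [x hx] [y hy]; exists (x * y) => v g Vv Sg.
  by rewrite coord_ev2M // hx // hy // mx_evalM.
have PX k : P 'X_k.
  case/mxvec_indexP: k => i j.
  pose Y : 'M[{mpoly C[n * n]}]_n := \matrix_(a, b) 'X_(mxvec_index a b).
  exists (\sum_a \sum_b
    (coord V a b \ox (quot_pi (vanishing SLset) (\adj Y i a) * coord SLset b j))).
  move=> v g Vv Sg; rewrite mx_evalX coord_ev2_sum //.
  have gu : g \in unitmx by rewrite unitmxE Sg unitr1.
  have eY : map_mx (meval (fun k => mxvec g 0 k)) Y = g.
    by apply/matrixP => a b; rewrite !mxE [LHS]mx_evalX.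
  rewrite -mulmxA mxE; apply: eq_bigr => a _.
  rewrite [X in _ = _ * X]mxE coord_ev2_sum // mulr_sumr; apply: eq_bigr => b _.
  rewrite coord_ev2_tens // coord_evM // !coord_ev_coord // coord_ev_pi //.
  have -> : mx_eval g (\adj Y i a) = invmx g i a.
    by rewrite /invmx gu Sg invr1 scale1r -{2}eY -map_mx_adj [RHS]mxE.
  by rewrite mulrCA.
elim/mpolyind: p => [|c m p _ _ hp]; first by rewrite -mpolyC0; apply: Pc.
apply: (PD) => //; rewrite -mul_mpolyC; apply: (PM); first exact: Pc.
rewrite mpolyXE_id; apply: (big_ind P) => [||k _]; first by rewrite -mpolyC1.
  exact: (PM).
by elim: (m k) => [|e he]; rewrite ?expr0 -?mpolyC1 // exprS; apply: (PM).
Qed.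

Definition conj_coaction_exists (f : coord_ring V) :
  exists x : F2, forall v g, V v -> SLset g ->
    coord_ev2 x v g = coord_ev f (invmx g *m v *m g) :=
  conj_comorphism _.

(* The coaction dual to the action of SL_n on V by (v, g) |-> g^-1 v g.  The
   element is unique, as elements of the tensor product are determined by their
   values on V x SL_n. *)
Definition conj_coaction (f : coord_ring V) : F2 :=
  sval (cid (conj_coaction_exists f)).

End Coaction.
End CoordinateRing.

Section QuantumDeformation.
Variables (C : fieldType) (n : nat).
Local Notation K := (Kq C).

Definition q1_rels (A : pzAlg K) : set A := [set (kq_q C - 1) *: (1 : A)].

(* The values on the generators determine piG, the natural surjection from the
   quantized to the classical coordinate ring of SL_n. *)
Definition natural_surjection_G (piG : FqG C n -> coord_ring (@SLset C n)) :
    Prop :=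
  semialg_morphism (@kq_ev1 C) piG /\ forall i j, piG (tq C i j) = coord _ i j.

Record quantum_deformation
    (Delta : FqG C n -> tensor (FqG C n) (FqG C n)) (eps : FqG C n -> K)
    (A : pzAlg C) (delta : A -> tensor A (coord_ring (@SLset C n)))
    (Aq : pzAlg K) (phi : Aq -> tensor Aq (FqG C n)) : Prop :=
  QuantumDeformation {
    qdef_comodule : comodule_algebra Delta eps phi;
    qdef_free : free_module Aq;
    qdef_classical :
      exists (psi : quot_alg (@q1_rels Aq) -> A)
             (piG : FqG C n -> coord_ring (@SLset C n)),
        [/\ semialg_morphism (@kq_ev1 C) psi,
            bijective psi,
            natural_surjection_G piG
          & forall x : Aq,
              tmap (fun y => psi (quot_pi (@q1_rels Aq) y)) piG (phi x) =
              delta (psi (quot_pi (@q1_rels Aq) x))]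
  }.

End QuantumDeformation.

(* Main.v *)
From HB Require Import structures.
From mathcomp Require Import finmap monalg mpoly.
From mathcomp Require Import all_boot all_order all_algebra fingroup perm.
From mathcomp Require Import fraction generic_quotient.
From mathcomp Require Import boolp classical_sets reals complex mxtens.
From mathcomp Require Import ring.
Require Import Defs.

(** Put h = q - 1, and write l_ij for the generators of the reflection equation
    algebra and Z_d = Tr_q(L^d).

    The coaction. If T is a solution of the RTT relation with inverse V = S(T), then
    V L T again solves the reflection equation (RE_conj), so beta exists; the square
    of the antipode is conjugation by the weights of the quantum trace
    (twisted_inverse), so the Z_d are coinvariant (qtrace_conj) and beta descends.
    Taking partial quantum traces of a shifted form of the reflection equation shows
    that the Z_d are central (qtrace_comm); the ideal that they generate therefore
    consists of the combinations sum_d a_d Z_d.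

    Flatness before the quotient. Modulo h the l_ij commute (entry_swap), so ordered
    words span each filtration step by Nakayama's lemma (pbw_span). The algebra has
    no h-torsion (LqM_torsion_free), because it has enough representations: starting
    from L = 1, a solution L on a space yields the solution Rhat L_2 Rhat on this
    space enlarged by one tensor factor (RE_next_RE). All these solutions have the
    form 1 + h Y, and passing to the next one adds 2 E_ji to Y_ij modulo h, so
    suitable functionals tell apart, modulo h, the ordered words in Y (detectsS).
    Hence the ordered words in the l_ij - delta_ij are independent.

    The classical input has two parts. The traces z_d = tr X^d of the generic matrix,
    d = 1, ..., n, have only trivial relations, and the determinant f of the Krylov
    vectors e_0, X e_0, ..., X^(n-1) e_0 is regular modulo the z_d (exact2_trace).
    This is proved by taking leading forms for two gradings (exact2_top): the first
    leads to the power sums of the diagonal entries and a monomial in subdiagonal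
    entries, the second, after unitriangular changes to complete symmetric functions,
    to pairwise coprime monomials. Moreover the z_d generate the ideal of the
    nilpotent cone (nilpotent_ideal): X^n is 0 modulo the z_d by Newton's identities,
    so X acts on the Krylov vectors as a nilpotent Jordan block, and a polynomial
    that vanishes on nilpotent matrices is 0 modulo the z_d after multiplication by a
    power of f.

    Flatness of the quotient. If h y = sum_d a_d Z_d, then the classical limits of the
    a_d form a trivial relation between the z_d; trivial relations lift, as the Z_d
    commute, and subtracting the lift makes all a_d divisible by h. So the quotient
    has no h-torsion (quotient_torsion_free). The monomials that are not leading
    monomials of the classical ideal span it, by Nakayama's lemma again
    (standard_spans), and are independent, because a relation between them is
    divisible by every power of h (standard_independent). The same lifting identifies
    the quotient by h with the coordinate ring of the nilpotent cone (chi_exists).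

    The square. An element of the tensor product of two coordinate rings is determined
    by its values at pairs of points (tensor_separated). At such a pair both ways
    around the square are algebra morphisms to the complex numbers, which agree on
    the generators (FqN_deformation). *)

Set Implicit Arguments.
Unset Strict Implicit.
Unset Printing Implicit Defensive.

Import GRing.Theory.
Local Open Scope ring_scope.

Notation "{ 'mpoly' T [ n ] }" := (mpoly n T) : type_scope.

(** * The ring of rational functions regular at q = 1 *)
Section GroundRingTheory.
Variable C : fieldType.
Local Notation K := (Kq C).
Local Notation ev := (@kq_ev1 C).

Definition kq_h : K := kq_q C - 1.
Local Notation h := kq_h.

Lemma evB x y : ev (x - y) = ev x - ev y. Proof. exact: rmorphB. Qed.
Lemma evD x y : ev (x + y) = ev x + ev y. Proof. exact: rmorphD. Qed.
Lemma evM x y : ev (x * y) = ev x * ev y. Proof. exact: rmorphM. Qed.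
Lemma ev1 : ev 1 = 1. Proof. exact: rmorph1. Qed.
Lemma ev0 : ev 0 = 0. Proof. exact: rmorph0. Qed.
Lemma ev_sum (I : Type) (r : seq I) (P : pred I) (F : I -> K) :
  ev (\sum_(i <- r | P i) F i) = \sum_(i <- r | P i) ev (F i).
Proof. exact: rmorph_sum. Qed.

Lemma tofrac_neq0 (d : {poly C}) : d.[1] != 0 -> tofrac d != 0 :> {fraction {poly C}}.
Proof. by rewrite tofrac_eq0; apply: contraNneq => ->; rewrite horner0. Qed.

Lemma ev_q : ev (kq_q C) = 1.
Proof.
by rewrite (@kq_ev1E _ _ 'X 1) ?hornerC ?oner_eq0 ?hornerX ?divr1 //= tofrac1 divr1.
Qed.

Lemma ev_h : ev h = 0.
Proof. by rewrite evB ev1 ev_q subrr. Qed.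

Lemma kq_mk (p d : {poly C}) : d.[1] != 0 ->
  exists x : K, kq_val x = tofrac p / tofrac d.
Proof.
move=> hd.
have P : tofrac p / tofrac d \in @regular_at1 C by apply/asboolP; exists p, d.
by exists (MkKq P).
Qed.

Lemma ev_surj (c : C) : exists k : K, ev k = c.
Proof.
have [|x hx] := @kq_mk c%:P 1; first by rewrite hornerC oner_eq0.
by exists x; rewrite (kq_ev1E _ hx) !hornerC ?divr1 ?oner_eq0.
Qed.

Lemma ev_ker (x : K) (p d : {poly C}) : d.[1] != 0 ->
  kq_val x = tofrac p / tofrac d -> ev x = 0 ->
  exists y r, [/\ x = h * y, kq_val y = tofrac r / tofrac d
    & p = r * ('X - 1%:P)].
Proof.
move=> hd ex; rewrite (kq_ev1E hd ex) => /eqP.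
rewrite mulf_eq0 invr_eq0 (negPf hd) orbF => /factor_theorem [r er].
have [y ey] := kq_mk r hd; exists y, r; split=> //.
apply: val_inj; rewrite [LHS]ex [RHS]kq_valM ey er kq_valB.
by rewrite mulrA tofracM tofracB polyC1 tofrac1 [kq_val 1](rmorph1 val) [X in X / _]mulrC.
Qed.

Lemma ev_eq0P (x : K) : ev x = 0 -> exists y, x = h * y.
Proof.
have [[p d] /= [hd ex]] := kq_fracP x.
by move=> /(ev_ker hd ex)[y [r [-> _ _]]]; exists y.
Qed.

Lemma kq_unit_ev (x : K) : ev x != 0 -> x \is a GRing.unit.
Proof.
have [[p d] /= [hd ex]] := kq_fracP x; rewrite (kq_ev1E hd ex) => p0.
have hp : p.[1] != 0 by apply: contraNneq p0 => ->; rewrite mul0r.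
have [y ey] := kq_mk d hp.
apply/unitrP; exists y; suff e : y * x = 1 by rewrite [x * y]mulrC.
apply: val_inj; rewrite [LHS]kq_valM ex ey mulrC mulf_div mulrC.
by rewrite [X in _ * X]mulrC mulVf ?mulf_neq0 ?tofrac_neq0 // [RHS](rmorph1 val).
Qed.

Lemma val_h_neq0 : kq_val h != 0.
Proof.
rewrite kq_valB [kq_val 1](rmorph1 val) /= -tofrac1 -tofracB tofrac_eq0.
by rewrite -polyC1 polyXsubC_eq0.
Qed.

Lemma kq_h_inj : injective ( *%R h).
Proof.
move=> x y /(congr1 (@kq_val C)); rewrite !kq_valM => e.
by apply: val_inj; apply: (mulfI val_h_neq0).
Qed.

(** A nonzero element of the ground ring is divisible by only finitely many
    powers of q - 1, which bounds the size of the numerators. *)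
Lemma h_descent (I : Type) (Q : (I -> K) -> Prop) :
  (forall c, Q c -> forall i, ev (c i) = 0) ->
  (forall c, Q (fun i => h * c i) -> Q c) ->
  forall c, Q c -> forall i, c i = 0.
Proof.
move=> Qev Qh.
suff main N (c : I -> K) i (p d : {poly C}) : Q c -> d.[1] != 0 ->
    kq_val (c i) = tofrac p / tofrac d -> (size p <= N)%N -> c i = 0.
  move=> c Qc i; have [[p d] /= [hd e]] := kq_fracP (c i).
  exact: (main (size p) c i p d).
elim: N c p => [|N ih] c p Qc hd e szp.
  apply: val_inj; rewrite [LHS]e; move: szp; rewrite leqn0 size_poly_eq0.
  by move=> /eqP->; rewrite tofrac0 mul0r [RHS](rmorph0 val).
have [c' ec'] : exists c' : I -> K, c = fun j => h * c' j.
  have /choice [c' hc'] : forall j, exists y, c j = h * y.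
    by move=> j; apply/ev_eq0P/Qev.
  by exists c'; apply/funext.
have [y [r [ey er ep]]] := ev_ker hd e (Qev _ Qc i).
have Qc' : Q c' by apply: Qh; rewrite -ec'.
have yc' : y = c' i by apply: kq_h_inj; rewrite -ey ec'.
have szr : (size r <= N)%N.
  have [->|r0] := eqVneq r 0; first by rewrite size_poly0.
  by move: szp; rewrite ep size_Mmonic ?monicXsubC // size_XsubC addn2.
by rewrite ey yc' (ih c' r Qc' hd _ szr) ?mulr0 // -yc'.
Qed.

Lemma kq_mulh_eq0 (x : K) : h * x = 0 -> x = 0.
Proof. by move=> e; apply: kq_h_inj; rewrite e mulr0. Qed.

End GroundRingTheory.

Section Nakayama.
Variables (C : fieldType) (V : lmodType (Kq C)).
Local Notation K := (Kq C).
Local Notation h := (kq_h C).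

(** Linear combinations as an inductive predicate: rewriting arguments follow the
    way in which a combination is built, and never need its coefficients. *)
Inductive Span (S : V -> Prop) : V -> Prop :=
| Span0 : Span S 0
| SpanD x y : Span S x -> Span S y -> Span S (x + y)
| SpanZ k x : S x -> Span S (k *: x).

Lemma SpanG (S : V -> Prop) x : S x -> Span S x.
Proof. by move=> Sx; rewrite -[x]scale1r; apply: SpanZ. Qed.
Lemma SpanZs (S : V -> Prop) k x : Span S x -> Span S (k *: x).
Proof.
elim=> [|a b _ ha _ hb|l a Sa]; first by rewrite scaler0; apply: Span0.
  by rewrite scalerDr; apply: SpanD.
by rewrite scalerA; apply: SpanZ.
Qed.
Lemma SpanB (S : V -> Prop) x y : Span S x -> Span S y -> Span S (x - y).
Proof. by move=> hx hy; rewrite -scaleN1r; apply/SpanD/SpanZs. Qed.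
Lemma Span_sum (S : V -> Prop) (I : Type) (r : seq I) (F : I -> V) (P : pred I) :
  (forall i, P i -> Span S (F i)) -> Span S (\sum_(i <- r | P i) F i).
Proof.
by move=> hF; apply: (big_ind (Span S)) => //; [apply: Span0|move=> x y; apply: SpanD].
Qed.
Lemma Span_sub (S S' : V -> Prop) : (forall x, S x -> Span S' x) ->
  forall x, Span S x -> Span S' x.
Proof.
move=> hS x; elim=> [|a b _ ha _ hb|k a /hS Sa]; [exact: Span0|exact: SpanD|exact: SpanZs].
Qed.
Lemma Span_fin (I : finType) (u : I -> V) x :
  Span (fun y => exists i, y = u i) x -> exists c : I -> K, x = \sum_i c i *: u i.
Proof.
elim=> [|a b _ [c ->] _ [c' ->]|k a [i ->]].
- by exists (fun => 0); rewrite big1 // => i _; rewrite scale0r.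
- exists (fun i => c i + c' i); rewrite -big_split /=.
  by apply: eq_bigr => i _; rewrite scalerDl.
- exists (fun j => k *+ (j == i)); rewrite (bigD1 i) //= eqxx big1 ?addr0 // => j /negPf->.
  by rewrite scale0r.
Qed.

(** If A collects the coefficients of the error terms, the system (1 - (q - 1) A) u
    lies in the span, and its determinant is a unit of the local ground ring. *)
Lemma nakayama (I : finType) (u : I -> V) (S : V -> Prop) :
  (forall i, exists x y, [/\ u i = x + h *: y, Span S x
     & Span (fun y => exists i, y = u i) y]) ->
  forall i, Span S (u i).
Proof.
move=> hu.
have /choice [A hA] : forall i, exists c : I -> K, Span S (u i - h *: \sum_j c j *: u j).
  move=> i; have [x [y [-> Sx /Span_fin[c ->]]]] := hu i.
  by exists c; rewrite addrK.
pose N := #|I|; pose v (k : 'I_N) := u (enum_val k).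
pose M : 'M[K]_N := 1%:M - h *: \matrix_(i, j) A (enum_val i) (enum_val j).
have SM i : Span S (\sum_j M i j *: v j).
  suff -> : \sum_j M i j *: v j = v i - h *: \sum_j A (enum_val i) j *: u j.
    exact: hA.
  rewrite [X in _ *: X](reindex _ (onW_bij _ (enum_val_bij _))) /=.
  rewrite scaler_sumr -sumrN.
  rewrite -{1}(_ : \sum_j (1%:M : 'M[K]_N) i j *: v j = v i); last first.
    rewrite (bigD1 i) //= mxE eqxx scale1r big1 ?addr0 // => j ji.
    by rewrite mxE eq_sym (negPf ji) scale0r.
  rewrite -big_split /=; apply: eq_bigr => j _.
  by rewrite /M !mxE scalerBl scalerA.
have detU : \det M \is a GRing.unit.
  apply: kq_unit_ev; rewrite -det_map_mx.
  suff -> : map_mx (@kq_ev1 C) M = 1%:M by rewrite det1 oner_eq0.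
  apply/matrixP => i j; rewrite !mxE rmorphB rmorphM /= ev_h mul0r subr0.
  by rewrite rmorph_nat.
have Sv i : Span S (v i).
  rewrite -[v i]scale1r -(mulVr detU) -scalerA; apply: SpanZs.
  suff -> : \det M *: v i = \sum_k \adj M i k *: \sum_j M k j *: v j.
    by apply: Span_sum => k _; apply: SpanZs.
  under eq_bigr => k _ do rewrite scaler_sumr.
  rewrite exchange_big /=.
  have e j : \sum_k \adj M i k *: (M k j *: v j) = ((\det M)%:M : 'M_N) i j *: v j.
    rewrite -mul_adj_mx mxE scaler_suml; apply: eq_bigr => k _; by rewrite scalerA.
  under eq_bigr => j _ do rewrite e.
  rewrite (bigD1 i) //= mxE eqxx big1 ?addr0 // => j ji.
  by rewrite mxE eq_sym (negPf ji) scale0r.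
by move=> i; rewrite -(enum_rankK i); apply: Sv.
Qed.

End Nakayama.

(** * Algebra morphisms, quotients and tensor products *)
Section SemialgMorphisms.
Variables (K L : comNzRingType) (sigma : K -> L) (A : pzAlg K) (B : pzAlg L).
Variable f : A -> B.
Hypothesis hf : semialg_morphism sigma f.

Lemma samB x y : f (x - y) = f x - f y. Proof. by case: hf => h _ _; apply: h. Qed.
Lemma sam0 : f 0 = 0. Proof. by rewrite -(subrr 0) samB subrr. Qed.
Lemma samN x : f (- x) = - f x. Proof. by rewrite -sub0r samB sam0 sub0r. Qed.
Lemma samD x y : f (x + y) = f x + f y.
Proof. by rewrite -{1}[y]opprK samB samN opprK. Qed.
Lemma samM x y : f (x * y) = f x * f y.
Proof. by case: hf => _ [_ h] _; apply: h. Qed.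
Lemma sam1 : f 1 = 1. Proof. by case: hf => _ [h _] _. Qed.
Lemma samZ k x : f (k *: x) = sigma k *: f x.
Proof. by case: hf => _ _ h; apply: h. Qed.
Lemma sam_sum (I : Type) (r : seq I) (P : pred I) (F : I -> A) :
  f (\sum_(i <- r | P i) F i) = \sum_(i <- r | P i) f (F i).
Proof. by apply: (big_morph f); [exact: samD|exact: sam0]. Qed.
Lemma sam_prod (I : Type) (r : seq I) (P : pred I) (F : I -> A) :
  f (\prod_(i <- r | P i) F i) = \prod_(i <- r | P i) f (F i).
Proof. by apply: (big_morph f); [exact: samM|exact: sam1]. Qed.
End SemialgMorphisms.

Lemma sam_comp (K L M : comNzRingType) (s : K -> L) (t : L -> M) (A : pzAlg K)
    (B : pzAlg L) (D : pzAlg M) (f : A -> B) (g : B -> D) :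
  semialg_morphism s f -> semialg_morphism t g -> semialg_morphism (t \o s) (g \o f).
Proof.
move=> hf hg; split=> [x y|//=|k x] /=.
- by rewrite (samB hf) (samB hg).
- by split=> [|x y] /=; rewrite ?(sam1 hf) ?(sam1 hg) // (samM hf) (samM hg).
- by rewrite (samZ hf) (samZ hg).
Qed.

Lemma sam_id (K : comNzRingType) (A : pzAlg K) : alg_morphism (@id A).
Proof. by split. Qed.

Section FreeLift.
Variables (K L : comNzRingType) (sigma : {rmorphism K -> L}).
Variables (I : choiceType) (A : pzAlg L) (g : I -> A).
Local Notation T := (free_alg K I).

Definition word_val (w : seq I) : A := \prod_(i <- w) g i.

Definition flift (x : T) : A :=
  \sum_(k <- monalg.msupp (x : {malg K[{fmonom I}]})) sigma (monalg.mcoeff k x) *: word_val k.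

Lemma fliftEw (d : {fset {fmonom I}}%fset) (x : {malg K[{fmonom I}]}) :
  {subset monalg.msupp x <= d} ->
  flift x = \sum_(k <- d) sigma (monalg.mcoeff k x) *: word_val k.
Proof.
move=> sd; rewrite /flift; apply: big_fset_incl; first exact/fsubsetP.
move=> k _ /monalg.mcoeff_outdom->; by rewrite rmorph0 scale0r.
Qed.

Fact flift_zmod : zmod_morphism flift.
Proof.
move=> x y; pose d := (monalg.msupp (x : {malg K[{fmonom I}]}) `|` monalg.msupp (y : {malg K[{fmonom I}]}) `|` monalg.msupp ((x - y : {malg K[{fmonom I}]})))%fset.
rewrite !(@fliftEw d); try by move=> k hk; rewrite /d !in_fsetE hk ?orbT.
rewrite -sumrB; apply: eq_bigr => k _.
by rewrite monalg.mcoeffB rmorphB scalerBl.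
Qed.

Lemma fliftU c (k : {fmonom I}) :
  flift (mkmalgU k c : {malg K[{fmonom I}]}) = sigma c *: word_val k.
Proof.
rewrite (@fliftEw [fset k]%fset) ?big_seq_fset1 ?monalg.mcoeffUU //.
by apply/fsubsetP; apply: msuppU_le.
Qed.

Lemma word_valM (k l : {fmonom I}) :
  word_val (monalg.mul k l : {fmonom I}) = word_val k * word_val l.
Proof. by rewrite /word_val fmM big_cat. Qed.

Fact flift_monoid : monoid_morphism flift.
Proof.
have f0 : flift 0 = 0 by rewrite -{1}(subrr 0) flift_zmod subrr.
have fD a b : flift (a + b) = flift a + flift b.
  rewrite -{1}[b]opprK flift_zmod; congr (_ + _).
  by rewrite -(sub0r b) flift_zmod f0 sub0r opprK.
split=> [|x y].
  by rewrite [flift 1](fliftU 1) rmorph1 scale1r /word_val fm1 big_nil.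
rewrite [x * y]monalg.malgME (big_morph flift fD f0).
rewrite {2}/flift mulr_suml; apply: eq_bigr => k _.
rewrite (big_morph flift fD f0) {2}/flift mulr_sumr; apply: eq_bigr => l _.
by rewrite fliftU rmorphM word_valM -!pz_scalerAl -!pz_scalerAr scalerA.
Qed.

Lemma flift_morphism : semialg_morphism sigma flift.
Proof.
split; [exact: flift_zmod|exact: flift_monoid|move=> c x].
have -> : c *: x = (mkmalgU (monalg.one : {fmonom I}) c : {malg K[{fmonom I}]}) * x.
  by rewrite [RHS](mul_malgC c).
case: flift_monoid => _ ->; rewrite fliftU /word_val fm1 big_nil.
by rewrite -pz_scalerAl mul1r.
Qed.

Lemma flift_gen i : flift (free_gen K i) = g i.
Proof.
by rewrite /free_gen fliftU rmorph1 scale1r /word_val fmU big_seq1.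
Qed.
End FreeLift.

Section FreeInd.
Variables (K : comNzRingType) (I : choiceType).
Local Notation T := (free_alg K I).

Lemma free_gen_word (s : seq I) :
  \prod_(i <- s) free_gen K i = (mkmalgU (FMonom s) 1 : {malg K[{fmonom I}]}).
Proof.
elim: s => [|i s ih]; rewrite ?big_nil ?big_cons.
  by congr (mkmalgU _ _); apply/eqP; rewrite fmP /= fm1.
rewrite ih [LHS]fgmulUU mul1r; congr (mkmalgU _ _).
by apply/eqP; rewrite fmP /= fmM fmU.
Qed.

Lemma free_sumE (x : T) : x = \sum_(k <- monalg.msupp (x : {malg K[{fmonom I}]}))
  monalg.mcoeff k x *: (\prod_(i <- (k : seq I)) free_gen K i : T).
Proof.
rewrite {1}[x]monalgE; apply: eq_bigr => k _.
rewrite free_gen_word; case: k => k /=.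
by apply/malgP => l; rewrite monalg.mcoeffZ !monalg.mcoeffU mulr_natr.
Qed.

Lemma free_ind (P : T -> Prop) :
  (forall x y, P x -> P y -> P (x + y)) ->
  (forall x y, P x -> P y -> P (x * y)) ->
  (forall k x, P x -> P (k *: x)) -> P 1 ->
  (forall i, P (free_gen K i)) -> forall x, P x.
Proof.
move=> PD PM PZ P1 Pg x; rewrite [x]free_sumE.
have P0 : P 0 by rewrite -(scale0r (1 : T)); apply: PZ.
apply: (big_ind P) => // k _; apply: PZ.
by apply: (big_ind P).
Qed.
End FreeInd.

Section QuotLift.
Variables (K L : comNzRingType) (sigma : K -> L) (A : pzAlg K) (B : pzAlg L).
Variables (S : set A) (f : A -> B).
Hypotheses (hf : semialg_morphism sigma f) (fS : forall x, S x -> f x = 0).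

Lemma ideal_gen_ker x : ideal_gen S x -> f x = 0.
Proof.
case=> s [hs ->]; rewrite (sam_sum hf) big_seq big1 // => t /hs /fS e.
by rewrite !(samM hf) e mulr0 mul0r.
Qed.

(** Any representative may be used, once f kills the relations. *)
Definition qlift (y : quot_alg S) : B := f (repr (y : quot_carrier S)).

Lemma qlift_pi x : qlift (quot_pi S x) = f x.
Proof.
apply/eqP; rewrite -subr_eq0 -(samB hf); apply/eqP/ideal_gen_ker/repr_qpi.
Qed.

Lemma qlift_morphism : semialg_morphism sigma qlift.
Proof.
have [piB [pi1 piM] piZ] := quot_pi_morphism S.
split=> [x y||k x].
- have [a ->] := quot_pi_surj x; have [b ->] := quot_pi_surj y.
  by rewrite -piB !qlift_pi (samB hf).
- split=> [|x y]; first by rewrite -pi1 qlift_pi (sam1 hf).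
  have [a ->] := quot_pi_surj x; have [b ->] := quot_pi_surj y.
  by rewrite -piM !qlift_pi (samM hf).
- by have [a ->] := quot_pi_surj x; rewrite -piZ !qlift_pi (samZ hf).
Qed.
End QuotLift.

Lemma quot_pi_eq0 (K : comNzRingType) (A : pzAlg K) (S : set A) x :
  S x -> quot_pi S x = 0.
Proof.
move=> Sx; rewrite -(sam0 (quot_pi_morphism S)); apply/quot_piP.
by rewrite subr0; apply: ideal_gen_sub.
Qed.

Lemma quot_pi_eq0P (K : comNzRingType) (A : pzAlg K) (S : set A) x :
  quot_pi S x = 0 <-> ideal_gen S x.
Proof. by rewrite -(sam0 (quot_pi_morphism S)) quot_piP subr0. Qed.

Lemma tlift0 (K : comNzRingType) (A B : pzAlg K) (U : zmodType) (f : A -> B -> U) :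
  balanced f -> tlift f 0 = 0.
Proof. by move=> fb; apply: (addrI (tlift f 0)); rewrite -tliftD // !addr0. Qed.

Section TensorMaps.
Variables (K : comNzRingType) (A B : pzAlg K).
Local Notation T := (tensor A B).

Lemma tensDl (a a' : A) (b : B) : (a + a') \ox b = a \ox b + a' \ox b.
Proof. by case: (tens_balanced A B). Qed.
Lemma tensDr (a : A) (b b' : B) : a \ox (b + b') = a \ox b + a \ox b'.
Proof. by case: (tens_balanced A B). Qed.
Lemma tensZm k (a : A) (b : B) : (k *: a) \ox b = a \ox (k *: b).
Proof. by case: (tens_balanced A B). Qed.
Lemma tensZl k (a : A) (b : B) : k *: (a \ox b) = (k *: a) \ox b.
Proof. exact: tensor_scale_pure. Qed.
Lemma tensZr k (a : A) (b : B) : k *: (a \ox b) = a \ox (k *: b).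
Proof. by rewrite tensZl tensZm. Qed.
Lemma tens0l (b : B) : (0 : A) \ox b = 0.
Proof. by apply: (addrI ((0 : A) \ox b)); rewrite -tensDl !addr0. Qed.
Lemma tens0r (a : A) : a \ox (0 : B) = 0.
Proof. by apply: (addrI (a \ox (0 : B))); rewrite -tensDr !addr0. Qed.
Lemma tens_suml (I : Type) (r : seq I) (P : pred I) (F : I -> A) (b : B) :
  (\sum_(i <- r | P i) F i) \ox b = \sum_(i <- r | P i) F i \ox b.
Proof. by apply: (big_morph (fun a => a \ox b)) => [x y|]; [exact: tensDl|exact: tens0l]. Qed.
Lemma tens_sumr (I : Type) (r : seq I) (P : pred I) (F : I -> B) (a : A) :
  a \ox (\sum_(i <- r | P i) F i) = \sum_(i <- r | P i) a \ox F i.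
Proof. by apply: (big_morph (fun b => a \ox b)) => [x y|]; [exact: tensDr|exact: tens0r]. Qed.

Lemma tens_injl_morphism : alg_morphism (fun a : A => (a \ox 1 : T)).
Proof.
split=> [x y|//|k x]; last by rewrite tensZl.
  by rewrite tensDl -scaleN1r -tensZl scaleN1r.
by split=> // x y; rewrite tens_mul mulr1.
Qed.
Lemma tens_injr_morphism : alg_morphism (fun b : B => ((1 : A) \ox b : T)).
Proof.
split=> [x y|//|k x]; last by rewrite tensZr.
  by rewrite tensDr -scaleN1r -tensZr scaleN1r.
by split=> // x y; rewrite tens_mul mulr1.
Qed.

Lemma tlift_morphism (L : comNzRingType) (sigma : K -> L) (D : pzAlg L)
    (f : A -> B -> D) :
  balanced f -> f 1 1 = 1 -> (forall a b c d, f (a * c) (b * d) = f a b * f c d) ->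
  (forall k a b, f (k *: a) b = sigma k *: f a b) ->
  semialg_morphism sigma (tlift f).
Proof.
move=> fb f1 fM fZ.
have tD x y : tlift f (x + y) = tlift f x + tlift f y by exact: tliftD.
have t0 := tlift0 fb.
have tB x y : tlift f (x - y) = tlift f x - tlift f y.
  by apply: (addIr (tlift f y)); rewrite -tD !subrK.
split=> [//||k x].
  split=> [|x y]; first by rewrite [LHS]tlift_tens.
  elim/tens_ind: x => [|x1 x2 h1 h2|a b]; first by rewrite !(mul0r, t0).
    by rewrite mulrDl !tD h1 h2 mulrDl.
  elim/tens_ind: y => [|x1 x2 h1 h2|c d]; first by rewrite !(mulr0, t0).
    by rewrite mulrDr !tD h1 h2 mulrDr.
  by rewrite tens_mul !tlift_tens.
elim/tens_ind: x => [|x1 x2 h1 h2|a b]; first by rewrite scaler0 !t0 scaler0.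
  by rewrite scalerDr !tD h1 h2 scalerDr.
by rewrite tensZl !tlift_tens.
Qed.
End TensorMaps.

Section Tmap.
Variables (K L : comNzRingType) (sigma : K -> L) (A B : pzAlg K) (A' B' : pzAlg L).
Variables (f : A -> A') (g : B -> B').
Hypotheses (hf : semialg_morphism sigma f) (hg : semialg_morphism sigma g).

Lemma tmap_balanced : balanced (fun a b => f a \ox g b).
Proof.
split=> [a a' b|a b b'|k a b].
- by rewrite (samD hf) tensDl.
- by rewrite (samD hg) tensDr.
- by rewrite (samZ hf) (samZ hg) tensZm.
Qed.
Lemma tmap_tens a b : tmap f g (a \ox b) = f a \ox g b.
Proof. exact: (tlift_tens _ _ tmap_balanced). Qed.
Lemma tmap_morphism : semialg_morphism sigma (tmap f g).
Proof.
apply: tlift_morphism; first exact: tmap_balanced.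
- by rewrite (sam1 hf) (sam1 hg).
- by move=> a b c d; rewrite (samM hf) (samM hg) tens_mul.
- by move=> k a b; rewrite (samZ hf) tensZl.
Qed.
End Tmap.

Section Tassoc.
Variables (K : comNzRingType) (A B D : pzAlg K).

Lemma tassoc_in_balanced (c : D) :
  balanced (fun (a : A) (b : B) => a \ox (b \ox c)).
Proof.
split=> [a a' b|a b b'|k a b]; first by rewrite tensDl.
  by rewrite tensDl tensDr.
by rewrite tensZm tensZl.
Qed.
Lemma tassoc_out_balanced :
  balanced (fun (x : tensor A B) (c : D) => tlift (fun a b => a \ox (b \ox c)) x).
Proof.
have b c := tassoc_in_balanced c.
have t0 c : tlift (fun (a : A) (b : B) => a \ox (b \ox c)) 0 = 0 := tlift0 (b c).
split=> [x y c|x c c'|k x c]; first by rewrite tliftD.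
  elim/tens_ind: x => [|x y hx hy|x y]; rewrite ?t0 ?addr0 //.
    by rewrite !tliftD // hx hy addrACA.
  by rewrite !tlift_tens // !tensDr.
elim/tens_ind: x => [|x y hx hy|x y]; rewrite ?scaler0 ?t0 //.
  by rewrite scalerDr !tliftD // hx hy.
by rewrite tensZl !tlift_tens // tensZm tensZr.
Qed.
Lemma tassoc_tens (a : A) (b : B) (c : D) :
  tassoc ((a \ox b) \ox c) = a \ox (b \ox c).
Proof.
rewrite [LHS](tlift_tens _ _ tassoc_out_balanced).
exact: (tlift_tens _ _ (tassoc_in_balanced c)).
Qed.
Lemma tassoc_morphism : alg_morphism (@tassoc K A B D).
Proof.
have b c := tassoc_in_balanced c.
have t0 c : tlift (fun (a : A) (b : B) => a \ox (b \ox c)) 0 = 0 := tlift0 (b c).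
apply: tlift_morphism => [|| x c y d|k x c].
- exact: tassoc_out_balanced.
- by rewrite [LHS]tlift_tens.
- elim/tens_ind: x => [|x1 x2 h1 h2|a b']; rewrite ?(mul0r, t0) //.
    by rewrite mulrDl !tliftD // h1 h2 mulrDl.
  elim/tens_ind: y => [|x1 x2 h1 h2|a' b'']; rewrite ?(mulr0, t0) //.
    by rewrite mulrDr !tliftD // h1 h2 mulrDr.
  by rewrite tens_mul !tlift_tens // !tens_mul.
- elim/tens_ind: x => [|x1 x2 h1 h2|a b']; rewrite ?(scaler0, t0) //.
    by rewrite scalerDr !tliftD // h1 h2 scalerDr.
  by rewrite tensZl !tlift_tens // tensZl.
Qed.
End Tassoc.

(** * Ordered words *)
Section MonomialWords.
Variable N : nat.

Definition mono_word (m : 'X_{1..N}) : seq 'I_N :=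
  flatten [seq nseq (m i) i | i <- enum 'I_N].
Definition word_mono (s : seq 'I_N) : 'X_{1..N} :=
  [multinom count_mem i s | i < N].

Lemma count_mono_word m i : count_mem i (mono_word m) = m i.
Proof.
rewrite /mono_word count_flatten -map_comp sumnE big_map big_enum /=.
rewrite (bigD1 i) //= count_nseq /= eqxx mul1n big1 ?addn0 // => j ji.
by rewrite count_nseq /= (negPf ji) mul0n.
Qed.
Lemma mono_wordK m : word_mono (mono_word m) = m.
Proof. by apply/mnmP => i; rewrite mnmE count_mono_word. Qed.
Lemma perm_word_mono s t : perm_eq s t = (word_mono s == word_mono t).
Proof.
apply/idP/eqP => [/seq.permP st|/mnmP st].
  by apply/mnmP => i; rewrite !mnmE st.
by apply/allP => i _ /=; have := st i; rewrite !mnmE => ->.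
Qed.
Lemma perm_mono_word s : perm_eq s (mono_word (word_mono s)).
Proof. by rewrite perm_word_mono mono_wordK. Qed.
Lemma size_mono_word m : size (mono_word m) = mdeg m.
Proof.
rewrite /mono_word size_flatten /shape -map_comp sumnE big_map big_enum /= mdegE.
by apply: eq_bigr => i _; rewrite /= size_nseq.
Qed.
Lemma mdeg_word_mono s : mdeg (word_mono s) = size s.
Proof. by rewrite -size_mono_word -(perm_size (perm_mono_word s)). Qed.
End MonomialWords.

Section AlmostCommutative.
Variables (C : fieldType) (A : pzAlg (Kq C)) (N : nat) (a : 'I_N -> A).
Local Notation K := (Kq C).
Local Notation h := (kq_h C).
Local Notation wv := (word_val a).

Definition words_le (d : nat) : A -> Prop :=
  Span (fun y => exists s : seq 'I_N, (size s <= d)%N /\ y = wv s).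
Local Notation V := words_le.
Definition mono_val (m : 'X_{1..N}) : A := wv (mono_word m).
Local Notation W := mono_val.

Lemma words_le_mono d e x : (d <= e)%N -> V d x -> V e x.
Proof.
move=> de; apply: Span_sub => y [s [hs ->]]; apply: SpanG.
by exists s; split=> //; apply: leq_trans de.
Qed.
Lemma words_le_word s d : (size s <= d)%N -> V d (wv s).
Proof. by move=> hs; apply: SpanG; exists s. Qed.
Lemma wv_cat s t : wv (s ++ t) = wv s * wv t.
Proof. by rewrite /word_val big_cat. Qed.
Lemma wv_cons i s : wv (i :: s) = a i * wv s.
Proof. by rewrite /word_val big_cons. Qed.
Lemma wv_nil : wv [::] = 1.
Proof. by rewrite /word_val big_nil. Qed.
Lemma words_leM d e x y : V d x -> V e y -> V (d + e) (x * y).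
Proof.
move=> Vx Vy; elim: Vx => [|u v _ hu _ hv|k u [s [hs ->]]].
- by rewrite mul0r; apply: Span0.
- by rewrite mulrDl; apply: SpanD.
rewrite -pz_scalerAl; apply: SpanZs.
elim: Vy => [|u' v _ hu _ hv|l v [t [ht ->]]].
- by rewrite mulr0; apply: Span0.
- by rewrite mulrDr; apply: SpanD.
rewrite -pz_scalerAr; apply: SpanZs; apply: SpanG; exists (s ++ t).
by rewrite size_cat leq_add // wv_cat.
Qed.

(** The bound is on the quotient by q - 1: an element of low degree that is
    divisible by q - 1 need not be divisible within that degree. *)
Definition words_h d (x : A) := exists y, V d y /\ x = h *: y.
Local Notation hV := words_h.
Lemma words_hD d x y : hV d x -> hV d y -> hV d (x + y).
Proof.
move=> [u [hu ->]] [v [hv ->]]; exists (u + v); rewrite scalerDr; split=> //.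
exact: SpanD.
Qed.
Lemma words_hZ d k x : hV d x -> hV d (k *: x).
Proof.
move=> [u [hu ->]]; exists (k *: u); rewrite !scalerA mulrC; split=> //.
exact: SpanZs.
Qed.
Lemma words_hN d x : hV d x -> hV d (- x).
Proof. by rewrite -scaleN1r; apply: words_hZ. Qed.
Lemma words_hB d x y : hV d x -> hV d y -> hV d (x - y).
Proof. by move=> hx /words_hN; apply: words_hD. Qed.
Lemma words_h0 d : hV d 0.
Proof. by exists 0; rewrite scaler0; split=> //; apply: Span0. Qed.
Lemma words_h_sum d (I : Type) (r : seq I) (P : pred I) (F : I -> A) :
  (forall i, P i -> hV d (F i)) -> hV d (\sum_(i <- r | P i) F i).
Proof.
by move=> hF; apply: (big_ind (hV d)) => //; [exact: words_h0|move=> x y; apply: words_hD].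
Qed.
Lemma words_hMl d e x y : V d x -> hV e y -> hV (d + e) (x * y).
Proof.
move=> hx [v [hv ->]]; exists (x * v); rewrite pz_scalerAr; split=> //.
exact: words_leM.
Qed.
Lemma words_hMr d e x y : hV d x -> V e y -> hV (d + e) (x * y).
Proof.
move=> [v [hv ->]] hy; exists (v * y); rewrite pz_scalerAl; split=> //.
exact: words_leM.
Qed.
Lemma words_h_mono d e x : (d <= e)%N -> hV d x -> hV e x.
Proof. by move=> de [y [hy ->]]; exists y; split=> //; apply: words_le_mono hy. Qed.

Hypothesis swap : forall i j, hV 2 (a i * a j - a j * a i).

Lemma word_front s i t d : (size (s ++ i :: t) <= d)%N ->
  hV d (wv (s ++ i :: t) - wv (i :: s ++ t)).
Proof.
elim: s d => [|j s ih] d hd; first by rewrite subrr; apply: words_h0.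
case: d hd => // d hd; rewrite !cat_cons !wv_cons.
have -> : a j * wv (s ++ i :: t) - a i * (a j * wv (s ++ t)) =
   a j * (wv (s ++ i :: t) - wv (i :: s ++ t)) +
   (a j * a i - a i * a j) * wv (s ++ t).
  by rewrite mulrBr mulrBl !wv_cons !mulrA addrA subrK.
apply: words_hD.
  rewrite -add1n; apply: words_hMl; last exact: ih.
  by rewrite -[a j]mulr1 -wv_nil -wv_cons; apply: words_le_word.
apply: (@words_h_mono (2 + size (s ++ t))).
  by move: hd; rewrite /= !size_cat /= addnS.
by apply: words_hMr; [exact: swap|exact: words_le_word].
Qed.

Lemma word_perm s t d : perm_eq s t -> (size s <= d)%N -> hV d (wv s - wv t).
Proof.
elim: s t d => [|i s ih] t d.
  by move/perm_size/esym/size0nil->; rewrite subrr => _; apply: words_h0.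
move=> pst hd; have it : i \in t by rewrite -(perm_mem pst) mem_head.
move: pst; case/splitPr: it => t1 t2.
rewrite perm_sym -(cat1s i t2) perm_catCA /= perm_cons perm_sym => pst.
have szt : size s = size (t1 ++ t2) by apply: perm_size.
rewrite -[X in hV _ X](subrKA (wv (i :: t1 ++ t2))).
apply: words_hD; last first.
  rewrite -opprB; apply/words_hN/word_front.
  by move: hd; rewrite /= szt !size_cat /= addnS.
case: d hd => // d hd; rewrite !wv_cons -mulrBr -add1n; apply: words_hMl; last exact: ih.
by rewrite -[a i]mulr1 -wv_nil -wv_cons; apply: words_le_word.
Qed.

Lemma word_sort s d : (size s <= d)%N -> hV d (wv s - W (word_mono s)).
Proof. by move=> hs; apply: word_perm => //; apply: perm_mono_word. Qed.

(** Sorting letters changes a word by a multiple of q - 1, so the ordered words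
    span by Nakayama; a rewriting rule modulo q - 1 for the leading monomials
    outside St is enough to discard these. *)
Lemma standard_span (St : 'X_{1..N} -> Prop) (d : nat) :
  (forall m, (mdeg m <= d)%N -> ~ St m -> exists x y,
     [/\ W m = x + y, Span (fun z => exists m', (m' < m)%O /\ z = W m') x
       & hV d y]) ->
  forall x, V d x -> Span (fun z => exists m, [/\ St m, (mdeg m <= d)%N & z = W m]) x.
Proof.
move=> hSt; set S := fun z => _.
pose I : Type := d.-tuple (option 'I_N); pose u (t : I) := wv (pmap id t).
have Su y : (exists s : seq 'I_N, (size s <= d)%N /\ y = wv s) -> exists t, y = u t.
  move=> [s [hs ->]]; pose t := map Some s ++ nseq (d - size s) None.
  have st : size t == d by rewrite size_cat size_map size_nseq subnKC.
  exists (Tuple st); rewrite /u /= pmap_cat.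
  have -> : pmap id (nseq (d - size s) (None : option 'I_N)) = [::] by elim: (d - size s)%N.
  by rewrite cats0; congr (wv _); elim: s {hs t st} => //= i s {1}->.
have szp (t : I) : (size (pmap id t) <= d)%N.
  by rewrite -{2}(size_tuple t) size_pmap count_size.
have key m : (mdeg m <= d)%N -> exists x y, [/\ W m = x + y, Span S x & hV d y].
  elim/(well_founded_ind (@ltom_wf N)): m => m ih hm.
  have [Sm|nSm] := pselect (St m).
    exists (W m), 0; rewrite addr0; split=> //; last exact: words_h0.
    by apply: SpanG; exists m.
  have [x [y [-> hx hy]]] := hSt m hm nSm.
  suff [x1 [y1 [-> hx1 hy1]]] : exists x1 y1, [/\ x = x1 + y1, Span S x1 & hV d y1].
    by exists x1, (y1 + y); rewrite addrA; split=> //; apply: words_hD.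
  elim: hx => [|b c _ [x1 [y1 [-> hx1 hy1]]] _ [x2 [y2 [-> hx2 hy2]]]|k b [m' [lm ->]]].
  - by exists 0, 0; rewrite addr0; split=> //; [exact: Span0|exact: words_h0].
  - exists (x1 + x2), (y1 + y2); rewrite addrACA; split=> //; first exact: SpanD.
    exact: words_hD.
  - have hm' : (mdeg m' <= d)%N by apply: leq_trans hm; apply/lemc_mdeg/Order.POrderTheory.ltW.
    have [x1 [y1 [-> hx1 hy1]]] := ih m' lm hm'.
    exists (k *: x1), (k *: y1); rewrite scalerDr; split=> //; first exact: SpanZs.
    exact: words_hZ.
have nak : forall t : I, Span S (u t).
  apply: nakayama => t.
  have [x [y [e hx [z [hz ez]]]]] : exists x y, [/\ u t = x + y, Span S x & hV d y].
    have [|x [y [e hx hy]]] := key (word_mono (pmap id t)); first by rewrite mdeg_word_mono.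
    exists x, (y + (u t - W (word_mono (pmap id t)))); split=> //.
      by rewrite addrA -e addrC subrK.
    by apply: words_hD => //; apply: word_sort.
  exists x, z; split=> //; first by rewrite e ez.
  by apply: Span_sub hz => w /Su hw; apply: SpanG.
by move=> x; apply: Span_sub => y /Su[t ->]; apply: nak.
Qed.

Lemma pbw_span d x : V d x ->
  Span (fun z => exists m, (mdeg m <= d)%N /\ z = W m) x.
Proof.
move=> Vx; apply: (Span_sub _ (@standard_span (fun=> True) d _ x Vx)).
  by move=> z [m [_ hm ->]]; apply: SpanG; exists m.
by move=> m _ [].
Qed.

End AlmostCommutative.

(** * Matrices over the tensor square *)
Local Notation ent M s u b t :=
  (fun_of_matrix M (mxtens_index (s, u)) (mxtens_index (b, t))) (only parsing).

Section RmorphOfSam.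
Variables (K L : comNzRingType) (sigma : K -> L) (A : pzAlg K) (B : pzAlg L).
Variables (f : A -> B) (hf : semialg_morphism sigma f).
Definition sam_rmorph : {rmorphism A -> B} :=
  HB.pack f (GRing.isZmodMorphism.Build A B f (let: And3 h _ _ := hf in h))
            (GRing.isMonoidMorphism.Build A B f (let: And3 _ h _ := hf in h)).
End RmorphOfSam.

Section Tens.
Variable n : nat.

Lemma mxtens_eqP (T : Type) (M M' : 'M[T]_(n * n)) :
  (forall s u b t, ent M s u b t = ent M' s u b t) -> M = M'.
Proof.
move=> h; apply/matrixP => i j.
by case: (mxtens_indexP i) => s u; case: (mxtens_indexP j) => b t; apply: h.
Qed.

Lemma mxtens_sum (V : nmodType) (F : 'I_(n * n) -> V) :
  \sum_k F k = \sum_(c < n) \sum_(d < n) F (mxtens_index (c, d)).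
Proof.
rewrite pair_big /=; rewrite (reindex (@mxtens_index n n)) /=; last first.
  by exists (@mxtens_unindex n n) => k _; rewrite ?mxtens_indexK ?mxtens_unindexK.
by apply: eq_bigr => -[c d].
Qed.

Lemma mxtens_mulE (R : pzRingType) (M M' : 'M[R]_(n * n)) s u b t :
  ent (M *m M') s u b t = \sum_c \sum_d ent M s u c d * ent M' c d b t.
Proof. by rewrite mxE mxtens_sum. Qed.

Lemma leg2E (R : pzRingType) (X : 'M[R]_n) s u b t :
  ent (1%:M *t X : 'M_(n * n)) s u b t = X u t *+ (s == b).
Proof. by rewrite tensmxE mxE mulrnAl mul1r. Qed.
Lemma leg1E (R : pzRingType) (X : 'M[R]_n) s u b t :
  ent (X *t 1%:M : 'M_(n * n)) s u b t = X s b *+ (u == t).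
Proof. by rewrite tensmxE mxE mulrnAr mulr1. Qed.

Lemma big_delta (V : nmodType) (F : 'I_n -> V) s : \sum_c F c *+ (s == c) = F s.
Proof.
rewrite (bigD1 s) //= eqxx big1 ?addr0 // => c /negPf.
by rewrite eq_sym => ->.
Qed.
Lemma big_delta' (V : nmodType) (F : 'I_n -> V) s : \sum_c F c *+ (c == s) = F s.
Proof. by rewrite -[RHS](big_delta F); apply: eq_bigr => c _; rewrite eq_sym. Qed.

Lemma mul_leg2l (R : pzRingType) (X : 'M[R]_n) (M : 'M_(n * n)) s u b t :
  ent ((1%:M *t X) *m M) s u b t = \sum_r X u r * ent M s r b t.
Proof.
rewrite mxtens_mulE exchange_big; apply: eq_bigr => r _ /=.
under eq_bigr => c _ do rewrite leg2E mulrnAl.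
by rewrite big_delta.
Qed.
Lemma mul_leg2r (R : pzRingType) (X : 'M[R]_n) (M : 'M_(n * n)) s u b t :
  ent (M *m (1%:M *t X)) s u b t = \sum_r ent M s u b r * X r t.
Proof.
rewrite mxtens_mulE exchange_big; apply: eq_bigr => r _ /=.
under eq_bigr => c _ do rewrite leg2E mulrnAr.
by rewrite big_delta'.
Qed.
Lemma mul_leg1l (R : pzRingType) (X : 'M[R]_n) (M : 'M_(n * n)) s u b t :
  ent ((X *t 1%:M) *m M) s u b t = \sum_r X s r * ent M r u b t.
Proof.
rewrite mxtens_mulE; apply: eq_bigr => r _ /=.
under eq_bigr => c _ do rewrite leg1E mulrnAl.
by rewrite big_delta.
Qed.
Lemma leg2_mul (R : pzRingType) (X Y : 'M[R]_n) :
  (1%:M *t X) *m (1%:M *t Y) = 1%:M *t (X *m Y) :> 'M_(n * n).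
Proof.
apply: mxtens_eqP => s u b t; rewrite mul_leg2l leg2E mxE -sumrMnl.
by apply: eq_bigr => r _; rewrite leg2E mulrnAr.
Qed.
Lemma leg1_mul (R : pzRingType) (X Y : 'M[R]_n) :
  (X *t 1%:M) *m (Y *t 1%:M) = (X *m Y) *t 1%:M :> 'M_(n * n).
Proof.
apply: mxtens_eqP => s u b t; rewrite mul_leg1l leg1E mxE -sumrMnl.
by apply: eq_bigr => r _; rewrite leg1E mulrnAr.
Qed.
Lemma leg2_1 (R : pzRingType) : 1%:M *t 1%:M = 1%:M :> 'M[R]_(n * n).
Proof.
apply: mxtens_eqP => s u b t; rewrite leg2E !mxE (can_eq (@mxtens_indexK n n)) xpair_eqE.
by case: (s == b); case: (u == t).
Qed.
Lemma leg12_comm (R : pzRingType) (X Y : 'M[R]_n) :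
  (forall i j k l, X i j * Y k l = Y k l * X i j) ->
  (X *t 1%:M) *m (1%:M *t Y) = (1%:M *t Y) *m (X *t 1%:M) :> 'M_(n * n).
Proof.
move=> XY; apply: mxtens_eqP => s u b t; rewrite mul_leg1l mul_leg2l.
under eq_bigr => r _ do rewrite leg2E mulrnAr.
under [RHS]eq_bigr => r _ do rewrite leg1E mulrnAr.
by rewrite !big_delta' XY.
Qed.

Variable C : fieldType.
Local Notation K := (Kq C).
Local Notation q := (kq_q C).
Local Notation h := (kq_h C).

Definition kq_lam : K := q - q^-1.
Local Notation lam := kq_lam.
Definition qdel (i j : 'I_n) : K := if i == j then q else 1.

Lemma qdelC i j : qdel i j = qdel j i. Proof. by rewrite /qdel eq_sym. Qed.

Lemma kq_qV : q * q^-1 = 1. Proof. exact/mulrV/kq_q_unit. Qed.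
Lemma kq_Vq : q^-1 * q = 1. Proof. exact/mulVr/kq_q_unit. Qed.

Lemma RhatE (s u b t : 'I_n) : ent (Rhat C n) s u b t =
  qdel s u *+ ((s == t) && (u == b)) + lam *+ [&& (b < t)%N, s == b & u == t].
Proof.
rewrite mxE !mxtens_indexK /Rcoef /qdel.
have [<-|ub] := eqVneq u b; last first.
  rewrite andbF mulr0n add0r /=.
  case: (ltnP b u) => [bu|ub'] /=.
    rewrite (eq_sym b s); case: (u =P t) => [<-|_]; rewrite ?andbF //= bu andbT.
    by case: eqP.
  case: (ltnP b t) => // bt /=; case: (u =P t) => [e|]; last by rewrite andbF.
  by move: bt; rewrite -e ltnNge ub'.
rewrite andbT; have [<-|us] := eqVneq u s => /=.
  have [->|ut] := eqVneq u t => /=; first by rewrite ltnn addr0.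
  by rewrite ltnn /= mulr0n add0r andbF.
by rewrite ltnn !andbF andbT /= addr0; case: (s == t).
Qed.

Section Scaled.
Variables (L : comNzRingType) (sigma : {rmorphism K -> L}) (B : pzAlg L).

(** The map sigma is the identity for the quantum algebras and the value at q = 1
    for their classical limits. *)
Definition Rhat_along : 'M[B]_(n * n) := map_mx (fun k : K => sigma k *: (1 : B)) (Rhat C n).
Local Notation Rh := Rhat_along.

Lemma RhE s u b t : ent Rh s u b t =
  sigma (qdel s u) *: (1 : B) *+ ((s == t) && (u == b)) +
  sigma lam *: (1 : B) *+ [&& (b < t)%N, s == b & u == t].
Proof.
rewrite mxE RhatE rmorphD !rmorphMn /= scalerDl.
by case: (_ && _); case: [&& _, _ & _]; rewrite ?mulr1n ?mulr0n ?scale0r.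
Qed.

(** The matrix Rhat is sparse: each entry of a product involves two entries. *)
Lemma mulRl (M : 'M[B]_(n * n)) s u b t : ent (Rh *m M) s u b t =
  sigma (qdel s u) *: ent M u s b t + sigma lam *: ent M s u b t *+ (s < u)%N.
Proof.
rewrite mxtens_mulE.
under eq_bigr => c _ do under eq_bigr => d _ do
  rewrite RhE mulrDl !mulrnAl -!pz_scalerAl !mul1r.
under eq_bigr => c _ do rewrite big_split /=.
rewrite big_split /=; congr (_ + _).
  rewrite exchange_big /=.
  under eq_bigr => c _.
    under eq_bigr => d _ do rewrite -mulnb mulrnA.
    rewrite big_delta; over.
  by rewrite big_delta.
rewrite (bigD1 s) //= (bigD1 u) //= !eqxx !andbT big1; last first.
  by move=> d /negPf du; rewrite [u == d]eq_sym du !andbF.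
rewrite addr0 big1 ?addr0 // => c /negPf cs.
by rewrite big1 // => d _; rewrite [s == c]eq_sym cs andbF.
Qed.

Lemma mulRr (M : 'M[B]_(n * n)) s u b t : ent (M *m Rh) s u b t =
  sigma (qdel b t) *: ent M s u t b + sigma lam *: ent M s u b t *+ (b < t)%N.
Proof.
rewrite mxtens_mulE.
under eq_bigr => c _ do under eq_bigr => d _ do
  rewrite RhE mulrDr !mulrnAr -!pz_scalerAr !mulr1.
under eq_bigr => c _ do rewrite big_split /=.
rewrite big_split /=; congr (_ + _).
  rewrite (bigD1 t) //= (bigD1 b) //= !eqxx /= big1; last first.
    by move=> d /negPf->.
  rewrite addr0 big1 ?addr0 1?qdelC // => c /negPf ct.
  by rewrite big1 // => d _; rewrite ct.
rewrite (bigD1 b) //= (bigD1 t) //= !eqxx !andbT big1; last first.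
  by move=> d /negPf->; rewrite ?andbF.
rewrite addr0 big1 ?addr0 // => c /negPf cs.
by rewrite big1 // => d _; rewrite cs andbF.
Qed.

Definition RE (X : 'M[B]_n) : Prop :=
  Rh *m (1%:M *t X) *m Rh *m (1%:M *t X) = (1%:M *t X) *m Rh *m (1%:M *t X) *m Rh.
Definition RTT (X : 'M[B]_n) : Prop :=
  Rh *m (X *t 1%:M) *m (1%:M *t X) = (X *t 1%:M) *m (1%:M *t X) *m Rh.
End Scaled.

Section Homs.
Variables (L : comNzRingType) (sigma : {rmorphism K -> L}) (B : pzAlg L).
Local Notation T := (free_alg K ('I_n * 'I_n)%type).

Lemma map_Rhat_in (A : pzAlg K) (f : A -> B) : semialg_morphism sigma f ->
  map_mx f (Rhat_in n A) = Rhat_along sigma B.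
Proof.
by move=> hf; apply/matrixP => i j; rewrite !mxE (samZ hf) (sam1 hf).
Qed.

Lemma RE_map (A : pzAlg K) (f : A -> B) (X : 'M[A]_n) : semialg_morphism sigma f ->
  map_mx f (let L2 := 1%:M *t X in let Rh := Rhat_in n A in
            Rh *m L2 *m Rh *m L2 - L2 *m Rh *m L2 *m Rh) =
  let L2 := 1%:M *t map_mx f X in let Rh := Rhat_along sigma B in
            Rh *m L2 *m Rh *m L2 - L2 *m Rh *m L2 *m Rh.
Proof.
move=> hf; rewrite /= -(map_Rhat_in hf).
change f with (sam_rmorph hf : A -> B).
by rewrite map_mxB !map_mxM map_mxT map_mx1.
Qed.

Lemma RTT_map (A : pzAlg K) (f : A -> B) (X : 'M[A]_n) : semialg_morphism sigma f ->
  map_mx f (let X1 := X *t 1%:M in let X2 := 1%:M *t X in let Rh := Rhat_in n A in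
            Rh *m X1 *m X2 - X1 *m X2 *m Rh) =
  let X1 := map_mx f X *t 1%:M in let X2 := 1%:M *t map_mx f X in
  let Rh := Rhat_along sigma B in Rh *m X1 *m X2 - X1 *m X2 *m Rh.
Proof.
move=> hf; rewrite /= -(map_Rhat_in hf).
change f with (sam_rmorph hf : A -> B).
by rewrite map_mxB !map_mxM !map_mxT !map_mx1.
Qed.

Lemma flift_gen_mx (X : 'M[B]_n) :
  map_mx (flift sigma (fun p => X p.1 p.2)) (gen_mx C n) = X.
Proof. by apply/matrixP => i j; rewrite !mxE flift_gen. Qed.

Lemma LqM_lift (X : 'M[B]_n) : RE sigma X ->
  exists f : LqM C n -> B, semialg_morphism sigma f /\ forall i j, f (lq C n i j) = X i j.
Proof.
move=> hX; pose g := flift sigma (fun p : 'I_n * 'I_n => X p.1 p.2).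
have hg : semialg_morphism sigma g := flift_morphism sigma _.
have kill x : LqM_rels x -> g x = 0.
  move=> [i [j ->]]; have /matrixP /(_ i j) := RE_map (gen_mx C n) hg.
  by rewrite mxE => ->; rewrite flift_gen_mx /= hX subrr mxE.
exists (qlift g); split; first exact: qlift_morphism.
by move=> i j; rewrite mxE (qlift_pi hg kill) mxE [LHS]flift_gen.
Qed.

Lemma FqM_lift (X : 'M[B]_n) : RTT sigma X ->
  exists f : FqM C n -> B, semialg_morphism sigma f /\ forall i j, f (xq C i j) = X i j.
Proof.
move=> hX; pose g := flift sigma (fun p : 'I_n * 'I_n => X p.1 p.2).
have hg : semialg_morphism sigma g := flift_morphism sigma _.
have kill x : FqM_rels x -> g x = 0.
  move=> [i [j ->]]; have /matrixP /(_ i j) := RTT_map (gen_mx C n) hg.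
  by rewrite mxE => ->; rewrite flift_gen_mx /= hX subrr mxE.
exists (qlift g); split; first exact: qlift_morphism.
by move=> i j; rewrite (qlift_pi hg kill) mxE [LHS]flift_gen.
Qed.
End Homs.

Lemma lq_RE : RE [the {rmorphism K -> K} of idfun] (lq C n).
Proof.
apply/eqP; rewrite -subr_eq0; apply/eqP.
have hpi := quot_pi_morphism (@LqM_rels C n).
have := @RE_map K [the {rmorphism K -> K} of idfun] _ _ _ (gen_mx C n) hpi.
have -> : map_mx (quot_pi (LqM_rels (n:=n))) (gen_mx C n) = lq C n.
  by apply/matrixP => i j; rewrite !mxE.
move=> /= <-; apply/matrixP => i j; rewrite mxE [RHS]mxE.
by apply: quot_pi_eq0; exists i, j.
Qed.

Definition tq_mx : 'M[FqG C n]_n := \matrix_(i, j) tq C i j.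

Lemma tq_RTT : RTT [the {rmorphism K -> K} of idfun] tq_mx.
Proof.
apply/eqP; rewrite -subr_eq0; apply/eqP.
have h1 := quot_pi_morphism (@FqM_rels C n).
have h2 := quot_pi_morphism (@FqG_rels C n).
have hpi := sam_comp h1 h2.
have := @RTT_map K [the {rmorphism K -> K} of idfun] _ _ _ (gen_mx C n) hpi.
have -> : map_mx (quot_pi (@FqG_rels C n) \o quot_pi (FqM_rels (n:=n))) (gen_mx C n) = tq_mx.
  by apply/matrixP => i j; rewrite !mxE /tq /xq mxE.
move=> /= <-; apply/matrixP => i j; rewrite mxE [RHS]mxE /=.
rewrite [X in quot_pi _ X](_ : _ = 0) ?(sam0 h2) //.
by apply: quot_pi_eq0; exists i, j.
Qed.

Lemma LqM_ind (P : LqM C n -> Prop) :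
  (forall x y, P x -> P y -> P (x + y)) ->
  (forall x y, P x -> P y -> P (x * y)) ->
  (forall k x, P x -> P (k *: x)) -> P 1 ->
  (forall i j, P (lq C n i j)) -> forall x, P x.
Proof.
move=> PD PM PZ P1 Pg x; have [u ->] := quot_pi_surj x.
elim/free_ind: u => [u v|u v|k u||[i j]].
- by rewrite quot_piD; apply: PD.
- by rewrite quot_piM; apply: PM.
- by rewrite quot_piZ; apply: PZ.
- by rewrite (sam1 (quot_pi_morphism _)).
- by have := Pg i j; rewrite mxE mxE.
Qed.

End Tens.

(** * The quantum trace *)
(** The RTT relation turns conjugation by t2 across r into conjugation by t1, which
    commutes with x. *)
Lemma reflection_conj (R : pzRingType) (r x t1 t2 v1 v2 : R) :
  v1 * t1 = 1 -> t1 * v1 = 1 -> v2 * t2 = 1 -> t2 * v2 = 1 ->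
  x * t1 = t1 * x -> x * v1 = v1 * x ->
  r * t1 * t2 = t1 * t2 * r -> r * x * r * x = x * r * x * r ->
  r * (v2 * x * t2) * r * (v2 * x * t2) = (v2 * x * t2) * r * (v2 * x * t2) * r.
Proof.
move=> e1 e1' e2 e2' xt xv rtt re.
have k1 : t2 * r * v2 = v1 * r * t1.
  have /(congr1 (fun z => v1 * z * v2)) := rtt.
  by rewrite !mulrA e1 mul1r => <-; rewrite -!mulrA e2' mulr1.
have k2 : r * v2 * v1 = v2 * v1 * r.
  have /(congr1 (fun z => v2 * v1 * z * v2 * v1)) := rtt.
  rewrite -!mulrA (mulrA v1 t1) e1 mul1r (mulrA v2 t2) e2 mul1r.
  by rewrite (mulrA t2 v2) e2' mul1r e1' mulr1.
have k3 : x * t2 * r * v2 * x = v1 * (x * r * x) * t1.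
  rewrite -(mulrA x t2) -(mulrA x _ v2) k1 !mulrA xv -!mulrA.
  by rewrite xt.
have -> : r * (v2 * x * t2) * r * (v2 * x * t2) = r * v2 * (x * t2 * r * v2 * x) * t2.
  by rewrite !mulrA.
have -> : v2 * x * t2 * r * (v2 * x * t2) * r = v2 * (x * t2 * r * v2 * x) * t2 * r.
  by rewrite !mulrA.
rewrite k3 !mulrA k2 -!mulrA; congr (v2 * _); congr (v1 * _).
have rtt' : t1 * (t2 * r) = r * (t1 * t2) by rewrite !mulrA.
rewrite rtt' !mulrA.
by rewrite re.
Qed.

Section Weights.
Variables (C : fieldType) (n : nat).
Local Notation K := (Kq C).
Local Notation q := (kq_q C).
Local Notation lam := (kq_lam C).

Definition qweight (i : nat) : K := q ^ (n.+1%:Z - (2 * i.+1)%:Z).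
Local Notation w := qweight.

Lemma qweightS i : q * w i.+1 = q^-1 * w i.
Proof.
have qu := kq_q_unit C.
have -> : w i.+1 = q^-1 * (q^-1 * w i).
  rewrite -exprN1 /qweight -(exprzDr qu) -(exprzDr qu).
  by congr (q ^ _); rewrite !mulnS !PoszD; ring.
by rewrite (mulVKr qu).
Qed.
Lemma lam_qweight i : lam * w i = q * w i - q * w i.+1.
Proof. by rewrite qweightS /kq_lam mulrBl. Qed.

(** With these weights the Hecke parameter telescopes. *)
Lemma qweight_tele (a b : nat) : (a <= b <= n)%N ->
  \sum_(s < n | (a <= s < b)%N) lam * w s = q * w a - q * w b.
Proof.
case/andP=> ab bn.
rewrite -(big_mkord (fun s => (a <= s < b)%N) (fun s => lam * w s)).
have -> : \sum_(0 <= i < n | (a <= i < b)%N) lam * w i = \sum_(a <= i < b) lam * w i.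
  rewrite (@big_cat_nat _ _ _ b) //= [X in _ + X]big_nat_cond [X in _ + X]big1 ?addr0.
    rewrite (@big_cat_nat _ _ _ a) //= [X in X + _]big_nat_cond [X in X + _]big1 ?add0r.
      rewrite big_nat_cond [RHS]big_nat_cond; apply: eq_bigl => i.
      by case: (a <= i < b)%N; rewrite ?andbT ?andbF.
    by move=> i /andP[/andP[_ ia] /andP[ai _]]; move: ia; rewrite ltnNge ai.
  by move=> i /andP[/andP[ia _] /andP[_ ai]]; move: ia; rewrite leqNgt ai.
under eq_bigr => i _ do rewrite lam_qweight.
have := @telescope_sumr _ a b (fun i => - (q * w i)) ab.
by rewrite opprK addrC => <-; apply: eq_bigr => i _; rewrite opprK addrC.
Qed.

Lemma q2lam : q * q - lam * q = 1.
Proof. by rewrite /kq_lam mulrBl opprB addrC subrK kq_Vq. Qed.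
End Weights.

Ltac delta_simp := rewrite /= ?mulr0n ?mulr1n ?mul0rn ?scaler0 ?oppr0 ?sub0r ?subr0 ?add0r ?addr0 ?mulr0n ?mul0rn ?scaler0 ?oppr0 ?sub0r ?subr0 ?add0r ?addr0 ?scaler0 ?oppr0 ?addr0 ?sub0r ?oppr0 ?scale0r.

Section QuantumTrace.
Variables (C : fieldType) (n : nat) (A : pzAlg (Kq C)).
Local Notation K := (Kq C).
Local Notation q := (kq_q C).
Local Notation lam := (kq_lam C).
Local Notation w := (qweight C n).
Local Notation idK := [the {rmorphism K -> K} of idfun].
Local Notation Rh := (Rhat_along n idK A).
Local Notation leg2 X := (1%:M *t X : 'M[A]_(n * n)).
Local Notation leg1 X := (X *t 1%:M : 'M[A]_(n * n)).

Lemma ent_mulRl (M : 'M[A]_(n * n)) (s u b t : 'I_n) : ent (Rh *m M) s u b t =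
  qdel C s u *: ent M u s b t + lam *: ent M s u b t *+ (s < u)%N.
Proof. exact: mulRl. Qed.
Lemma ent_mulRr (M : 'M[A]_(n * n)) (s u b t : 'I_n) : ent (M *m Rh) s u b t =
  qdel C b t *: ent M s u t b + lam *: ent M s u b t *+ (b < t)%N.
Proof. exact: mulRr. Qed.

Local Notation kmx k M := (map_mx (fun x : A => k *: x) M).
Lemma kmx_mull k m p (M : 'M[A]_(m, p)) : kmx k 1%:M *m M = kmx k M.
Proof.
apply/matrixP => i j; rewrite !mxE (bigD1 i) //= big1 => [|l /negPf li].
  by rewrite !mxE eqxx addr0 -pz_scalerAl mul1r.
by rewrite !mxE eq_sym li scaler0 mul0r.
Qed.
Lemma kmx_mulr k m p (M : 'M[A]_(m, p)) : M *m kmx k 1%:M = kmx k M.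
Proof.
apply/matrixP => i j; rewrite !mxE (bigD1 j) //= big1 => [|l /negPf lj].
  by rewrite !mxE eqxx addr0 -pz_scalerAr mulr1.
by rewrite !mxE lj scaler0 mulr0.
Qed.

Lemma hecke : Rh *m Rh = kmx lam Rh + 1%:M.
Proof.
apply: mxtens_eqP => s u b t; rewrite ent_mulRl [RHS]mxE [X in _ = X + _]mxE.
rewrite !RhE mxE (can_eq (@mxtens_indexK n n)) xpair_eqE /=.
have dd i : qdel C i i = q by rewrite /qdel eqxx.
have [->|su] := eqVneq s u.
  rewrite ltnn mulr0n addr0 dd !scalerDr -!scalerMnr !scalerA.
  have [ut|ut] := eqVneq u t; have [ub|ub] := eqVneq u b; rewrite ?andbF ?andbT //= ?mulr0n ?addr0 ?add0r //.
  rewrite -ub -ut ltnn /= mulr0n !addr0 !mulr1n -[RHS]/(_ + (1%R : A)) -[X in _ + X]scale1r -scalerDl.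
  by congr (_ *: _); rewrite -[X in _ = _ + X](@q2lam C) addrC subrK.
have e1 : qdel C s u = 1 by rewrite /qdel (negPf su).
have e2 : qdel C u s = 1 by rewrite /qdel eq_sym (negPf su).
rewrite e1 e2 !scale1r.
case: (ltngtP s u) => [lsu|lus|/val_inj/eqP]; rewrite ?(negPf su) //.
- have -> : [&& (b < t)%N, u == b & s == t] = false.
    by apply/and3P => -[bt /eqP ub /eqP st]; move: bt; rewrite -ub -st ltnNge ltnW.
  by rewrite /= addr0 mulr1n addrC; congr (_ + _); rewrite andbC.
- have -> : [&& (b < t)%N, s == b & u == t] = false.
    by apply/and3P => -[bt /eqP sb /eqP ut]; move: bt; rewrite -sb -ut ltnNge ltnW.
  have -> : [&& (b < t)%N, u == b & s == t] = (s == t) && (u == b).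
    by rewrite [RHS]andbC; apply: andb_idl => /andP[/eqP<- /eqP<-].
  by rewrite /= !addr0 scalerMnr addrC [(u == t) && _]andbC.
Qed.

Definition Rinv : 'M[A]_(n * n) := Rh - kmx lam 1%:M.
Lemma RhK : Rh *m Rinv = 1%:M.
Proof. by rewrite mulmxBr hecke kmx_mulr addrC addKr. Qed.
Lemma RinvK : Rinv *m Rh = 1%:M.
Proof. by rewrite mulmxBl hecke kmx_mull addrC addKr. Qed.

(** The quantum trace over the first tensor factor. *)
Definition qptrace (M : 'M[A]_(n * n)) (u t : 'I_n) : A :=
  \sum_(s < n) w s *: ent M s u s t.

Lemma qtraceE (Y : 'M[A]_n) : qtrace Y = \sum_(s < n) w s *: Y s s.
Proof. by []. Qed.

Lemma qptrace_mul2r M (X : 'M[A]_n) u t :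
  qptrace (M *m leg2 X) u t = \sum_r qptrace M u r * X r t.
Proof.
rewrite /qptrace; under [RHS]eq_bigr => r _ do rewrite mulr_suml.
rewrite exchange_big; apply: eq_bigr => s _ /=.
rewrite mul_leg2r scaler_sumr; apply: eq_bigr => r _.
by rewrite pz_scalerAl.
Qed.
Lemma qptrace_mul2l M (X : 'M[A]_n) u t :
  qptrace (leg2 X *m M) u t = \sum_r X u r * qptrace M r t.
Proof.
rewrite /qptrace; under [RHS]eq_bigr => r _ do rewrite mulr_sumr.
rewrite exchange_big; apply: eq_bigr => s _ /=.
rewrite mul_leg2l scaler_sumr; apply: eq_bigr => r _.
by rewrite pz_scalerAr.
Qed.

Lemma ent_leg2R (Y : 'M[A]_n) s u b t : ent (leg2 Y *m Rh) s u b t =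
  qdel C b t *: Y u b *+ (s == t) + lam *: Y u t *+ (s == b) *+ (b < t)%N.
Proof. by rewrite ent_mulRr !leg2E -!scalerMnr. Qed.

(** Off the diagonal all contributions are multiples of the same entry of Y, and
    they cancel by telescoping. *)
Lemma qptrace_RinvYR (Y : 'M[A]_n) u t :
  qptrace (Rinv *m leg2 Y *m Rh) u t = qtrace Y *+ (u == t).
Proof.
have E s : ent (Rinv *m leg2 Y *m Rh) s u s t =
   qdel C s u *: (qdel C s t *: Y s s *+ (u == t) + lam *: Y s t *+ (u == s) *+ (s < t)%N)
   - lam *: (qdel C s t *: Y u s *+ (s == t) + lam *: Y u t *+ (s < t)%N) *+ (u <= s)%N.
  rewrite -mulmxA mulmxBl kmx_mull mxE [X in _ + X]mxE [X in _ - X]mxE ent_mulRl !ent_leg2R eqxx mulr1n.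
  rewrite -addrA; congr (_ + _); rewrite (ltnNge s u).
  by case: (u <= s)%N; rewrite /= ?mulr0n ?mulr1n ?sub0r ?subrr ?oppr0.
rewrite /qptrace; under eq_bigr => s _ do rewrite E.
have dd i : qdel C i i = q by rewrite /qdel eqxx.
have [->|ut] := eqVneq u t.
  rewrite mulr1n qtraceE; apply: eq_bigr => s _; congr (_ *: _).
  have [->|st] := eqVneq s t.
    rewrite !dd leqnn ltnn !mulr1n !mulr0n !addr0 !scalerA -scalerBl.
    by rewrite q2lam scale1r.
  have -> : qdel C s t = 1 by rewrite /qdel (negPf st).
  rewrite !scale1r /= !mulr0n mulr1n mul0rn addr0 add0r.
  case: (ltngtP s t) => [lst|lts|/val_inj e]; rewrite ?mulr0n ?subr0 ?scaler0 ?mul0rn ?subr0 //.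
rewrite mulr0n.
have E2 (s : 'I_n) : w s *: (qdel C s u *: (qdel C s t *: Y s s *+ false + lam *: Y s t *+ (u == s) *+ (s < t)%N)
   - lam *: (qdel C s t *: Y u s *+ (s == t) + lam *: Y u t *+ (s < t)%N) *+ (u <= s)%N)
   = ((lam * (q * w u)) *+ (u == s) *+ (u < t)%N - (lam * (q * w t)) *+ (t == s) *+ (u < t)%N
     - (lam * (lam * w s)) *+ (u <= s < t)%N) *: Y u t.
  have [<-|us] := eqVneq u s.
    rewrite dd leqnn (negPf ut) [t == u]eq_sym (negPf ut) !mulr0n !add0r !mul0rn subr0 !mulr1n.
    case: (u < t)%N; rewrite ?mulr0n ?scaler0 ?subr0 ?scale0r ?scaler0 // !mulr1n.
    by rewrite !scalerA -scalerBl !scalerA; congr (_ *: _); rewrite mulrBr; ring.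
  rewrite mulr0n mul0rn !add0r scaler0 sub0r.
  have [->|st] := eqVneq s t.
    rewrite !dd ltnn !mulr0n andbF mulr0n mul0rn !mulr1n addr0 sub0r subr0.
    rewrite leq_eqVlt (_ : (u == t :> nat) = false) /=; last exact: negbTE.
    case: (u < t)%N; rewrite ?mulr0n ?oppr0 ?scaler0 ?scale0r // !mulr1n.
    by rewrite scalerN !scalerA scaleNr; congr (- (_ *: _)); ring.
  delta_simp.
  case: (u <= s)%N; case: (s < t)%N; delta_simp => //.
  by rewrite scalerN !scalerA scaleNr; congr (- (_ *: _)); ring.
under eq_bigr => s _ do rewrite E2.
rewrite -scaler_suml !sumrB.
rewrite (_ : \sum_(i < n) _ *+ (u == i) *+ _ = lam * (q * w u) *+ (u < t)%N); last first.
  by rewrite sumrMnl big_delta.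
rewrite (_ : \sum_(i < n) _ *+ (t == i) *+ _ = lam * (q * w t) *+ (u < t)%N); last first.
  by rewrite sumrMnl big_delta.
have -> : \sum_(i < n) (lam * (lam * w i)) *+ (u <= i < t)%N =
  lam * (q * w u - q * w t) *+ (u < t)%N.
  case: (ltnP u t) => lut.
    rewrite mulr1n -(@qweight_tele C n u t) ?(ltnW lut) ?(ltnW (ltn_ord _)) // mulr_sumr.
    rewrite [RHS]big_mkcond; apply: eq_bigr => i _; by case: ifP.
  rewrite mulr0n big1 // => i _; case: andP => // -[ui it].
  by have := leq_ltn_trans ui it; rewrite ltnNge lut.
by rewrite -!mulrnBl mulrBr subrr mul0rn scale0r.
Qed.

Lemma qptrace_Rh u t : qptrace Rh u t = (q * w 0) *: (1 : A) *+ (u == t).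
Proof.
have E (s : 'I_n) : w s *: ent Rh s u s t =
    (((q * w s) *+ (t == s) + (lam * w s) *+ (s < t)%N) *: (1 : A)) *+ (u == t).
  rewrite RhE eqxx /= [t == s]eq_sym; have [->|ut] := eqVneq u t.
    rewrite /= andbT mulr1n [RHS]scalerDl [LHS]scalerDr; congr (_ + _).
      have [->|st] := eqVneq s t; last by rewrite !mulr0n scaler0 scale0r.
      by rewrite /= /qdel eqxx !mulr1n scalerA mulrC.
    by case: (s < t)%N; rewrite ?mulr1n ?mulr0n ?scaler0 ?scale0r // scalerA mulrC.
  have -> : (s == t) && (u == s) = false.
    by apply/andP => -[/eqP st /eqP us]; rewrite us st eqxx in ut.
  by rewrite andbF !mulr0n addr0 scaler0.
rewrite /qptrace; under eq_bigr => s _ do rewrite E.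
rewrite sumrMnl -scaler_suml big_split /= big_delta.
have -> : \sum_(s < n) (lam * w s) *+ (s < t)%N = q * w 0 - q * w t.
  rewrite -(@qweight_tele C n 0 t) ?(ltnW (ltn_ord _)) //= [RHS]big_mkcond.
  by apply: eq_bigr => s _; case: (s < t)%N.
by rewrite addrC subrK.
Qed.

(** The partial trace of Rhat is a scalar, so exchanging the two outer factors
    changes nothing. *)
Lemma qptrace_RYRinv (Y : 'M[A]_n) u t :
  qptrace (Rh *m leg2 Y *m Rinv) u t = qtrace Y *+ (u == t).
Proof.
rewrite -qptrace_RinvYR.
have D (M M' : 'M[A]_(n * n)) : qptrace (M - kmx lam M') u t = qptrace M u t - lam *: qptrace M' u t.
  rewrite /qptrace scaler_sumr -sumrB; apply: eq_bigr => s _.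
  by rewrite mxE [X in _ + X]mxE [X in _ - X]mxE scalerBr !scalerA mulrC.
have kM (M M' : 'M[A]_(n * n)) : kmx lam M *m M' = kmx lam (M *m M').
  by rewrite -[kmx lam M]kmx_mull -mulmxA kmx_mull.
rewrite /Rinv mulmxBr kmx_mulr !mulmxBl kmx_mull kM !D; congr (_ - lam *: _).
rewrite qptrace_mul2r qptrace_mul2l.
under eq_bigr => r _ do rewrite qptrace_Rh mulrnAl -pz_scalerAl mul1r.
under [RHS]eq_bigr => r _ do rewrite qptrace_Rh mulrnAr -pz_scalerAr mulr1.
by rewrite big_delta big_delta'.
Qed.

Section Central.
Variable X : 'M[A]_n.
Hypothesis hX : RE idK X.

(** For d = 1 this is the reflection equation multiplied by the inverse of Rhat on
    both sides; inserting Rhat and its inverse between the factors gives powers. *)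
Lemma RE_shift d :
  Rinv *m leg2 (X ^+ d) *m Rh *m leg2 X = leg2 X *m (Rh *m leg2 (X ^+ d) *m Rinv).
Proof.
elim: d => [|d ih].
  by rewrite expr0 leg2_1 !mulmx1 RinvK mul1mx RhK mulmx1.
have base : Rinv *m leg2 X *m Rh *m leg2 X = leg2 X *m Rh *m leg2 X *m Rinv.
  have /(congr1 (fun z => Rinv *m z *m Rinv)) := hX.
  rewrite -!(mulmxA Rh) (mulmxA Rinv Rh) RinvK mul1mx => ->.
  by rewrite !mulmxA -(mulmxA _ Rh Rinv) RhK mulmx1.
have -> : leg2 (X ^+ d.+1) = leg2 X *m leg2 (X ^+ d) by rewrite exprS leg2_mul.
have -> : Rinv *m (leg2 X *m leg2 (X ^+ d)) *m Rh *m leg2 X =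
   Rinv *m leg2 X *m Rh *m (Rinv *m leg2 (X ^+ d) *m Rh *m leg2 X).
  by rewrite !mulmxA -(mulmxA _ Rh Rinv) RhK mulmx1.
rewrite ih !mulmxA base -!mulmxA (mulmxA Rinv Rh) RinvK mul1mx.
by rewrite !mulmxA.
Qed.

(** In the partial trace of the shifted reflection equation, the conjugated power
    of X contributes the scalar qtrace (X ^+ d) on either side. *)
Lemma qtrace_comm d u t : qtrace (X ^+ d) * X u t = X u t * qtrace (X ^+ d).
Proof.
have := congr1 (fun M => qptrace M u t) (RE_shift d).
rewrite /= qptrace_mul2r qptrace_mul2l.
under eq_bigr => r _ do rewrite qptrace_RinvYR mulrnAl.
under [RHS]eq_bigr => r _ do rewrite qptrace_RYRinv mulrnAr.
by rewrite big_delta big_delta'.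
Qed.
End Central.

Section Coinvariance.
Variables (T V : 'M[A]_n).
Hypotheses (VT : V *m T = 1%:M) (TV : T *m V = 1%:M) (hT : RTT idK T).

Lemma RTT_shift : leg1 V *m Rh *m leg1 T = leg2 T *m Rh *m leg2 V.
Proof.
have /(congr1 (fun z => leg1 V *m z *m leg2 V)) := hT.
rewrite !mulmxA leg1_mul VT leg2_1 mul1mx => <-.
by rewrite -!mulmxA leg2_mul TV leg2_1 mulmx1.
Qed.

Let Z (u t : 'I_n) : A := \sum_(s < n) w s *: (V s t * T u s).

(* The partial trace of the shifted RTT relation, a triangular system. *)
Let Zrec (u t : 'I_n) : qdel C t u *: Z u t + lam *: (\sum_(r < n | (r < u)%N) Z r r) *+ (u == t) =
  ((q * w 0) *: (1 : A)) *+ (u == t).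
Proof.
have := RTT_shift => /(congr1 (fun M => \sum_(s < n) w s *: ent M s u s t)) /=.
have L s : ent (leg1 V *m Rh *m leg1 T) s u s t = qdel C t u *: (V s t * T u s) +
    lam *: (\sum_(r < n | (r < u)%N) V s r * T r s) *+ (u == t).
  rewrite -mulmxA mul_leg1l.
  under eq_bigr => r _ do rewrite ent_mulRl !leg1E mulrDr -pz_scalerAr mulrnAr.
  rewrite big_split /=; congr (_ + _).
    rewrite (bigD1 t) //= eqxx mulr1n big1 ?addr0 // => r /negPf->.
    by rewrite mulr0n scaler0.
  rewrite [RHS]scalerMnr [in RHS]big_mkcond -sumrMnl scaler_sumr; apply: eq_bigr => r _.
  case: (r < u)%N; rewrite ?mulr0n ?mulr1n ?mul0rn ?scaler0 ?mulr0 //.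
  by rewrite -pz_scalerAr mulrnAr.
have Rr s : ent (leg2 T *m Rh *m leg2 V) s u s t = q *: (T u s * V s t) +
    lam *: (\sum_(r < n | (s < r)%N) T u r * V r t).
  rewrite -mulmxA mul_leg2l.
  under eq_bigr => r _ do rewrite ent_mulRl !leg2E mulrDr -pz_scalerAr mulrnAr.
  rewrite big_split /=; congr (_ + _).
    rewrite (bigD1 s) //= eqxx mulr1n big1 ?addr0 ?/qdel ?eqxx // => r /negPf->.
    by rewrite mulr0n ?mulr0 ?scaler0 ?mulr0.
  rewrite [in RHS]big_mkcond scaler_sumr; apply: eq_bigr => r _.
  by rewrite eqxx; case: (s < r)%N; rewrite ?mulr0n ?mulr1n ?scaler0 ?mulr0 // -pz_scalerAr.
under eq_bigr => s _ do rewrite L scalerDr.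
under [RHS]eq_bigr => s _ do rewrite Rr scalerDr.
rewrite !big_split /= => E.
have E1 : \sum_(i < n) w i *: (qdel C t u *: (V i t * T u i)) = qdel C t u *: Z u t.
  by rewrite scaler_sumr; apply: eq_bigr => s _; rewrite !scalerA mulrC.
have E2 : \sum_(i < n) w i *: (lam *: (\sum_(r < n | (r < u)%N) V i r * T r i) *+ (u == t)) =
   lam *: (\sum_(r < n | (r < u)%N) Z r r) *+ (u == t).
  rewrite [X in _ = X *+ _]scaler_sumr -sumrMnl.
  under eq_bigr => s _ do rewrite -scalerMnr scalerA scaler_sumr -sumrMnl.
  rewrite exchange_big /=; apply: eq_bigr => r _; rewrite /Z scaler_sumr -sumrMnl.
  by apply: eq_bigr => s _; rewrite scalerA mulrC.
rewrite E1 E2 in E; rewrite {}E.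
have -> : \sum_(i < n) w i *: (q *: (T u i * V i t)) = \sum_(i < n) (q * w i) *: (T u i * V i t).
  by apply: eq_bigr => i _; rewrite scalerA mulrC.
have -> : \sum_(i < n) w i *: (lam *: \sum_(r < n | (i < r)%N) T u r * V r t) =
   \sum_(r < n) (q * w 0 - q * w r) *: (T u r * V r t).
  under eq_bigr => i _ do rewrite scalerA scaler_sumr big_mkcond /=.
  rewrite exchange_big /=; apply: eq_bigr => r _.
  rewrite -(@qweight_tele C n 0 r) ?(ltnW (ltn_ord _)) //= scaler_suml [RHS]big_mkcond /=.
  by apply: eq_bigr => i _; case: ifP => // _; rewrite mulrC.
rewrite -big_split /=; under eq_bigr => i _ do rewrite -scalerDl addrC subrK.
rewrite -scaler_sumr; have /matrixP /(_ u t) := TV; rewrite mxE => ->.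
by rewrite mxE scalerMnr.
Qed.

(** The square of the antipode is conjugation by the weights of the quantum
    trace. *)
Lemma twisted_inverse (u t : 'I_n) : \sum_(s < n) w s *: (V s t * T u s) = (w t *: (1 : A)) *+ (u == t).
Proof.
have qu := kq_q_unit C.
have qinj (x y : A) : q *: x = q *: y -> x = y.
  by move=> /(congr1 (fun z => q^-1 *: z)); rewrite !scalerA kq_Vq !scale1r.
have diag r : Z r r = w r *: (1 : A).
  have [m] := ubnP (r : nat); elim: m r => // m ih r; rewrite ltnS => rm.
  have := Zrec r r; rewrite eqxx !mulr1n /qdel eqxx.
  rewrite (eq_bigr (fun i : 'I_n => w i *: (1 : A))) => [e|i ir]; last by apply: ih; apply: leq_trans rm.
  apply: qinj; move: e => /(canRL (addrK _)) ->.
  rewrite -scaler_suml !scalerA -scalerBl mulr_sumr (@qweight_tele C n 0 r) ?(ltnW (ltn_ord _)) //.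
  by rewrite opprB addrC subrK.
have [->|ut] := eqVneq u t; first by rewrite mulr1n; apply: diag.
have := Zrec u t; rewrite (negPf ut) !mulr0n addr0 /qdel eq_sym (negPf ut) scale1r.
by [].
Qed.

(** The weights turn the products V_sb T_as, taken in the wrong order for the
    relation T V = 1, into a Kronecker delta. *)
Lemma qtrace_conj (Y : 'M[A]_n) :
  (forall i j k l, Y i j * T k l = T k l * Y i j) ->
  (forall i j k l, Y i j * V k l = V k l * Y i j) ->
  qtrace (V *m Y *m T) = qtrace Y.
Proof.
move=> YT YV; rewrite !qtraceE.
have E s : (V *m Y *m T) s s = \sum_a \sum_b Y b a * (V s b * T a s).
  rewrite mxE; apply: eq_bigr => a _; rewrite mxE mulr_suml; apply: eq_bigr => b _.
  by rewrite mulrA YV.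
under eq_bigr => s _ do rewrite E scaler_sumr.
rewrite exchange_big /=; apply: eq_bigr => a _.
under eq_bigr => s _ do rewrite scaler_sumr.
rewrite exchange_big /=.
have E2 b : \sum_(s < n) w s *: (Y b a * (V s b * T a s)) = w b *: Y b a *+ (a == b).
  under eq_bigr => s _ do rewrite pz_scalerAr.
  by rewrite -mulr_sumr twisted_inverse mulrnAr -pz_scalerAr mulr1.
under eq_bigr => b _ do rewrite E2.
by rewrite big_delta.
Qed.

Lemma RE_conj (X : 'M[A]_n) : RE idK X ->
  (forall i j k l, X i j * T k l = T k l * X i j) ->
  (forall i j k l, X i j * V k l = V k l * X i j) -> RE idK (V *m X *m T).
Proof.
move=> hX XT XV; rewrite /RE -!leg2_mul.
apply: (@reflection_conj _ Rh (leg2 X) (leg1 T) (leg2 T) (leg1 V) (leg2 V)) => //.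
- by rewrite [LHS]leg1_mul VT leg2_1.
- by rewrite [LHS]leg1_mul TV leg2_1.
- by rewrite [LHS]leg2_mul VT leg2_1.
- by rewrite [LHS]leg2_mul TV leg2_1.
- by rewrite [RHS]leg12_comm // => i j k l; rewrite XT.
- by rewrite [RHS]leg12_comm // => i j k l; rewrite XV.
Qed.
End Coinvariance.
End QuantumTrace.

#[local] Opaque quot_alg free_alg tensor tens tlift tmap tassoc.
(** * The coaction *)

Section MorphEq.
Variables (C : fieldType) (n : nat).
Local Notation K := (Kq C).
Local Notation LM := (LqM C n).
Local Notation FN := (FqN C n).
Local Notation piN := (quot_pi (@FqN_rels C n)).

Lemma LqM_morph_eq (L : comNzRingType) (sigma : K -> L) (B : pzAlg L) (f g : LM -> B) :
  semialg_morphism sigma f -> semialg_morphism sigma g ->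
  (forall i j, f (lq C n i j) = g (lq C n i j)) -> f =1 g.
Proof.
move=> hf hg e; elim/LqM_ind => [x y ex ey|x y ex ey|k x ex||//].
- by rewrite (samD hf) (samD hg) ex ey.
- by rewrite (samM hf) (samM hg) ex ey.
- by rewrite (samZ hf) (samZ hg) ex.
- by rewrite (sam1 hf) (sam1 hg).
Qed.

Lemma FqN_morph_eq (L : comNzRingType) (sigma : K -> L) (B : pzAlg L) (f g : FN -> B) :
  semialg_morphism sigma f -> semialg_morphism sigma g ->
  (forall i j, f (piN (lq C n i j)) = g (piN (lq C n i j))) -> f =1 g.
Proof.
move=> hf hg e x; have [y ->] := quot_pi_surj x.
have hp := quot_pi_morphism (@FqN_rels C n).
exact: (LqM_morph_eq (sam_comp hp hf) (sam_comp hp hg)).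
Qed.

End MorphEq.

Section Coaction.
Variables (C : fieldType) (n : nat).
Local Notation K := (Kq C).
Local Notation idK := [the {rmorphism K -> K} of idfun].
Variables (FG : pzAlg K) (T : 'M[FG]_n).
Variables (Delta : FG -> tensor FG FG) (eps : FG -> K) (S : FG -> FG).
Hypotheses (hopfG : hopf_algebra Delta eps S) (hT : RTT idK T).
Hypothesis Dt : forall i j, Delta (T i j) = \sum_(s < n) T i s \ox T s j.
Hypothesis et : forall i j, eps (T i j) = (i == j)%:R.

Let hD : alg_morphism Delta := comul_morphism hopfG.
Let heps : @alg_morphism K FG (alg_pzAlg K^o) eps := counit_morphism hopfG.
Let hS : linear S := antipode_linear hopfG.
Let eps1 : eps 1 = 1. Proof. exact: (sam1 heps). Qed.
Let epsM x y : eps (x * y) = eps x * eps y. Proof. exact: (samM heps). Qed.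
Let epsD x y : eps (x + y) = eps x + eps y. Proof. exact: (samD heps). Qed.
Let epsZ k x : eps (k *: x) = k * eps x. Proof. exact: (samZ heps). Qed.
Let SD x y : S (x + y) = S x + S y. Proof. by rewrite -{1}[x]scale1r hS scale1r. Qed.
Let S0 : S 0 = 0. Proof. by apply: (addrI (S 0)); rewrite -SD !addr0. Qed.
Let SZ k x : S (k *: x) = k *: S x. Proof. by rewrite -[k *: x]addr0 hS S0 addr0. Qed.

Definition antipode_mx : 'M[FG]_n := \matrix_(i, j) S (T i j).
Local Notation V := antipode_mx.

Lemma tlift_sum (K' : comNzRingType) (A B : pzAlg K') (U : zmodType) (f : A -> B -> U)
    (I : Type) (r : seq I) (P : pred I) (F : I -> tensor A B) : balanced f ->
  tlift f (\sum_(i <- r | P i) F i) = \sum_(i <- r | P i) tlift f (F i).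
Proof.
move=> fb; apply: (big_morph (tlift f)); last exact: tlift0.
by move=> x y; apply: tliftD.
Qed.

Lemma antipode_mxl : V *m T = 1%:M.
Proof.
have b : balanced (fun a b : FG => S a * b).
  by split=> [a a' c|a c c'|k a c]; rewrite ?SD ?mulrDl ?mulrDr ?SZ -?pz_scalerAl ?pz_scalerAr.
apply/matrixP => i j; rewrite !mxE.
have h : tlift (fun a b => S a * b) (Delta (T i j)) = eps (T i j) *: (1 : FG).
  exact: (antipodel hopfG).
rewrite Dt (tlift_sum _ _ _ b) et in h.
have <- : \sum_(s < n) tlift (fun a b : FG => S a * b) (T i s \ox T s j) = \sum_(s < n) V i s * T s j.
  by apply: eq_bigr => s _; rewrite (tlift_tens _ _ b) !mxE.
by rewrite h; case: (i == j); rewrite ?scale1r ?scale0r.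
Qed.
Lemma antipode_mxr : T *m V = 1%:M.
Proof.
have b : balanced (fun a b : FG => a * S b).
  by split=> [a a' c|a c c'|k a c]; rewrite ?SD ?mulrDl ?mulrDr ?SZ -?pz_scalerAl ?pz_scalerAr.
apply/matrixP => i j; rewrite !mxE.
have h : tlift (fun a b => a * S b) (Delta (T i j)) = eps (T i j) *: (1 : FG).
  exact: (antipoder hopfG).
rewrite Dt (tlift_sum _ _ _ b) et in h.
have <- : \sum_(s < n) tlift (fun a b : FG => a * S b) (T i s \ox T s j) = \sum_(s < n) T i s * V s j.
  by apply: eq_bigr => s _; rewrite (tlift_tens _ _ b) !mxE.
by rewrite h; case: (i == j); rewrite ?scale1r ?scale0r.
Qed.

Lemma morph_mulmx (K' L : comNzRingType) (sigma : K' -> L) (A : pzAlg K') (B : pzAlg L)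
    (f : A -> B) (hf : semialg_morphism sigma f) m p r (M : 'M[A]_(m, p)) (N : 'M_(p, r)) :
  map_mx f (M *m N) = map_mx f M *m map_mx f N.
Proof. exact: (map_mxM (sam_rmorph hf)). Qed.
Lemma morph_mx1 (K' L : comNzRingType) (sigma : K' -> L) (A : pzAlg K') (B : pzAlg L)
    (f : A -> B) (hf : semialg_morphism sigma f) m :
  map_mx f (1%:M : 'M[A]_m) = 1%:M.
Proof. exact: (map_mx1 (sam_rmorph hf)). Qed.
Lemma morph_mxX (K' L : comNzRingType) (sigma : K' -> L) (A : pzAlg K') (B : pzAlg L)
    (f : A -> B) (hf : semialg_morphism sigma f) m (M : 'M[A]_m) d :
  map_mx f (M ^+ d) = map_mx f M ^+ d.
Proof.
elim: d => [|d ih]; first by rewrite !expr0; apply: morph_mx1 hf _.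
by rewrite !exprS -ih; apply: morph_mulmx hf _ _ _ _ _.
Qed.

(** The antipode reverses the coproduct of the generators, since both sides
    invert the matrix of the Delta (t_ij). *)
Lemma Delta_antipode i j :
  Delta (S (T i j)) = \sum_(a < n) S (T a j) \ox S (T i a).
Proof.
have h1 := tens_injl_morphism FG FG; have h2 := tens_injr_morphism FG FG.
set i1 := (fun a : FG => a \ox (1 : FG)) in h1; set i2 := (fun b : FG => (1 : FG) \ox b) in h2.
pose E := map_mx i2 V *m map_mx i1 V.
have DT : map_mx Delta T = map_mx i1 T *m map_mx i2 T.
  apply/matrixP => k l; rewrite !mxE Dt; apply: eq_bigr => s _.
  by rewrite !mxE /i1 /i2 tens_mul mul1r mulr1.
have e1 : map_mx Delta V *m map_mx Delta T = 1%:M.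
  by rewrite -(morph_mulmx hD) antipode_mxl (morph_mx1 hD).
have e2 : map_mx Delta T *m E = 1%:M.
  rewrite DT /E mulmxA -(mulmxA _ _ (map_mx i2 V)) -(morph_mulmx h2) antipode_mxr.
  by rewrite (morph_mx1 h2) mulmx1 -(morph_mulmx h1) antipode_mxr (morph_mx1 h1).
have DV : map_mx Delta V = E by rewrite -[LHS]mulmx1 -e2 mulmxA e1 mul1mx.
have /matrixP /(_ i j) := DV; rewrite !mxE => ->; apply: eq_bigr => a _.
by rewrite !mxE /i1 /i2 tens_mul mul1r mulr1.
Qed.

Lemma eps_antipode i j : eps (S (T i j)) = (i == j)%:R.
Proof.
have e1 : map_mx eps V *m map_mx eps T = 1%:M.
  by have := morph_mulmx heps V T; rewrite antipode_mxl (morph_mx1 heps).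
have eT : map_mx eps T = 1%:M by apply/matrixP => k l; rewrite !mxE et.
by move: e1; rewrite eT mulmx1 => /matrixP /(_ i j); rewrite !mxE.
Qed.

Section Beta.
Variables (A : pzAlg K) (X : 'M[A]_n).
Local Notation AG := (tensor A FG).
Local Notation i1 := (fun a : A => (a \ox (1 : FG) : AG)).
Local Notation i2 := (fun b : FG => ((1 : A) \ox b : AG)).

Definition conj_mx : 'M[AG]_n := map_mx i2 V *m map_mx i1 X *m map_mx i2 T.

Lemma conj_mxE i j :
  conj_mx i j = \sum_(a < n) \sum_(b < n) X a b \ox (S (T i a) * T b j).
Proof.
rewrite mxE exchange_big /=; apply: eq_bigr => b _; rewrite mxE mulr_suml.
by apply: eq_bigr => a _; rewrite !mxE !tens_mul !mulr1 mul1r.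
Qed.

Let h1 : alg_morphism i1 := tens_injl_morphism A FG.
Let h2 : alg_morphism i2 := tens_injr_morphism A FG.

Let VT2 : map_mx i2 V *m map_mx i2 T = 1%:M.
Proof. by rewrite -(morph_mulmx h2) antipode_mxl (morph_mx1 h2). Qed.
Let TV2 : map_mx i2 T *m map_mx i2 V = 1%:M.
Proof. by rewrite -(morph_mulmx h2) antipode_mxr (morph_mx1 h2). Qed.
Let comm12 (Y : 'M[A]_n) (U : 'M[FG]_n) i j k l :
  map_mx i1 Y i j * map_mx i2 U k l = map_mx i2 U k l * map_mx i1 Y i j.
Proof. by rewrite !mxE !tens_mul !mul1r !mulr1. Qed.
Let RTT2 : RTT idK (map_mx i2 T).
Proof.
apply/eqP; rewrite -subr_eq0; apply/eqP.
have := @RTT_map n C K idK _ _ _ T h2 => /= <-.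
have /eqP := hT; rewrite -subr_eq0 => /eqP e.
by rewrite [X in map_mx _ X]e; apply/matrixP => i j; rewrite !mxE tens0r.
Qed.

(** The entries of X and T sit in different tensor factors, hence commute. *)
Lemma conj_mx_RE : RE idK X -> RE idK conj_mx.
Proof.
move=> hX; apply: RE_conj; [exact: VT2|exact: TV2|exact: RTT2| |exact: comm12|exact: comm12].
apply/eqP; rewrite -subr_eq0; apply/eqP.
have := @RE_map n C K idK _ _ _ X h1 => /= <-.
have /eqP := hX; rewrite -subr_eq0 => /eqP e.
by rewrite [X in map_mx _ X]e; apply/matrixP => i j; rewrite !mxE tens0l.
Qed.

Lemma conj_mxX d : conj_mx ^+ d = map_mx i2 V *m map_mx i1 (X ^+ d) *m map_mx i2 T.
Proof.
elim: d => [|d ih]; first by rewrite !expr0 (morph_mx1 h1) mulmx1 VT2.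
rewrite exprS ih [X ^+ d.+1]exprS (morph_mulmx h1) -[LHS]/(_ *m _) /conj_mx.
by rewrite !mulmxA -(mulmxA _ (map_mx i2 T) (map_mx i2 V)) TV2 mulmx1.
Qed.

Lemma qtrace_conj_mxX d : qtrace (conj_mx ^+ d) = qtrace (X ^+ d) \ox 1.
Proof.
rewrite conj_mxX qtrace_conj; [|exact: VT2|exact: TV2|exact: RTT2|exact: comm12|exact: comm12].
rewrite !qtraceE tens_suml; apply: eq_bigr => i _.
by rewrite mxE tensZl.
Qed.
End Beta.

Lemma qtrace_morph (A B : pzAlg K) (f : A -> B) (M : 'M[A]_n) : alg_morphism f ->
  f (qtrace M) = qtrace (map_mx f M).
Proof.
move=> hf; rewrite !qtraceE (sam_sum hf); apply: eq_bigr => i _.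
by rewrite (samZ hf) mxE.
Qed.

Lemma id_tens_Delta_morphism (A : pzAlg K) : alg_morphism (tmap (@id A) Delta).
Proof. by apply: (tmap_morphism (sam_id A) hD). Qed.

Lemma counit_balanced (A : pzAlg K) : balanced (fun (b : A) (h : FG) => eps h *: b).
Proof.
split=> [a a' b|a b b'|k a b]; first by rewrite scalerDr.
  by rewrite epsD scalerDl.
by rewrite epsZ scalerA mulrC.
Qed.

Lemma counit_map_morphism (A : pzAlg K) :
  alg_morphism (tlift (fun (b : A) (h : FG) => eps h *: b)).
Proof.
apply: tlift_morphism; first exact: counit_balanced.
- by rewrite eps1 scale1r.
- move=> a b c d; rewrite epsM -scalerA -pz_scalerAl -pz_scalerAr.
  by rewrite ![eps _ *: (eps _ *: _)]scalerA mulrC.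
- by move=> k a b; rewrite !scalerA mulrC.
Qed.

Lemma sum4_exchange (W : nmodType) (F : 'I_n -> 'I_n -> 'I_n -> 'I_n -> W) :
  \sum_a \sum_b \sum_c \sum_d F a b c d = \sum_c \sum_d \sum_a \sum_b F a b c d.
Proof.
under eq_bigr => a _ do rewrite exchange_big.
rewrite exchange_big; apply: eq_bigr => c _ /=.
under eq_bigr => a _ do rewrite exchange_big.
by rewrite exchange_big.
Qed.

Lemma conj_coassoc (A : pzAlg K) (f : A -> tensor A FG) (X : 'M[A]_n) :
  alg_morphism f -> (forall i j, f (X i j) = conj_mx X i j) ->
  forall i j, tassoc (tmap f id (f (X i j))) = tmap id Delta (f (X i j)).
Proof.
move=> hf fX i j; rewrite fX conj_mxE.
have h3 := tmap_morphism hf (sam_id FG).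
have h4 := tassoc_morphism A FG FG; have h5 := id_tens_Delta_morphism A.
rewrite (sam_sum h3) (sam_sum h4) (sam_sum h5).
under eq_bigr => a _ do rewrite (sam_sum h3) (sam_sum h4).
under [RHS]eq_bigr => c _ do rewrite (sam_sum h5).
have R c d : tmap id Delta (X c d \ox (S (T i c) * T d j)) =
    \sum_a \sum_b X c d \ox ((S (T a c) * T d b) \ox (S (T i a) * T b j)).
  rewrite (tmap_tens (sam_id A) hD) (samM hD) Dt Delta_antipode mulr_suml tens_sumr.
  apply: eq_bigr => a _; rewrite mulr_sumr tens_sumr; apply: eq_bigr => b _.
  by rewrite tens_mul.
under [RHS]eq_bigr => c _ do under eq_bigr => d _ do rewrite R.
have Lh a b : tassoc (tmap f id (X a b \ox (S (T i a) * T b j))) =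
    \sum_c \sum_d X c d \ox ((S (T a c) * T d b) \ox (S (T i a) * T b j)).
  rewrite (tmap_tens hf (sam_id FG)) fX conj_mxE tens_suml (sam_sum h4).
  apply: eq_bigr => c _; rewrite tens_suml (sam_sum h4); apply: eq_bigr => d _.
  by rewrite tassoc_tens.
under eq_bigr => a _ do under eq_bigr => b _ do rewrite Lh.
exact: (sum4_exchange (fun a b c d => X c d \ox (S (T a c) * T d b \ox (S (T i a) * T b j)))).
Qed.

Lemma conj_counit (A : pzAlg K) (f : A -> tensor A FG) (X : 'M[A]_n) :
  (forall i j, f (X i j) = conj_mx X i j) ->
  forall i j, tlift (fun b h => eps h *: b) (f (X i j)) = X i j.
Proof.
move=> fX i j; rewrite fX conj_mxE.
have h := counit_map_morphism A.
have E a b : tlift (fun (b : A) (h : FG) => eps h *: b) (X a b \ox (S (T i a) * T b j)) =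
    X a b *+ (b == j) *+ (i == a).
  rewrite (tlift_tens _ _ (counit_balanced A)) epsM eps_antipode et.
  by case: (i == a); case: (b == j); rewrite ?mulr1 ?mulr0 ?mul0r ?scale1r ?scale0r ?mul0rn.
rewrite (sam_sum h) -[RHS](big_delta (fun a => X a j)); apply: eq_bigr => a _.
rewrite (sam_sum h) -(big_delta' (X a)) -sumrMnl; apply: eq_bigr => b _.
exact: E.
Qed.

End Coaction.

Section CoactionExists.
Variables (C : fieldType) (n : nat).
Local Notation K := (Kq C).
Local Notation FG := (FqG C n).
Local Notation LM := (LqM C n).
Local Notation FN := (FqN C n).
Local Notation T := (tq_mx n C).
Local Notation piN := (quot_pi (@FqN_rels C n)).
Variables (Delta : FG -> tensor FG FG) (eps : FG -> K) (S : FG -> FG).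
Hypothesis hopfG : FqG_hopf Delta eps S.

Lemma tq_antipodel : antipode_mx T S *m T = 1%:M.
Proof.
case: hopfG => hH Dt et; apply: (antipode_mxl hH) => i j; rewrite mxE.
  by rewrite Dt; apply: eq_bigr => s _; rewrite !mxE.
by rewrite et.
Qed.

(** The coaction exists by the defining relations and descends to the quotient
    because the quantum traces are coinvariant; both sides of each comodule axiom
    are algebra morphisms, so they are compared on the generators. *)
Lemma coaction_exists :
  exists (beta : LM -> tensor LM FG) (phi : FN -> tensor FN FG),
    [/\ comodule_algebra Delta eps beta, adjoint_coaction S beta,
        forall x : LM, phi (piN x) = tmap piN id (beta x)
      & comodule_algebra Delta eps phi].
Proof.
have hH : hopf_algebra Delta eps S by case: hopfG.
have Dt i j : Delta (T i j) = \sum_(s < n) T i s \ox T s j.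
  by case: hopfG => _ Dt _; rewrite mxE Dt; apply: eq_bigr => s _; rewrite !mxE.
have et i j : eps (T i j) = (i == j)%:R by case: hopfG => _ _ et; rewrite mxE et.
have hT := tq_RTT n C.
have [beta [hb bE]] := LqM_lift (conj_mx_RE hH hT Dt et (lq_RE n C)).
have hp := quot_pi_morphism (@FqN_rels C n).
have hpi := tmap_morphism hp (sam_id FG).
have hpb := sam_comp hb hpi.
have kill x : FqN_rels x -> (tmap piN id \o beta) x = 0.
  move=> hx; have [d [_ ex]] := hx.
  rewrite ex /= (qtrace_morph _ hb) (morph_mxX hb).
  have -> : map_mx beta (lq C n) = conj_mx T S (lq C n).
    by apply/matrixP => i j; rewrite mxE bE.
  rewrite (qtrace_conj_mxX hH hT Dt et) (tmap_tens hp (sam_id FG)).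
  rewrite -ex.
  have e0 := quot_pi_eq0 hx.
  have e1 := congr1 (fun z : FN => z \ox (1 : FG)) e0.
  have e2 := tens0l FN (1 : FG).
  apply: etrans e1 _.
  exact: e2.
have hphi := qlift_morphism hpb kill.
have pE x : qlift (tmap piN id \o beta) (piN x) = tmap piN id (beta x).
  exact: (qlift_pi hpb kill).
have fX i j : qlift (tmap piN id \o beta) ((map_mx piN (lq C n)) i j) = conj_mx T S (map_mx piN (lq C n)) i j.
  rewrite mxE pE bE !conj_mxE (sam_sum hpi); apply: eq_bigr => a _.
  rewrite (sam_sum hpi); apply: eq_bigr => b _.
  rewrite [X in _ = X \ox _]mxE; exact: (tmap_tens hp (sam_id FG)).
exists beta, (qlift (tmap piN id \o beta)); split; [split| |exact: pE|split].
- exact: hb.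
- apply: (LqM_morph_eq (f := fun x => tassoc (tmap beta id (beta x)))).
  + apply: (sam_comp hb (sam_comp (tmap_morphism hb (sam_id FG)) (tassoc_morphism _ _ _))).
  + exact: (sam_comp hb (id_tens_Delta_morphism hH _)).
  + exact: (conj_coassoc hH Dt et hb bE).
- apply: (LqM_morph_eq (f := fun x => tlift (fun b h => eps h *: b) (beta x)) (g := id)).
  + exact: (sam_comp hb (counit_map_morphism hH _)).
  + exact: sam_id.
  + exact: (conj_counit hH Dt et bE).
- split; first exact: hb.
  move=> i j; rewrite bE conj_mxE; apply: eq_bigr => a _; apply: eq_bigr => b _.
  by rewrite ![T _ _]mxE.
- exact: hphi.
- apply: (FqN_morph_eq (f := fun x => tassoc (tmap (qlift (tmap piN id \o beta)) id (qlift (tmap piN id \o beta) x)))).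
  + apply: (sam_comp hphi (sam_comp (tmap_morphism hphi (sam_id FG)) (tassoc_morphism _ _ _))).
  + exact: (sam_comp hphi (id_tens_Delta_morphism hH _)).
  + by move=> i j; have := conj_coassoc hH Dt et hphi fX i j; rewrite mxE.
- apply: (FqN_morph_eq (f := fun x => tlift (fun b h => eps h *: b) (qlift (tmap piN id \o beta) x)) (g := id)).
  + exact: (sam_comp hphi (counit_map_morphism hH _)).
  + exact: sam_id.
  + by move=> i j; have := conj_counit hH Dt et fX i j; rewrite mxE.
Qed.

End CoactionExists.

(** * Representations of the reflection equation algebra near the identity *)

Section Algebras.
Variable K : comNzRingType.

Section MatAlg.
Variables (A : pzAlg K) (m : nat).
Local Notation sc := (fun (k : K) (M : 'M[A]_m) => map_mx ( *:%R k) M).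
Fact mat_scaleA a b (v : 'M[A]_m) : sc a (sc b v) = sc (a * b) v.
Proof. by apply/matrixP => i j; rewrite !mxE scalerA. Qed.
Fact mat_scale1 : left_id 1 sc.
Proof. by move=> v; apply/matrixP => i j; rewrite !mxE scale1r. Qed.
Fact mat_scaleDr : right_distributive sc +%R.
Proof. by move=> k u v; apply/matrixP => i j; rewrite !mxE scalerDr. Qed.
Fact mat_scaleDl v : {morph sc^~ v : a b / a + b}.
Proof. by move=> a b; apply/matrixP => i j; rewrite !mxE scalerDl. Qed.
Fact mat_scaleMl k (x y : 'M[A]_m) : sc k (x * y) = sc k x * y.
Proof.
apply/matrixP => i j; rewrite !mxE scaler_sumr; apply: eq_bigr => l _.
by rewrite mxE pz_scalerAl.
Qed.
Fact mat_scaleMr k (x y : 'M[A]_m) : sc k (x * y) = x * sc k y.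
Proof.
apply/matrixP => i j; rewrite !mxE scaler_sumr; apply: eq_bigr => l _.
by rewrite mxE pz_scalerAr.
Qed.
Definition mat_pzAlg : pzAlg K :=
  @PzAlg K 'M[A]_m sc mat_scaleA mat_scale1 mat_scaleDr mat_scaleDl mat_scaleMl mat_scaleMr.
Lemma mat_scaleE k (M : mat_pzAlg) i j : (k *: M : 'M[A]_m) i j = k *: (M : 'M[A]_m) i j.
Proof. by rewrite [LHS]mxE. Qed.
End MatAlg.

Section ProdAlg.
Variables (A B : pzAlg K).
Definition prod_pzAlg : pzAlg K :=
  @PzAlg K (A * B)%type (fun k x => (k *: x.1, k *: x.2))
    (fun a b v => congr2 pair (scalerA a b v.1) (scalerA a b v.2))
    (fun v => etrans (congr2 pair (scale1r v.1) (scale1r v.2)) (esym (surjective_pairing v)))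
    (fun k u v => congr2 pair (scalerDr k u.1 v.1) (scalerDr k u.2 v.2))
    (fun v a b => congr2 pair (scalerDl v.1 a b) (scalerDl v.2 a b))
    (fun k x y => congr2 pair (pz_scalerAl k x.1 y.1) (pz_scalerAl k x.2 y.2))
    (fun k x y => congr2 pair (pz_scalerAr k x.1 y.1) (pz_scalerAr k x.2 y.2)).
Lemma prod_fst_morphism : alg_morphism (fun x : prod_pzAlg => (x : A * B).1).
Proof. by split. Qed.
Lemma prod_snd_morphism : alg_morphism (fun x : prod_pzAlg => (x : A * B).2).
Proof. by split. Qed.
End ProdAlg.
End Algebras.

(** The recursion for the commuting generators of the affine Hecke algebra. *)
Lemma affine_hecke (R : pzRingType) (r p x : R) :
  r * p * r = p * r * p -> r * x = x * r -> p * x * p * x = x * p * x * p ->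
  r * (p * x * p) * r * (p * x * p) = (p * x * p) * r * (p * x * p) * r.
Proof.
move=> br rx re.
have t1 : x * (p * r * p) * x = r * x * p * x * r.
  by rewrite -br !mulrA -rx -!mulrA rx.
transitivity (p * (r * x) * p * x * p * r * p).
  transitivity (r * p * (x * (p * r * p) * x) * p); first by rewrite !mulrA.
  transitivity ((r * p * r) * (x * p * x) * (r * p)); first by rewrite t1 !mulrA.
  transitivity (p * r * (p * x * p * x) * (r * p)); first by rewrite br !mulrA.
  by rewrite re !mulrA.
transitivity (p * (x * (p * r * p) * x) * p * r); last by rewrite !mulrA.
transitivity (p * r * x * p * x * (r * p * r)); last by rewrite t1 !mulrA.
by rewrite br !mulrA.
Qed.

Section Braid.
Variables (C : fieldType) (n : nat).
Local Notation K := (Kq C).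
Local Notation q := (kq_q C).
Local Notation lam := (kq_lam C).
Local Notation qd := (@qdel n C).

Definition act12 (F : 'I_n -> 'I_n -> 'I_n -> K) s u a : K :=
  qd s u * F u s a + lam * F s u a *+ (s < u)%N.
Definition act23 (F : 'I_n -> 'I_n -> 'I_n -> K) s u a : K :=
  qd u a * F s a u + lam * F s u a *+ (u < a)%N.

Lemma qdel_lt (i j : 'I_n) : (i < j)%N -> qd i j = 1.
Proof. by move=> ij; rewrite /qdel -val_eqE /= ltn_eqF. Qed.
Lemma qdel_gt (i j : 'I_n) : (j < i)%N -> qd i j = 1.
Proof. by move=> ij; rewrite qdelC qdel_lt. Qed.
Lemma qdel_eq (i : 'I_n) : qd i i = q.
Proof. by rewrite /qdel eqxx. Qed.

(** The Yang-Baxter equation for Rhat, written on functions of three indices. *)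
Lemma braid_fun F s u a :
  act12 (act23 (act12 F)) s u a = act23 (act12 (act23 F)) s u a.
Proof.
rewrite /act12 /act23.
case: (ltngtP s u) => [su|us|/val_inj su].
- rewrite ?(qdel_lt su) ?(qdel_gt su); case: (ltngtP u a) => [ua|au|/val_inj ua].
  + have sa := ltn_trans su ua; rewrite ?(qdel_lt ua) ?(qdel_gt ua) ?(qdel_lt sa) ?(qdel_gt sa) sa /=.
    by ring.
  + rewrite ?(qdel_lt au) ?(qdel_gt au); case: (ltngtP s a) => [sa|sa|/val_inj sa].
    * by rewrite ?(qdel_lt sa) ?(qdel_gt sa) /=; ring.
    * by rewrite ?(qdel_lt sa) ?(qdel_gt sa) /=; ring.
    * by rewrite -sa ?qdel_eq ?(qdel_lt su) ?(qdel_gt su) ?ltnn /=; ring.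
  + rewrite -ua ?qdel_eq ?(qdel_lt su) ?(qdel_gt su) ?ltnn su /=.
    apply/eqP; rewrite -subr_eq0; apply/eqP.
    transitivity ((q * q - lam * q - 1) * (- (lam * F s u u))); first by ring.
    by rewrite q2lam subrr mul0r.
- rewrite ?(qdel_lt us) ?(qdel_gt us); case: (ltngtP u a) => [ua|au|/val_inj ua].
  + rewrite ?(qdel_lt ua) ?(qdel_gt ua); case: (ltngtP s a) => [sa|sa|/val_inj sa].
    * by rewrite ?(qdel_lt sa) ?(qdel_gt sa) /=; ring.
    * by rewrite ?(qdel_lt sa) ?(qdel_gt sa) /=; ring.
    * by rewrite -sa ?qdel_eq ?(qdel_lt us) ?(qdel_gt us) ?ltnn /=; ring.
  + have sa := ltn_trans au us.
    have sa' : (s < a)%N = false by rewrite ltnNge ltnW.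
    by rewrite ?(qdel_lt au) ?(qdel_gt au) ?(qdel_lt sa) ?(qdel_gt sa) ?sa ?sa' /=; ring.
  + have us' : (s < u)%N = false by rewrite ltnNge ltnW.
    by rewrite -ua ?qdel_eq ?(qdel_lt us) ?(qdel_gt us) ?ltnn ?us' /=; ring.
- rewrite -su ?qdel_eq; case: (ltngtP s a) => [sa|sa|/val_inj sa].
  + rewrite ?(qdel_lt sa) ?(qdel_gt sa) ?ltnn /=.
    apply/eqP; rewrite -subr_eq0; apply/eqP.
    transitivity ((q * q - lam * q - 1) * (lam * F s s a)); first by ring.
    by rewrite q2lam subrr mul0r.
  + by rewrite ?(qdel_lt sa) ?(qdel_gt sa) ?ltnn /=; ring.
  + by rewrite -sa ?qdel_eq ?ltnn.
Qed.
End Braid.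

Section ReflectionStep.
Variables (C : fieldType) (n : nat) (A : pzAlg (Kq C)).
Local Notation K := (Kq C).
Local Notation q := (kq_q C).
Local Notation h := (kq_h C).
Local Notation lam := (kq_lam C).
Local Notation idK := [the {rmorphism K -> K} of idfun].
Local Notation B := (mat_pzAlg A n).
Local Notation leg2 X := (1%:M *t X).
Local Notation RhA := (Rhat_along n idK A).

(** A matrix over M_n(A) is an operator on the tensor square with entries in A;
    this is how a further tensor factor is added. *)
Definition flat (M : 'M[B]_n) : 'M[A]_(n * n) :=
  \matrix_(i, j) (M (mxtens_unindex i).1 (mxtens_unindex j).1 : 'M[A]_n)
                 (mxtens_unindex i).2 (mxtens_unindex j).2.
Definition unflat (M : 'M[A]_(n * n)) : 'M[B]_n :=
  \matrix_(u, t) ((\matrix_(a, c) ent M u a t c) : 'M[A]_n).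

Lemma flatE M u a t c : ent (flat M) u a t c = (M u t : 'M[A]_n) a c.
Proof. by rewrite mxE !mxtens_indexK. Qed.
Lemma unflatE M u t a c : (unflat M u t : 'M[A]_n) a c = ent M u a t c.
Proof. by rewrite mxE mxE. Qed.
Lemma flatK : cancel flat unflat.
Proof. by move=> M; apply/matrixP => u t; apply/matrixP => a c; rewrite unflatE flatE. Qed.
Lemma unflatK : cancel unflat flat.
Proof. by move=> M; apply: mxtens_eqP => s u b t; rewrite flatE unflatE. Qed.

Lemma mat_sumE (I : Type) (r : seq I) (P : pred I) (F : I -> B) a c :
  ((\sum_(i <- r | P i) F i : B) : 'M[A]_n) a c = \sum_(i <- r | P i) (F i : 'M[A]_n) a c.
Proof. exact: (@summxE A n n I r P F a c). Qed.
Lemma mat_mulE (x y : B) a c :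
  ((x * y : B) : 'M[A]_n) a c = \sum_b (x : 'M[A]_n) a b * (y : 'M[A]_n) b c.
Proof. by rewrite [LHS]mxE. Qed.

Lemma flatM (M N : 'M[B]_n) : flat (M *m N) = flat M *m flat N.
Proof.
apply: mxtens_eqP => u a t c; rewrite mxtens_mulE flatE mxE mat_sumE.
apply: eq_bigr => r _; rewrite mat_mulE; apply: eq_bigr => b _.
by rewrite !flatE.
Qed.

Variable X : 'M[A]_n.
Hypothesis hX : RE idK X.

(** The inner matrix acts on the added factor, which makes the result a solution
    for the two factors that remain visible. *)
Definition RE_next : 'M[B]_n := unflat (RhA *m leg2 X *m RhA).
Let rho : 'M[B]_n := unflat RhA.
Let xB : 'M[B]_n := (X : B)%:M.

Let flat_xB : flat xB = leg2 X.
Proof.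
apply: mxtens_eqP => u a t c; rewrite flatE leg2E mxE.
by case: (u == t); rewrite ?mulr1n ?mulr0n // mxE.
Qed.
Let RE_nextE : RE_next = rho *m xB *m rho.
Proof. by apply: (can_inj flatK); rewrite !flatM unflatK flat_xB unflatK. Qed.

Let RhB := Rhat_along n idK B.

Let RhB_act (M : 'M[B]_(n * n)) s u a b t c :
  (ent (RhB *m M) s u b t : 'M[A]_n) a c =
  qdel C s u *: (ent M u s b t : 'M[A]_n) a c + lam *: (ent M s u b t : 'M[A]_n) a c *+ (s < u)%N.
Proof.
rewrite /RhB (@mulRl n C K idK B) [LHS]mxE; congr (_ + _); first by rewrite [LHS]mxE.
by case: (s < u)%N; rewrite ?mulr1n ?mulr0n; [rewrite [LHS]mxE|rewrite mxE].
Qed.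
Let rho_act (M : 'M[B]_(n * n)) s u a b t c :
  (ent (leg2 rho *m M) s u b t : 'M[A]_n) a c =
  qdel C u a *: (ent M s a b t : 'M[A]_n) u c + lam *: (ent M s u b t : 'M[A]_n) a c *+ (u < a)%N.
Proof.
rewrite mul_leg2l mat_sumE.
pose N : 'M[A]_(n * n) := \matrix_(i, j) (ent M s (mxtens_unindex i).1 b t : 'M[A]_n) (mxtens_unindex i).2 c.
have NE r d b' t' : ent N r d b' t' = (ent M s r b t : 'M[A]_n) d c by rewrite mxE !mxtens_indexK.
have := @mulRl n C K idK A N u a u a; rewrite !NE => <-.
rewrite mxtens_mulE; apply: eq_bigr => r _; rewrite mat_mulE; apply: eq_bigr => d _.
by rewrite NE unflatE.
Qed.

(** Both operators act on the row indices through scalars only, so that the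
    braid relation reduces to functions with values in the ground ring. *)
Let scal3 (G : 'I_n -> 'I_n -> 'I_n -> 'I_n -> 'I_n -> 'I_n -> K) : 'M[B]_(n * n) :=
  \matrix_(i, j) ((\matrix_(a, c) (G (mxtens_unindex i).1 (mxtens_unindex i).2 a
     (mxtens_unindex j).1 (mxtens_unindex j).2 c *: (1 : A))) : 'M[A]_n).
Let scal3E G s u a b t c : (ent (scal3 G) s u b t : 'M[A]_n) a c = G s u a b t c *: (1 : A).
Proof. by rewrite mxE mxE !mxtens_indexK. Qed.
Let scal3_eqP (M N : 'M[B]_(n * n)) : (forall s u a b t c,
  (ent M s u b t : 'M[A]_n) a c = (ent N s u b t : 'M[A]_n) a c) -> M = N.
Proof. by move=> e; apply: mxtens_eqP => s u b t; apply/matrixP => a c; apply: e. Qed.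
Let scal3_r G : RhB *m scal3 G = scal3 (fun s u a b t c => act12 (fun s u a => G s u a b t c) s u a).
Proof.
apply: scal3_eqP => s u a b t c; rewrite RhB_act !scal3E /act12 scalerDl !scalerA.
by case: (s < u)%N; rewrite ?mulr1n ?mulr0n ?scale0r.
Qed.
Let scal3_p G : leg2 rho *m scal3 G = scal3 (fun s u a b t c => act23 (fun s u a => G s u a b t c) s u a).
Proof.
apply: scal3_eqP => s u a b t c; rewrite rho_act !scal3E /act23 scalerDl !scalerA.
by case: (u < a)%N; rewrite ?mulr1n ?mulr0n ?scale0r.
Qed.
Let scal3_1 : scal3 (fun s u a b t c => ((s == b) && (u == t) && (a == c))%:R) = 1%:M.
Proof.
apply: scal3_eqP => s u a b t c; rewrite scal3E mxE (can_eq (@mxtens_indexK n n)) xpair_eqE.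
case: ((s == b) && (u == t)) => /=; last by rewrite mulr0n [RHS]mxE scale0r.
by rewrite mulr1n [RHS]mxE; case: (a == c); rewrite ?scale1r ?scale0r.
Qed.

Let braid_mx : RhB *m leg2 rho *m RhB = leg2 rho *m RhB *m leg2 rho.
Proof.
rewrite -[LHS]mulmx1 -[RHS]mulmx1 -scal3_1 -!mulmxA !(scal3_r, scal3_p).
by congr scal3; do 6! apply/funext => ?; rewrite braid_fun.
Qed.

Lemma RE_next_RE : RE idK RE_next.
Proof.
rewrite /RE RE_nextE -!leg2_mul.
apply: (@affine_hecke _ RhB (leg2 rho) (leg2 xB)).
- exact: braid_mx.
- apply: scal3_eqP => s u a b t c.
  rewrite [in LHS]RhB_act !leg2E [in RHS](@mulRr n C K idK B) !leg2E.
  have xE i j a' c' : (xB i j : 'M[A]_n) a' c' = X a' c' *+ (i == j).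
    by rewrite mxE; case: (i == j); rewrite ?mulr1n ?mulr0n // mxE.
  rewrite [RHS]mxE.
  have mnE (y : B) (k : bool) : ((y *+ k : B) : 'M[A]_n) a c = (y : 'M[A]_n) a c *+ k.
    by case: k; rewrite ?mulr1n ?mulr0n // mxE.
  rewrite !mnE !mat_scaleE !mnE !xE.
  congr (_ + _).
    have [st|st] := eqVneq s t; have [ub|ub] := eqVneq u b; rewrite /= ?mulr0n ?mul0rn ?scaler0 //.
    by rewrite st ub qdelC.
  have [ut|ut] := eqVneq u t; have [sb|sb] := eqVneq s b; rewrite /= ?mulr0n ?mul0rn ?scaler0 ?mul0rn //.
  by rewrite ut sb.
- transitivity (leg2 (rho *m xB *m rho *m xB) : 'M[B]_(n * n)); first by rewrite -!leg2_mul.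
  transitivity (leg2 (xB *m rho *m xB *m rho) : 'M[B]_(n * n)); last by rewrite -!leg2_mul.
  congr (leg2 _); apply: (can_inj flatK); rewrite !flatM flat_xB unflatK.
  exact: hX.
Qed.
End ReflectionStep.

Section RepresentationStep.
Variables (C : fieldType) (n : nat).
Local Notation K := (Kq C).
Local Notation ev := (@kq_ev1 C).
Local Notation q := (kq_q C).
Local Notation h := (kq_h C).
Local Notation lam := (kq_lam C).
Local Notation idK := [the {rmorphism K -> K} of idfun].
Local Notation letter := ('I_n * 'I_n)%type.

Lemma lam_h : exists mu : K, lam = h * mu /\ ev mu = 2%:R.
Proof.
exists ((q + 1) * q^-1); split.
  rewrite /kq_lam /kq_h mulrA -subr_sqr expr1n mulrBl mul1r expr2 -mulrA kq_qV mulr1 //.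
have eV : ev q^-1 = 1.
  by have := congr1 ev (kq_qV C); rewrite evM ev_q mul1r ev1.
by rewrite evM evD eV ev_q ev1 mulr1 -[1 + 1]/(1 *+ 2).
Qed.

Lemma qdel_h (i j : 'I_n) : qdel C i j = 1 + h * (i == j)%:R.
Proof.
by rewrite /qdel; case: (i == j); rewrite ?mulr1 ?mulr0 ?addr0 // /kq_h addrC subrK.
Qed.

Fixpoint deletions (x : letter) (y : seq letter) : seq (seq letter) :=
  if y is k :: y' then
    (if k == x then [:: y'] else [::]) ++ [seq k :: z | z <- deletions x y']
  else [::].
Lemma deletions_perm x y z : z \in deletions x y -> perm_eq (x :: z) y.
Proof.
elim: y z => //= k y ih z; rewrite mem_cat => /orP[|/mapP[w /ih pw ->]].
  by case: eqP => // ->; rewrite inE => /eqP->.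
by rewrite -(perm_cons k) in pw; rewrite -cat1s -(cat1s k w) perm_catCA.
Qed.
Lemma size_deletions x y : size (deletions x y) = count_mem x y.
Proof. by elim: y => //= k y ih; rewrite size_cat size_map ih; case: (k == x). Qed.

Section Expansion.
Variables (A : pzAlg K) (Y : letter -> A).
Local Notation wv := (word_val Y).
Local Notation B := (mat_pzAlg A n).

Definition short_words (k : nat) : A -> Prop :=
  Span (fun z => exists s : seq letter, (size s + 2 <= k)%N /\ z = wv s).

(** If X = 1 + h Y with h = q - 1, the next solution is 1 + h Y' with Y' equal to
    this matrix modulo h: the term 2 E_ji comes from squaring Rhat. *)
Definition YB0 (k : letter) : B :=
  (\matrix_(a, c) ((2%:R *: (1 : A)) *+ ((a == k.2) && (c == k.1)) + Y k *+ (a == c))) : 'M[A]_n.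

Lemma YB0E k a c : (YB0 k : 'M[A]_n) a c =
  (2%:R *: (1 : A)) *+ ((a == k.2) && (c == k.1)) + Y k *+ (a == c).
Proof. by rewrite mxE. Qed.

Lemma wvcons k y : wv (k :: y) = Y k * wv y.
Proof. by rewrite /word_val big_cons. Qed.

Lemma short_wordsM k d x : short_words d x -> short_words d.+1 (Y k * x).
Proof.
elim=> [|u v _ hu _ hv|l u [s [hs ->]]].
- by rewrite mulr0; apply: Span0.
- by rewrite mulrDr; apply: SpanD.
rewrite -pz_scalerAr; apply: SpanZs; apply: SpanG; exists (k :: s).
by rewrite wvcons /= ltnS.
Qed.
Lemma short_words_mono d e x : (d <= e)%N -> short_words d x -> short_words e x.
Proof.
move=> de; apply: Span_sub => z [s [hs ->]]; apply: SpanG; exists s; split=> //.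
exact: leq_trans de.
Qed.

(** Words in Y' are, up to shorter words in Y, the word itself on the diagonal and
    twice the words with one letter deleted at the position of that letter. *)
Lemma YB0_expansion y a c : exists r,
  ((word_val YB0 y : B) : 'M[A]_n) a c =
    wv y *+ (a == c) + 2%:R *: (\sum_(z <- deletions (c, a) y) wv z) + r
  /\ short_words (size y) r.
Proof.
elim: y a c => [|[i j] y ih] a c.
  exists 0; split; last exact: Span0.
  by rewrite /word_val !big_nil mxE scaler0 !addr0.
have [r [er hr]] := ih a c; have [r' [er' hr']] := ih i c.
pose d := 2%:R *: (\sum_(z <- deletions (c, i) y) wv z) + r'.
exists (Y (i, j) * r + (2%:R *: d) *+ (a == j)); split.
  have -> : (word_val YB0 ((i, j) :: y) : 'M[A]_n) a c =
      Y (i, j) * (word_val YB0 y : 'M[A]_n) a c +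
      (2%:R *: (word_val YB0 y : 'M[A]_n) i c) *+ (a == j).
    have -> : word_val YB0 ((i, j) :: y) = YB0 (i, j) * word_val YB0 y by rewrite /word_val big_cons.
    rewrite mat_mulE.
    under eq_bigr => b _ do rewrite YB0E mulrDl !mulrnAl /= -pz_scalerAl mul1r.
    rewrite big_split /= addrC big_delta; congr (_ + _).
    under eq_bigr => b _ do rewrite -mulnb mulrnA mulrnAC.
    by rewrite sumrMnl big_delta'.
  rewrite er er' wvcons /= big_cat big_map /=.
  have -> : \sum_(z <- deletions (c, a) y) wv ((i, j) :: z) =
      Y (i, j) * \sum_(z <- deletions (c, a) y) wv z.
    by rewrite mulr_sumr; apply: eq_bigr => z _; rewrite wvcons.
  rewrite !mulrDr mulrnAr -!addrA; congr (_ + _).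
  rewrite -pz_scalerAr scalerDr.
  have -> : \sum_(z <- (if (i, j) == (c, a) then [:: y] else [::])) wv z = wv y *+ ((i == c) && (a == j)).
    by rewrite xpair_eqE [j == a]eq_sym; case: (_ && _); rewrite ?big_seq1 ?big_nil.
  rewrite -/d [2%:R *: (_ + Y (i, j) * _)]scalerDr -mulnb mulrnA -!scalerMnr mulrnDl.
  rewrite -!addrA [RHS]addrCA; congr (_ + _).
  by rewrite addrCA.
apply: SpanD; first exact: short_wordsM.
case: (a == j); rewrite ?mulr0n; last exact: Span0.
rewrite mulr1n /d; apply/SpanZs/SpanD; last exact: short_words_mono hr'.
apply: SpanZs; rewrite big_seq; apply: Span_sum => z /deletions_perm /perm_size /= sz.
apply: SpanG; exists z; split=> //; by rewrite -sz /= addn2.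
Qed.
End Expansion.

(** A representation of the reflection equation algebra near the identity, with
    functionals that detect, modulo q - 1, the words of length N up to
    permutation. *)
Definition detects (N : nat) (A : pzAlg K) (X : 'M[A]_n) : Prop :=
  RE idK X /\ exists Y : letter -> A,
    (forall i j, X i j = (i == j)%:R + h *: Y (i, j)) /\
    forall b, size b = N -> exists (F : A -> K) (kap : C),
      [/\ linear_for *%R F, kap != 0
        & forall y, (size y <= N)%N -> ev (F (word_val Y y)) = kap *+ perm_eq b y].

Lemma lin_forD (A : pzAlg K) (F : A -> K) : linear_for *%R F ->
  [/\ forall x y, F (x + y) = F x + F y, F 0 = 0 & forall k x, F (k *: x) = k * F x].
Proof.
move=> hF; have FD x y : F (x + y) = F x + F y by rewrite -{1}[x]scale1r hF mul1r.
have F0 : F 0 = 0 by apply: (addrI (F 0)); rewrite -FD !addr0.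
by split=> // k x; rewrite -[k *: x]addr0 hF F0 addr0.
Qed.

Hypothesis C0 : [pchar C] =i pred0.

Lemma RE_1 (A : pzAlg K) : RE idK (1%:M : 'M[A]_n).
Proof. by rewrite /RE leg2_1 !mulmx1 !mul1mx. Qed.

Lemma detects0 : exists (A : pzAlg K) (X : 'M[A]_n), detects 0 X.
Proof.
exists (alg_pzAlg K^o), 1%:M; split; first exact: RE_1.
exists (fun=> 0); split=> [i j|b /size0nil ->]; first by rewrite mxE scaler0 addr0.
exists id, 1; split=> [k x y //||y]; first exact: oner_neq0.
by rewrite leqn0 => /nilP ->; rewrite /word_val big_nil [ev 1]ev1.
Qed.

Lemma word_val_mod (A : pzAlg K) (Y Y0 Z : letter -> A) :
  (forall k, Y k = Y0 k + h *: Z k) ->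
  forall y, exists r, word_val Y y = word_val Y0 y + h *: r.
Proof.
move=> e; elim=> [|k y [r er]].
  by exists 0; rewrite /word_val !big_nil scaler0 addr0.
exists (Y0 k * r + Z k * word_val Y y).
rewrite !wvcons e er mulrDl mulrDr scalerDr -!addrA; congr (_ + _).
by rewrite pz_scalerAr -pz_scalerAl.
Qed.

(** The next representation is the sum of the given one and of the one with a
    further tensor factor. A functional for a word with first letter (i, j) reads
    off the entry (j, i), where the deletions of (i, j) are, and subtracts the
    undeleted word by means of the first summand. *)
Lemma detectsS N (A : pzAlg K) (X : 'M[A]_n) : detects N X ->
  exists (A' : pzAlg K) (X' : 'M[A']_n), detects N.+1 X'.
Proof.
case=> hX [Y [eX hF]].
pose B := mat_pzAlg A n; pose XB : 'M[B]_n := RE_next X.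
pose A' := prod_pzAlg A B; pose X' : 'M[A']_n := \matrix_(i, j) (X i j, XB i j).
have hXB : RE idK XB := RE_next_RE hX.
have m1 := prod_fst_morphism A B; have m2 := prod_snd_morphism A B.
exists A', X'; split.
  have e1 := @RE_map n C K idK _ _ _ X' m1; have e2 := @RE_map n C K idK _ _ _ X' m2.
  have x1 : map_mx (fun x : A' => (x : A * B).1) X' = X by apply/matrixP => i j; rewrite !mxE.
  have x2 : map_mx (fun x : A' => (x : A * B).2) X' = XB by apply/matrixP => i j; rewrite !mxE.
  rewrite x1 /= in e1; rewrite x2 /= in e2.
  apply/eqP; rewrite -subr_eq0; apply/eqP/matrixP => i j.
  move/eqP: hX; rewrite -subr_eq0 => /eqP hX0; move/eqP: hXB; rewrite -subr_eq0 => /eqP hXB0.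
  rewrite [RHS]mxE.
  have := congr1 (fun M : 'M[A]_(n * n) => M i j) (etrans e1 hX0); rewrite mxE [RHS]mxE => f1.
  have := congr1 (fun M : 'M[B]_(n * n) => M i j) (etrans e2 hXB0); rewrite mxE [RHS]mxE => f2.
  exact: (etrans (surjective_pairing _) (congr2 pair f1 f2)).
have [mu [elam emu]] := lam_h.
pose Y2 : 'M[A]_(n * n) := 1%:M *t \matrix_(i, j) Y (i, j).
have [YB [Z [eYB eXB]]] : exists YB Z : letter -> B,
    (forall k, YB k = YB0 Y k + h *: Z k) /\
    (forall i j, XB i j = (i == j)%:R + h *: YB (i, j)).
  (* Modulo h the matrix Rhat is the flip. *)
  pose RA := Rhat_along n idK A.
  pose Pf : 'M[A]_(n * n) := \matrix_(i, j) ((((mxtens_unindex i).1 == (mxtens_unindex j).2) && ((mxtens_unindex i).2 == (mxtens_unindex j).1))%:R).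
  have PfE s u b t : ent Pf s u b t = ((s == t) && (u == b))%:R by rewrite mxE !mxtens_indexK.
  have PfL M s u b t : ent (Pf *m M) s u b t = ent M u s b t.
    rewrite [LHS]mxE (bigD1 (mxtens_index (u, s))) //= PfE !eqxx mul1r big1 ?addr0 // => k kne.
    rewrite mxE mxtens_indexK /=; case: andP => [[/eqP e1 /eqP e2]|_]; last by rewrite mul0r.
    by case/eqP: kne; rewrite -[LHS]mxtens_unindexK e1 e2.
  have PfR M s u b t : ent (M *m Pf) s u b t = ent M s u t b.
    rewrite [LHS]mxE (bigD1 (mxtens_index (t, b))) //= PfE !eqxx mulr1 big1 ?addr0 // => k kne.
    rewrite [X in _ * X]mxE mxtens_indexK /=; case: andP => [[/eqP e1 /eqP e2]|_]; last by rewrite mulr0.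
    by case/eqP: kne; rewrite -[LHS]mxtens_unindexK -e1 -e2.
  pose R1 : 'M[A]_(n * n) := \matrix_(i, j)
    (((((mxtens_unindex i).1 == (mxtens_unindex j).2) && ((mxtens_unindex i).2 == (mxtens_unindex j).1) && ((mxtens_unindex i).1 == (mxtens_unindex i).2))%:R)
    + mu *: (1 : A) *+ [&& ((mxtens_unindex j).1 < (mxtens_unindex j).2)%N, (mxtens_unindex i).1 == (mxtens_unindex j).1 & (mxtens_unindex i).2 == (mxtens_unindex j).2]).
  have R1E s u b t : ent R1 s u b t = ((s == t) && (u == b) && (s == u))%:R + mu *: (1 : A) *+ [&& (b < t)%N, s == b & u == t].
    by rewrite mxE !mxtens_indexK.
  have RAE : RA = Pf + map_mx ( *:%R h) R1.
    apply: mxtens_eqP => s u b t; rewrite RhE [RHS]mxE PfE [X in _ = _ + X]mxE R1E /= qdel_h elam.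
    rewrite scalerDl scale1r scalerDr mulrnDl -addrA; congr (_ + _).
    congr (_ + _); last by rewrite -scalerMnr scalerA.
    by case: (s == u); case: ((s == t) && (u == b)); rewrite /= ?mulr1 ?mulr0 ?scale0r ?mulr1n ?mulr0n ?scaler0.
  pose YBm : 'M[A]_(n * n) := map_mx ( *:%R mu) RA + RA *m Y2 *m RA.
  pose Zm : 'M[A]_(n * n) := map_mx ( *:%R mu) R1 + R1 *m Y2 *m RA + Pf *m Y2 *m R1.
  have [c ec] : exists c : K, mu = 2%:R + h * c.
    have [|c ec] := @ev_eq0P C (mu - 2%:R); first by rewrite evB emu rmorph_nat subrr.
    by exists c; rewrite -ec addrC subrK.
  exists (fun k => unflat YBm k.1 k.2), (fun k => unflat (Zm + map_mx ( *:%R c) Pf) k.1 k.2).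
  have kl (k : K) (M N' : 'M[A]_(n * n)) : map_mx ( *:%R k) M *m N' = map_mx ( *:%R k) (M *m N').
    apply/matrixP => i j; rewrite !mxE scaler_sumr; apply: eq_bigr => l _.
    by rewrite mxE pz_scalerAl.
  have kr (k : K) (M N' : 'M[A]_(n * n)) : M *m map_mx ( *:%R k) N' = map_mx ( *:%R k) (M *m N').
    apply/matrixP => i j; rewrite !mxE scaler_sumr; apply: eq_bigr => l _.
    by rewrite mxE pz_scalerAr.
  have kD (k : K) (M N' : 'M[A]_(n * n)) : map_mx ( *:%R k) (M + N') = map_mx ( *:%R k) M + map_mx ( *:%R k) N'.
    by apply/matrixP => i j; rewrite !mxE scalerDr.
  split=> [[i j]|i j].
    have e : YBm = map_mx ( *:%R 2%:R) Pf + Pf *m Y2 *m Pf + map_mx ( *:%R h) (Zm + map_mx ( *:%R c) Pf).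
      have e1 : map_mx ( *:%R mu) RA = map_mx ( *:%R 2%:R) Pf + map_mx ( *:%R h) (map_mx ( *:%R c) Pf) + map_mx ( *:%R h) (map_mx ( *:%R mu) R1).
        apply/matrixP => k l; rewrite RAE !mxE scalerDr {1}ec scalerDl !scalerA; congr (_ + _ + _ *: _).
        by rewrite mulrC.
      have e2 : RA *m Y2 *m RA = Pf *m Y2 *m Pf + map_mx ( *:%R h) (R1 *m Y2 *m RA) + map_mx ( *:%R h) (Pf *m Y2 *m R1).
        by rewrite {1}RAE !mulmxDl !kl {1}RAE mulmxDr kr addrAC.
      by rewrite /YBm e1 e2 /Zm !kD [LHS](AC (3*3) ((1*4)*((3*5*6)*2))).
    apply/matrixP => a d; rewrite unflatE /= e.
    rewrite mxE [X in _ + X]mxE [RHS]mxE [X in _ = _ + X]mxE unflatE; congr (_ + _).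
    rewrite mxE [X in X + _]mxE PfE (YB0E Y (i, j) a d) /=; congr (_ + _).
      by rewrite scalerMnr [i == d]eq_sym andbC.
    by rewrite PfR PfL leg2E mxE.
  have XE : X = 1%:M + map_mx ( *:%R h) (\matrix_(i, j) Y (i, j)).
    by apply/matrixP => k l; rewrite !mxE eX.
  have leg2X : 1%:M *t X = 1%:M + map_mx ( *:%R h) Y2 :> 'M[A]_(n * n).
    apply: mxtens_eqP => s u b t; rewrite leg2E mxE [X in _ + X]mxE leg2E XE mxE [X in _ + X]mxE.
    rewrite mxE mulrnDl -scalerMnr; congr (_ + _).
    rewrite mxE (can_eq (@mxtens_indexK n n)) xpair_eqE.
    by case: (s == b); case: (u == t).
  have e : RA *m (1%:M *t X) *m RA = 1%:M + map_mx ( *:%R h) YBm.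
    rewrite leg2X mulmxDr mulmx1 mulmxDl kr kl hecke /YBm kD addrAC -addrA [RHS]addrC.
    rewrite -[RHS]addrA; congr (_ + _).
    by apply/matrixP => k l; rewrite !mxE scalerA elam.
  apply/matrixP => a d; rewrite unflatE e mxE [RHS]mxE [X in _ + X]mxE; congr (_ + _); last first.
    by rewrite [RHS]mxE unflatE.
  rewrite mxE (can_eq (@mxtens_indexK n n)) xpair_eqE.
  by case: (i == j); rewrite /= ?mulr1n ?mulr0n [RHS]mxE.
pose Y' (k : letter) : A' := (Y k, YB k).
exists Y'; split.
  move=> i j; rewrite mxE /Y' eX eXB.
  by case: (i == j).
case=> // -[i j] b [sb]; have [F [kap [linF kap0 hFy]]] := hF b sb.
have [FD F0 FZ] := lin_forD linF.
pose F' (x : A') := F (((x : A * B).2 : 'M[A]_n) j i - (x : A * B).1 *+ (i == j)).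
exists F', (2%:R * (kap *+ (count_mem (i, j) b).+1)); split.
- move=> k x y; rewrite /F' -linF; congr F.
  transitivity (((k *: (x : A * B).2 : B) + (y : A * B).2 : 'M[A]_n) j i
      - (k *: (x : A * B).1 + (y : A * B).1) *+ (i == j)); first by [].
  rewrite [X in X - _]mxE [X in X + _ - _]mxE mulrnDl opprD addrACA; congr (_ + _).
  by rewrite scalerBr scalerMnr.
- have c0 := iffLR (pcharf0P C) C0.
  by rewrite mulf_neq0 ?c0 // -mulr_natr mulf_neq0 // c0.
move=> y szy.
have wE : word_val Y' y = (word_val Y y, word_val YB y).
  by elim: y {szy} => [|k y ih]; rewrite ?wvcons ?ih // /word_val !big_nil.
have [r er] := word_val_mod eYB y.
have [s [es hs]] := YB0_expansion Y y j i.
have FX : F' (word_val Y' y) = 2%:R * F (\sum_(z <- deletions (i, j) y) word_val Y z) + F s + h * F ((r : 'M[A]_n) j i).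
  rewrite /F' wE /= er [X in F (X - _)]mxE es mat_scaleE [j == i]eq_sym.
  by rewrite -!addrA addrC !addrA addrNK ?subrK !FD !FZ.
have Fs : ev (F s) = 0.
  elim: hs => [|u v _ hu _ hv|k u [t [ht ->]]]; first by rewrite F0 [ev 0]ev0.
    by rewrite FD evD hu hv addr0.
  have szt : (size t < N)%N by rewrite -ltnS -ltnS -addn2; apply: leq_ltn_trans ht _; rewrite ltnS.
  have -> : word_val Y t = word_val Y t by [].
  rewrite FZ evM hFy; last exact: ltnW.
  have -> : perm_eq b t = false.
    by apply/negP => /perm_size e; rewrite -e sb ltnn in szt.
  by rewrite mulr0n mulr0.
have Fsum (u : seq (seq letter)) :
    F (\sum_(z <- u) word_val Y z) = \sum_(z <- u) F (word_val Y z).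
  by elim: u => [|z u ih]; rewrite ?big_nil // !big_cons FD ih.
rewrite FX !evD !evM ev_h mul0r Fs !addr0 Fsum ev_sum.
have ev2 : ev 2%:R = 2%:R :> C by rewrite -[2%:R]/(1 + 1) evD ev1.
rewrite ev2 -mulrnAr; congr (_ * _).
rewrite big_seq (eq_bigr (fun=> kap *+ perm_eq ((i, j) :: b) y)); last first.
  move=> z hz; have pz := deletions_perm hz.
  have sz : (size z <= N)%N by rewrite -ltnS -(perm_size pz) in szy.
  by rewrite -(permPr pz) perm_cons hFy.
rewrite -big_seq big_const_seq iter_addr_0 count_predT size_deletions.
case pe: (perm_eq _ _); last by rewrite !mulr0n mul0rn.
by rewrite !mulr1n -(seq.permP pe) /= eqxx add1n.
Qed.
End RepresentationStep.

(** * Flatness of the reflection equation algebra *)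

Section Letters.
Variable n : nat.
Definition vpair (k : 'I_(n * n)) : 'I_n * 'I_n :=
  enum_val (cast_ord (esym (mxvec_cast n n)) k).
Lemma vpairK k : mxvec_index (vpair k).1 (vpair k).2 = k.
Proof. by rewrite /mxvec_index -surjective_pairing enum_valK cast_ordKV. Qed.
Lemma vpair_mxvec (i j : 'I_n) : vpair (mxvec_index i j) = (i, j).
Proof. by rewrite /vpair /mxvec_index cast_ordK enum_rankK. Qed.
Lemma mxvec_vpair (T : Type) (M : 'M[T]_n) k : mxvec M 0 k = M (vpair k).1 (vpair k).2.
Proof. by rewrite -{1}(vpairK k) mxvecE. Qed.
End Letters.

Section CommutatorIdentities.
Lemma eq_add_diff (U : zmodType) (a1 a2 p1 p2 p3 r1 r2 r3 : U) :
  a1 + p1 + p2 + p3 = a2 + r1 + r2 + r3 ->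
  a2 - a1 = p1 + p2 + p3 - (r1 + r2 + r3).
Proof.
move=> e; apply/eqP; rewrite subr_eq addrAC eq_sym subr_eq addrC.
by rewrite -!addrA in e *; rewrite e.
Qed.
Lemma comm_shiftl (R : pzRingType) (a b x : R) : x * b = b * x ->
  (a - x) * b - b * (a - x) = a * b - b * a.
Proof. by move=> xb; rewrite mulrBl mulrBr xb opprB addrA subrK. Qed.
Lemma comm_shift (R : pzRingType) (a b x y : R) :
  (forall c, x * c = c * x) -> (forall c, y * c = c * y) ->
  (a - x) * (b - y) - (b - y) * (a - x) = a * b - b * a.
Proof.
move=> cx cy; rewrite comm_shiftl // -opprB comm_shiftl ?opprB //.
Qed.
End CommutatorIdentities.

Section ReflectionWords.
Variables (C : fieldType) (n : nat) (A : pzAlg (Kq C)).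
Local Notation K := (Kq C).
Local Notation h := (kq_h C).
Local Notation lam := (kq_lam C).
Local Notation idK := [the {rmorphism K -> K} of idfun].
Local Notation N := (n * n)%N.
Variable L : 'M[A]_n.

Definition letters (k : 'I_N) : A := L (vpair k).1 (vpair k).2.
Local Notation V := (words_le letters).
Local Notation hV := (words_h letters).

Lemma letters_mxvec i j : letters (mxvec_index i j) = L i j.
Proof. by rewrite /letters vpair_mxvec. Qed.
Lemma entry_le1 i j : V 1 (L i j).
Proof.
rewrite -letters_mxvec -[X in V _ X]mulr1 -(wv_nil letters) -wv_cons.
exact: words_le_word.
Qed.
Lemma entry_le2 i j k l : V 2 (L i j * L k l).
Proof. exact: (words_leM (entry_le1 _ _) (entry_le1 _ _)). Qed.
Lemma words_h_scale d x : V d x -> hV d (h *: x).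
Proof. by exists x. Qed.

Hypothesis hL : RE idK L.

(** At q = 1 the matrix Rhat is the flip, and the reflection equation says that the
    entries commute. *)
Lemma entry_swap s u b t : hV 2 (L u t * L s b - L s b * L u t).
Proof.
pose M : 'M_(n * n) := (1%:M *t L) *m (Rhat_along n idK A *m (1%:M *t L)).
have [mu [elam _]] := lam_h C.
have Mx s' u' b' t' : exists2 y, V 2 y & ent M s' u' b' t' = L u' b' * L s' t' + h *: y.
  pose y1 : A := \sum_(r < n) (L u' r * L r t') *+ (s' == b') *+ (s' < r)%N.
  exists ((s' == b')%:R *: (L u' b' * L s' t') + mu *: y1).
    apply: SpanD; first by apply: SpanZs; apply: entry_le2.
    apply: SpanZs; apply: Span_sum => r _.
    by rewrite -mulrnA -scaler_nat; apply: SpanZs; apply: entry_le2.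
  rewrite mul_leg2l.
  transitivity (\sum_(r < n) ((qdel C s' b' *: (L u' r * L s' t')) *+ (r == b') +
      lam *: ((L u' r * L r t') *+ (s' == b') *+ (s' < r)%N))).
    apply: eq_bigr => r _.
    rewrite [X in _ * X](@mulRl n C K idK) !leg2E mulrDr; congr (_ + _).
      rewrite -pz_scalerAr mulrnAr /=.
      by have [->|_] := eqVneq r b'; rewrite ?mulr1n // !mulr0n scaler0.
    by rewrite mulrnAr -pz_scalerAr mulrnAr scalerMnr.
  rewrite big_split /= big_delta' -scaler_sumr -/y1 elam qdel_h.
  by rewrite scalerDl scale1r scalerDr !scalerA -addrA.
have e : ent (Rhat_along n idK A *m M) s u b t = ent (M *m Rhat_along n idK A) s u b t.
  by move: hL; rewrite /RE /M -!mulmxA => ->.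
rewrite (@mulRl n C K idK) (@mulRr n C K idK) in e.
have [y1 h1 e1] := Mx u s b t; have [y2 h2 e2] := Mx s u t b.
have [y3 h3 e3] := Mx s u b t.
have V3 : V 2 (ent M s u b t).
  by rewrite e3; apply: SpanD; [apply: entry_le2|apply: SpanZs].
have qdelZ i0 j0 (y : A) : qdel C i0 j0 *: y = y + (h * (i0 == j0)%:R) *: y.
  by rewrite qdel_h scalerDl scale1r.
move: e; rewrite e1 e2 /= elam !qdelZ => e.
rewrite (eq_add_diff e).
have hz (y : A) : V 2 y -> hV 2 (h *: y) by exact: words_h_scale.
have hz2 (k : K) (y : A) : V 2 y -> hV 2 ((h * k) *: y).
  by move=> hy; rewrite -scalerA; apply/hz/SpanZs.
have hz3 (k : K) (y : A) (b0 : bool) : V 2 y -> hV 2 ((h * k) *: y *+ b0).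
  by case: b0 => hy; [rewrite mulr1n; apply: hz2|rewrite mulr0n; apply: words_h0].
have VD i0 j0 k0 l0 (y : A) : V 2 y -> V 2 (L i0 j0 * L k0 l0 + h *: y).
  by move=> hy; apply: SpanD; [apply: entry_le2|apply: SpanZs].
apply: words_hB; apply: words_hD; try apply: words_hD; try exact: hz; try exact: hz3.
  exact/hz2/VD.
exact/hz2/VD.
Qed.

Lemma letters_swap i j : hV 2 (letters i * letters j - letters j * letters i).
Proof. exact: entry_swap. Qed.
End ReflectionWords.

Section ShiftedWords.
Variables (C : fieldType) (A : pzAlg (Kq C)) (N : nat) (a : 'I_N -> A) (c : 'I_N -> Kq C).
Definition shifted (k : 'I_N) : A := a k - c k *: (1 : A).

Lemma words_le_shifted d x : words_le a d x -> words_le shifted d x.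
Proof.
apply: Span_sub => z [s [hs ->]]; apply: (words_le_mono hs).
elim: s {hs} => [|k s ih]; first by rewrite wv_nil -(wv_nil shifted); apply: words_le_word.
rewrite wv_cons; have -> : a k = shifted k + c k *: (1 : A) by rewrite /shifted subrK.
rewrite mulrDl; apply: SpanD.
  rewrite -[shifted k]mulr1 -(wv_nil shifted) -wv_cons.
  by apply: (@words_leM _ _ _ _ 1 (size s)) ih; apply: words_le_word.
rewrite -pz_scalerAl mul1r; apply: SpanZs.
exact: words_le_mono ih.
Qed.

Lemma shifted_swap : (forall i j, words_h a 2 (a i * a j - a j * a i)) ->
  forall i j, words_h shifted 2 (shifted i * shifted j - shifted j * shifted i).
Proof.
have cen k (z : A) : (k *: (1 : A)) * z = z * (k *: (1 : A)).
  by rewrite -pz_scalerAl -pz_scalerAr mul1r mulr1.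
move=> sw i j; rewrite comm_shift //.
by have [y [hy ->]] := sw i j; exists y; split=> //; exact: words_le_shifted.
Qed.
End ShiftedWords.

Section ReflectionAlgebra.
Variables (C : fieldType) (n : nat).
Local Notation K := (Kq C).
Local Notation ev := (@kq_ev1 C).
Local Notation h := (kq_h C).
Local Notation lam := (kq_lam C).
Local Notation idK := [the {rmorphism K -> K} of idfun].
Local Notation L := (lq C n).
Local Notation N := (n * n)%N.

Definition lq_letter : 'I_N -> LqM C n := letters (lq C n).
(** These generators vanish in the trivial representation L = 1. *)
Definition lq_shift : 'I_N -> LqM C n :=
  shifted lq_letter (fun k => ((vpair k).1 == (vpair k).2)%:R).
Local Notation V := (words_le lq_letter).
Local Notation hV := (words_h lq_letter).

Lemma lq_letter_swap i j :
  hV 2 (lq_letter i * lq_letter j - lq_letter j * lq_letter i).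
Proof. exact: (letters_swap (lq_RE n C)). Qed.
Lemma lq_shift_swap i j :
  words_h lq_shift 2 (lq_shift i * lq_shift j - lq_shift j * lq_shift i).
Proof. exact: (shifted_swap _ lq_letter_swap). Qed.

Lemma words_le_all x : exists d, V d x.
Proof.
elim/LqM_ind: x => [x y [d hd] [e he]|x y [d hd] [e he]|k x [d hd]||i j].
- exists (maxn d e); apply: SpanD.
    exact: (words_le_mono (leq_maxl d e) hd).
  exact: (words_le_mono (leq_maxr d e) he).
- by exists (d + e)%N; apply: words_leM.
- by exists d; apply: SpanZs.
- by exists 0; rewrite -(wv_nil lq_letter); apply: words_le_word.
- by exists 1%N; apply: entry_le1.
Qed.

Hypothesis C0 : [pchar C] =i pred0.

Lemma detects_ex d : exists (A : pzAlg K) (X : 'M[A]_n), detects d X.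
Proof.
elim: d => [|d [A [X hX]]]; first exact: detects0.
exact: detectsS C0 _ _ _ hX.
Qed.

Local Notation Wp := (mono_val lq_shift).

(** On the representation X = 1 + h Y the ordered word in the shifted generators
    is a power of h times the ordered word in Y. *)
Lemma shift_functional d (m0 : 'X_{1..N}) : mdeg m0 = d ->
  exists (f : 'X_{1..N} -> K) (kap : C),
  [/\ forall (I : finType) (m : I -> 'X_{1..N}) (c : I -> K),
        \sum_i c i *: Wp (m i) = 0 -> \sum_i c i * h ^+ mdeg (m i) * f (m i) = 0,
      kap != 0 & forall m, (mdeg m <= d)%N -> ev (f m) = kap *+ (m == m0)].
Proof.
move=> hm0; have [A [X [hX [Y [eX hF]]]]] := detects_ex d.
pose lt (m : 'X_{1..N}) : seq ('I_n * 'I_n) := map (@vpair n) (mono_word m).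
have szlt m : size (lt m) = mdeg m by rewrite size_map size_mono_word.
have [|F [kap [linF kap0 Fval]]] := hF (lt m0); first by rewrite szlt.
exists (fun m => F (word_val Y (lt m))), kap; split=> // [I m c e|m hm].
  have [FD F0 FZ] := lin_forD linF.
  have Fs (r : seq I) (G : I -> A) : F (\sum_(i <- r) G i) = \sum_(i <- r) F (G i).
    by elim: r => [|i r ih]; rewrite ?big_nil // !big_cons FD ih.
  have [g [hg eg]] := LqM_lift hX.
  have gp k : g (lq_shift k) = h *: Y (vpair k).
    rewrite /lq_shift /shifted (samB hg) (samZ hg) (sam1 hg) eg eX /= scaler_nat.
    by rewrite addrC addKr -surjective_pairing.
  have gW m' : g (Wp m') = h ^+ mdeg m' *: word_val Y (lt m').
    rewrite -szlt /mono_val /lt /word_val (sam_prod hg) big_map size_map.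
    elim: (mono_word m') => [|k s ih]; first by rewrite !big_nil scale1r.
    by rewrite !big_cons ih gp exprS -pz_scalerAl -pz_scalerAr scalerA.
  have eF := congr1 F (congr1 g e); rewrite (sam_sum hg) (sam0 hg) F0 Fs in eF.
  by rewrite -[RHS]eF; apply: eq_bigr => i _; rewrite (samZ hg) gW scalerA FZ.
rewrite Fval ?szlt //; congr (_ *+ _).
have vinj : injective (@vpair n) := can_inj (fun k => vpairK k : (fun p => mxvec_index p.1 p.2) (vpair k) = k).
congr (nat_of_bool _); apply/idP/eqP => [pe|->]; last exact: perm_refl.
rewrite -[m]mono_wordK -[m0]mono_wordK; apply/eqP; rewrite -perm_word_mono perm_sym.
exact: (perm_map_inj vinj pe).
Qed.

(** By descending induction on the degree: modulo q - 1 the functional of a monomial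
    sees this monomial and those of larger degree only. *)
Lemma shift_independent d (c : 'X_{1..N < d} -> K) :
  \sum_m c m *: Wp m = 0 -> forall m, c m = 0.
Proof.
move=> ec.
suff hc : forall m, c m * h ^+ mdeg m = 0.
  move=> m; have := hc m; elim: (mdeg m) => [|k ih]; first by rewrite mulr1.
  by rewrite exprS mulrCA => /kq_mulh_eq0.
pose adm (f : 'X_{1..N} -> K) := forall c' : 'X_{1..N < d} -> K,
  \sum_m c' m *: Wp m = 0 -> \sum_m c' m * h ^+ mdeg m * f m = 0.
pose Q (u : 'X_{1..N < d} -> K) := forall f, adm f -> \sum_m u m * f m = 0.
apply: (@h_descent C _ Q); last by move=> f /(_ _ ec).
  move=> u Qu.
  suff main k : forall m : 'X_{1..N < d}, (d <= mdeg m + k)%N -> ev (u m) = 0.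
    by move=> m; apply: (main d); rewrite leq_addl.
  elim: k => [|k ih] m; first by rewrite addn0 leqNgt bmdeg.
  rewrite addnS leq_eqVlt => /orP[/eqP dk|]; last by rewrite ltnS; apply: ih.
  have [f [kap [hf kap0 fv]]] := shift_functional (erefl (mdeg m)).
  have /(congr1 ev) := Qu f (fun c' => hf _ _ c'); rewrite ev_sum ev0 (bigD1 m) //= big1.
    rewrite addr0 evM fv // eqxx mulr1n => /eqP.
    by rewrite mulf_eq0 (negPf kap0) orbF => /eqP.
  move=> m' m'm; rewrite evM; have [le|lt] := leqP (mdeg m') (mdeg m).
    by rewrite fv // (_ : (m' : 'X_{1..N}) == m = false) ?mulr0 //; apply/negbTE.
  by rewrite ih ?mul0r //; apply: (leq_trans (eq_leq dk)); rewrite -addSn leq_add2r.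
move=> u Qu f hf; apply: kq_mulh_eq0; rewrite mulr_sumr -[RHS](Qu f hf).
by apply: eq_bigr => m _; rewrite mulrA.
Qed.

Lemma LqM_torsion_free (x : LqM C n) : h *: x = 0 -> x = 0.
Proof.
move=> hx; have [d /words_le_shifted /(pbw_span lq_shift_swap) Vx] := words_le_all x.
have [c ec] : exists c : 'X_{1..N < d.+1} -> K, x = \sum_m c m *: Wp m.
  apply: Span_fin; apply: Span_sub Vx => z [m [hm ->]]; apply: SpanG.
  have hm' : (mdeg m < d.+1)%N by []; by exists (BMultinom hm').
have e : \sum_m (h * c m) *: Wp m = 0.
  by rewrite -[RHS]hx ec scaler_sumr; apply: eq_bigr => m _; rewrite scalerA.
rewrite ec; apply: big1 => m _.
by rewrite (kq_mulh_eq0 (shift_independent e m)); exact: scale0r.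
Qed.

(** * The classical limit of the reflection equation algebra *)

Local Notation P := {mpoly C[N]}.
Local Notation PA := (alg_pzAlg P).
Local Notation evR := [the {rmorphism K -> C} of ev].

Definition generic_mx : 'M[P]_n := \matrix_(i, j) 'X_(mxvec_index i j).

Lemma ev_lam : ev lam = 0.
Proof. by have [mu [-> _]] := lam_h C; rewrite evM ev_h mul0r. Qed.
Lemma ev_qdel (i j : 'I_n) : ev (qdel C i j) = 1.
Proof. by rewrite qdel_h evD evM ev_h mul0r addr0 ev1. Qed.

Lemma classical_mulRl (A : pzAlg C) (M : 'M[A]_(n * n)) s u b t :
  ent (Rhat_along n evR A *m M) s u b t = ent M u s b t.
Proof. by rewrite mulRl /= ev_lam ev_qdel scale1r scale0r mul0rn addr0. Qed.
Lemma classical_mulRr (A : pzAlg C) (M : 'M[A]_(n * n)) s u b t :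
  ent (M *m Rhat_along n evR A) s u b t = ent M s u t b.
Proof. by rewrite mulRr /= ev_lam ev_qdel scale1r scale0r mul0rn addr0. Qed.

Lemma classical_RE (A : pzAlg C) (X : 'M[A]_n) :
  (forall i j k l, X i j * X k l = X k l * X i j) -> RE evR X.
Proof.
move=> XC; apply: mxtens_eqP => s u b t.
rewrite -!mulmxA classical_mulRl mul_leg2l [RHS]mul_leg2l.
transitivity (X s b * X u t).
  under eq_bigr => r _ do rewrite classical_mulRl leg2E mulrnAr.
  by rewrite big_delta'.
rewrite XC; under eq_bigr => r _ do rewrite classical_mulRl classical_mulRr leg2E mulrnAr.
by rewrite big_delta'.
Qed.

Lemma classical_exists : exists f : LqM C n -> PA,
  semialg_morphism evR f /\ forall i j, f (lq C n i j) = generic_mx i j.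
Proof.
apply: (@LqM_lift n C C evR PA generic_mx); apply: classical_RE => i j k l.
exact: (@mulrC P).
Qed.

End ReflectionAlgebra.

(** * Exact sequences *)
Section Exactness.
Variable R : comUnitRingType.

(** The first Koszul homology of the sequence g vanishes: every linear relation
    between its members is a combination of the trivial ones. *)
Definition exact r (g : 'cV[R]_r) : Prop :=
  forall a : 'rV_r, a *m g = 0 -> exists D : 'M_r, a^T = (D - D^T) *m g.

Lemma row_col_mul r (a : 'rV[R]_r) (g : 'cV[R]_r) :
  a *m g = (\sum_i a 0 i * g i 0)%:M.
Proof. by apply/matrixP => i j; rewrite !ord1 !mxE eqxx. Qed.

Lemma exactP r (g : 'cV[R]_r) : exact g <->
  forall a : 'I_r -> R, \sum_i a i * g i 0 = 0 ->
    exists D : 'I_r -> 'I_r -> R, forall i, a i = \sum_j (D i j - D j i) * g j 0.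
Proof.
split=> [hg a ea|hg a ea].
  have [|D eD] := hg (\row_i a i).
    rewrite row_col_mul; under eq_bigr => i _ do rewrite mxE.
    by rewrite ea; apply/matrixP => i j; rewrite !mxE mul0rn.
  exists D => i; have /matrixP /(_ i 0) := eD; rewrite !mxE => ->.
  by apply: eq_bigr => j _; rewrite !mxE.
have [|D eD] := hg (a 0).
  by have /matrixP /(_ 0 0) := ea; rewrite row_col_mul !mxE eqxx.
exists (\matrix_(i, j) D i j); apply/matrixP => i j; rewrite ord1 !mxE eD.
by apply: eq_bigr => k _; rewrite !mxE.
Qed.

Lemma exact_unit r (U : 'M[R]_r) (g : 'cV[R]_r) : U \in unitmx ->
  exact g -> exact (U *m g).
Proof.
move=> uU hg a; rewrite mulmxA => /hg[D eD].
exists ((invmx U)^T *m D *m invmx U).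
transitivity ((invmx U)^T *m ((D - D^T) *m g)).
  by rewrite -eD trmx_mul mulmxA -trmx_mul mulmxV // trmx1 mul1mx.
rewrite mulmxA [in RHS]mulmxA !trmx_mul trmxK [(invmx U)^T *m (_ *m _)]mulmxA -mulmxBl -mulmxBr.
by rewrite -!mulmxA (mulmxA (invmx U)) mulVmx // mul1mx.
Qed.

Definition in_ideal r (g : 'cV[R]_r) (p : R) : Prop := exists c : 'rV_r, p%:M = c *m g.

(** A relation b f + a g = 0 puts b into the ideal of g, so a trivial relation
    between f and g removes the term b f. *)
Lemma exact_cons r (g : 'cV[R]_r) f : exact g ->
  (forall p, in_ideal g (f * p) -> in_ideal g p) -> exact (col_mx f%:M g : 'cV_(1 + r)).
Proof.
move=> hg nzd a; rewrite -[a]hsubmxK mul_row_col.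
set b := lsubmx a; set a' := rsubmx a => e.
have [c ec] : in_ideal g (b 0 0).
  apply: nzd; exists (- a'); rewrite mulNmx; apply/eqP; rewrite eq_sym eqr_oppLR -addr_eq0.
  by rewrite mulrC scalar_mxM -mx11_scalar addrC e.
have [|D eD] := hg (a' + f *: c).
  by rewrite mulmxDl -scalemxAl -ec -mx11_scalar -mul_mx_scalar addrC e.
exists (block_mx 0 c 0 D).
rewrite tr_row_mx tr_block_mx !trmx0 opp_block_mx add_block_mx !oppr0 !add0r !addr0.
rewrite mul_block_col mul0mx add0r -eD -ec -mx11_scalar.
rewrite [b]mx11_scalar tr_scalar_mx; congr col_mx.
have -> : (a' + f *: c)^T = a'^T + f *: c^T by apply/matrixP => i j; rewrite !mxE.
by rewrite mulNmx mul_mx_scalar [RHS]addrC addrK.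
Qed.

(** If f p = c g, exactness writes the coefficient p of f in the relation
    p f - c g = 0 by means of g alone, as D - D^T vanishes on the diagonal. *)
Lemma exact_cons_nzd r (g : 'cV[R]_r) f p : exact (col_mx f%:M g : 'cV_(1 + r)) ->
  in_ideal g (f * p) -> in_ideal g p.
Proof.
move=> hfg [c ec]; have [|D] := hfg (row_mx p%:M (- c)).
  by rewrite mul_row_col mulNmx -ec -scalar_mxM mulrC subrr.
rewrite tr_row_mx tr_scalar_mx -[D]submxK tr_block_mx opp_block_mx add_block_mx mul_block_col.
move=> /eq_col_mx[ep _]; rewrite /in_ideal ep.
set d := ulsubmx D; have -> : d^T = d by rewrite [d]mx11_scalar tr_scalar_mx.
by rewrite subrr mul0mx add0r; exists (ursubmx D - (dlsubmx D)^T).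
Qed.

(** Both parts are used: without f, to lift relations to the quantum algebra; with
    f, to divide by f modulo the ideal. *)
Definition exact2 r (f : R) (g : 'cV[R]_r) : Prop :=
  exact g /\ exact (col_mx f%:M g : 'cV_(1 + r)).

Lemma exact2_unit r f (U : 'M[R]_r) (g : 'cV[R]_r) : U \in unitmx ->
  exact2 f g -> exact2 f (U *m g).
Proof.
move=> uU [h1 h2]; split; first exact: exact_unit.
have -> : col_mx f%:M (U *m g) = block_mx 1%:M 0 0 U *m col_mx f%:M g.
  by rewrite mul_block_col !mul0mx mul1mx addr0 add0r.
apply: exact_unit => //.
by rewrite unitmxE det_ublock det1 mul1r -unitmxE.
Qed.

Lemma exact2_trig r f (g g' : 'cV[R]_r) :
  (forall k : 'I_r, exists v : R, exists u : 'I_r -> R, v \is a GRing.unit /\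
     g' k 0 = v * g k 0 + \sum_(j < r | (j < k)%N) u j * g j 0) ->
  exact2 f g <-> exact2 f g'.
Proof.
move=> /boolp.choice[v] /boolp.choice[u hu].
pose U : 'M[R]_r := \matrix_(k, j) if (j < k)%N then u k j else v k *+ (k == j).
have eU : g' = U *m g.
  apply/matrixP => k j; rewrite ord1 mxE; have [_ ->] := hu k.
  rewrite [RHS](bigID (fun j : 'I_r => (j < k)%N)) /= addrC; congr (_ + _); last first.
    by apply: eq_bigr => i ik; rewrite mxE ik.
  rewrite (bigD1 k) ?ltnn //= big1; first by rewrite mxE ltnn eqxx addr0 mulr1n.
  by move=> i /andP[/negPf ik /negPf ki]; rewrite mxE ik eq_sym ki mulr0n mul0r.
have uU : U \in unitmx.
  rewrite unitmxE det_trig; last first.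
    apply/is_trig_mxP => i j ij; rewrite mxE ltnNge (ltnW ij) /=.
    by rewrite -val_eqE /= ltn_eqF.
  by apply: rpred_prod => k _; rewrite mxE ltnn eqxx mulr1n; case: (hu k).
split=> [h|h]; first by rewrite eU; apply: exact2_unit.
rewrite -[g](mulKmx uU) -eU; apply: exact2_unit => //.
by rewrite unitmx_inv.
Qed.
End Exactness.

(** * Leading forms *)
Section LeadingForms.
Variable R : comNzRingType.

(** The leading form t may be 0, which makes the notion additive. *)
Definition ptop (e : nat) (Q : {poly R}) (t : R) : Prop := (size Q <= e.+1)%N /\ Q`_e = t.

Lemma ptopD e Q Q' t t' : ptop e Q t -> ptop e Q' t' -> ptop e (Q + Q') (t + t').
Proof.
move=> [s1 <-] [s2 <-]; split; last by rewrite coefD.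
by apply: leq_trans (size_polyD _ _) _; rewrite geq_max s1.
Qed.
Lemma ptopN e Q t : ptop e Q t -> ptop e (- Q) (- t).
Proof. by move=> [s1 <-]; split; rewrite ?size_polyN ?coefN. Qed.
Lemma ptop0 e : ptop e 0 0.
Proof. by split; rewrite ?size_poly0 ?coef0. Qed.
Lemma ptop_sum e (I : Type) (r : seq I) (P : pred I) (Q : I -> {poly R}) t :
  (forall i, P i -> ptop e (Q i) (t i)) ->
  ptop e (\sum_(i <- r | P i) Q i) (\sum_(i <- r | P i) t i).
Proof.
move=> h; elim: r => [|i r ih]; first by rewrite !big_nil; apply: ptop0.
by rewrite !big_cons; case: ifP => // Pi; apply: ptopD => //; apply: h.
Qed.
Lemma ptopM e e' Q Q' t t' : ptop e Q t -> ptop e' Q' t' -> ptop (e + e') (Q * Q') (t * t').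
Proof.
move=> [s1 <-] [s2 <-]; split.
  apply: leq_trans (size_polyMleq _ _) _.
  by rewrite -subn1 leq_subLR add1n -addnS -addSn leq_add.
rewrite coefM (bigD1 (inord e)) //= big1 ?addr0.
  by rewrite inordK ?addKn // ltnS leq_addr.
move=> i; rewrite -val_eqE /= inordK ?ltnS ?leq_addr // => ie.
case: (ltngtP i e) ie => // [lt|gt] _.
  rewrite [Q'`__]nth_default ?mulr0 //; apply: leq_trans s2 _.
  by rewrite -(ltn_add2l i) subnKC ?ltn_add2r // -ltnS.
by rewrite [Q`__]nth_default ?mul0r //; apply: leq_trans s1 _.
Qed.
Lemma ptop_prod (I : Type) (r : seq I) (P : pred I) (e : I -> nat) (Q : I -> {poly R}) t :
  (forall i, P i -> ptop (e i) (Q i) (t i)) ->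
  ptop (\sum_(i <- r | P i) e i) (\prod_(i <- r | P i) Q i) (\prod_(i <- r | P i) t i).
Proof.
move=> h; elim: r => [|i r ih].
  by rewrite !big_nil; split; rewrite ?coef1 // size_poly1.
by rewrite !big_cons; case: ifP => // Pi; apply: ptopM => //; apply: h.
Qed.
Lemma ptopC c : ptop 0 c%:P c.
Proof. by split; rewrite ?coefC // size_polyC; case: (c != 0). Qed.
Lemma ptop_lt e e' Q t : ptop e Q t -> (e < e')%N -> ptop e' Q 0.
Proof.
by move=> [s1 _] ee; split; [apply: leq_trans s1 _; rewrite ltnS ltnW|rewrite nth_default // (leq_trans s1)].
Qed.
Lemma ptop_size e Q : ptop e Q 0 -> (size Q <= e)%N.
Proof.
move=> [s1 c0]; apply/leq_sizeP => j; rewrite leq_eqVlt => /orP[/eqP<- //|ej].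
by rewrite nth_default // (leq_trans s1).
Qed.
Lemma ptop_XnM r e Q t : ptop (r + e) ('X^r * Q) t <-> ptop e Q t.
Proof.
have c j : ('X^r * Q)`_(r + j) = Q`_j by rewrite coefXnM ltnNge leq_addr /= addKn.
split=> [[s1 <-]|[s1 <-]]; split; rewrite ?c //.
  apply/leq_sizeP => j ej; rewrite -c nth_default //; apply: leq_trans s1 _.
  by rewrite -addnS leq_add2l.
by apply: leq_trans (size_polyMleq _ _) _; rewrite size_polyXn /= -addnS leq_add2l.
Qed.
Lemma ptop_Xn e c : ptop e (c *: 'X^e) c.
Proof.
split; last by rewrite coefZ coefXn eqxx mulr1.
by apply: leq_trans (size_scale_leq _ _) _; rewrite size_polyXn.
Qed.

(** Every term of the determinant takes one entry from each column. *)
Lemma ptop_det n (M : 'M[{poly R}]_n) (t : 'M[R]_n) (e : 'I_n -> nat) :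
  (forall i k, ptop (e k) (M i k) (t i k)) -> ptop (\sum_k e k)%N (\det M) (\det t).
Proof.
move=> h; rewrite -det_tr -[\det t]det_tr; apply: ptop_sum => s _.
have p1 : ptop 0 ((-1) ^+ s : {poly R}) ((-1) ^+ s).
  by case: (odd_perm s); [rewrite expr1 -polyC1 -polyCN|rewrite expr0 -polyC1]; apply: ptopC.
rewrite -[(\sum_k _)%N]add0n; apply: ptopM => //.
by apply: ptop_prod => k _; rewrite !mxE.
Qed.
End LeadingForms.

Section Graded.
Variable R : comUnitRingType.
(** A grading of R by natural numbers, as the substitution that multiplies a
    homogeneous element of degree e by the e-th power of a parameter. *)
Variable sigma : {rmorphism R -> {poly R}}.
Hypothesis sigma1 : forall p, (sigma p).[1] = p.
Hypothesis sigma_hom : forall p e, sigma ((sigma p)`_e) = (sigma p)`_e *: 'X^e.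

(** If the leading forms have only trivial relations, the leading form of a
    relation is trivial, and subtracting a trivial relation lowers its degree. *)
Lemma exact_top r (g t : 'cV[R]_r) (e : 'I_r -> nat) :
  (forall i, ptop (e i) (sigma (g i 0)) (t i 0)) -> exact t -> exact g.
Proof.
move=> hg /exactP ht; apply/exactP.
suff main M (a : 'I_r -> R) : (forall i, (size ('X^(e i) * sigma (a i))%R <= M)%N) ->
    \sum_i a i * g i 0 = 0 ->
    exists D : 'I_r -> 'I_r -> R, forall i, a i = \sum_j (D i j - D j i) * g j 0.
  move=> a; apply: (main (\max_i size ('X^(e i) * sigma (a i))%R)%N) => i.
  exact: (leq_bigmax i).
elim: M a => [|m ih] a ha ea.
  exists (fun _ _ => 0) => i; rewrite big1 => [|j _]; last by rewrite subrr mul0r.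
  rewrite -(sigma1 (a i)); have := ha i; rewrite leqn0 size_poly_eq0 => /eqP e0.
  suff -> : sigma (a i) = 0 by rewrite horner0.
  apply/polyP => j; rewrite coef0.
  by have := congr1 (fun Q : {poly R} => Q`_(e i + j)) e0; rewrite /= coef0 coefXnM ltnNge leq_addr addKn.
pose al i := ('X^(e i) * sigma (a i))`_m.
have hal i : ptop m ('X^(e i) * sigma (a i)) (al i) by split.
have eal : \sum_i al i * t i 0 = 0.
  have [_ <-] : ptop m (\sum_i sigma (a i * g i 0)) (\sum_i al i * t i 0).
    apply: ptop_sum => i _; apply/(ptop_XnM (e i)).
    by rewrite rmorphM mulrA addnC; apply: ptopM.
  by rewrite -rmorph_sum ea rmorph0 coef0.
have [D0 eD0] := ht al eal.
pose D i j := ('X^(e i + e j) * sigma (D0 i j))`_m.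
have homM i x : sigma ('X^(e i) * sigma x)`_m * 'X^(e i) = ('X^(e i) * sigma x)`_m *: 'X^m.
  rewrite coefXnM; case: ltnP => [_|le]; first by rewrite rmorph0 mul0r scale0r.
  by rewrite sigma_hom -scalerAl -exprD subnK.
have homD k x : sigma ('X^k * sigma x)`_m * 'X^k = ('X^k * sigma x)`_m *: 'X^m.
  rewrite coefXnM; case: ltnP => [_|le]; first by rewrite rmorph0 mul0r scale0r.
  by rewrite sigma_hom -scalerAl -exprD subnK.
have homt j : sigma (t j 0) = t j 0 *: 'X^(e j) by have [_ <-] := hg j; rewrite sigma_hom.
have ealD i : al i = \sum_j (D i j - D j i) * t j 0.
  transitivity ('X^(e i) * sigma (al i))`_m.
    by rewrite mulrC homD coefZ coefXn eqxx mulr1.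
  rewrite eD0 rmorph_sum mulr_sumr coef_sum; apply: eq_bigr => j _.
  rewrite rmorphM homt mulrA -scalerAr coefZ mulrC; congr (_ * _).
  rewrite rmorphB mulrBr mulrBl coefB /D; congr (_`__ - _`__).
    by rewrite exprD mulrAC.
  by rewrite addnC exprD mulrAC.
pose a' i := a i - \sum_j (D i j - D j i) * g j 0.
have hD i j : ptop m ('X^(e i) * sigma (D i j * g j 0)) (D i j * t j 0).
  apply/(ptop_XnM (e j)); rewrite rmorphM !mulrA -exprD [(e j + m)%N]addnC [(e j + _)%N]addnC.
  by apply: ptopM => //; rewrite mulrC homD; apply: ptop_Xn.
have hD' i j : ptop m ('X^(e i) * sigma (D j i * g j 0)) (D j i * t j 0).
  apply/(ptop_XnM (e j)); rewrite rmorphM !mulrA -exprD [(e j + m)%N]addnC.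
  by apply: ptopM => //; rewrite mulrC homD; apply: ptop_Xn.
have [i||D1 eD1] := ih a'.
- apply: ptop_size; rewrite -[0](subrr (al i)) {2}ealD /a' rmorphB mulrBr.
  apply: ptopD => //; apply: ptopN; rewrite rmorph_sum mulr_sumr; apply: ptop_sum => j _.
  by rewrite !mulrBl rmorphB mulrBr; apply: ptopD => //; apply: ptopN.
- rewrite /a'; under eq_bigr => i _ do rewrite mulrBl.
  rewrite sumrB ea sub0r; apply/eqP; rewrite oppr_eq0; apply/eqP.
  have anti (x : 'I_r -> 'I_r -> R) : \sum_i \sum_j x i j = \sum_i \sum_j x j i by exact: exchange_big.
  transitivity (\sum_i \sum_j (D i j * g j 0 * g i 0 - D j i * g i 0 * g j 0)).
    apply: eq_bigr => i _; rewrite mulr_suml; apply: eq_bigr => j _.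
    by rewrite mulrBl mulrBl [X in _ - X]mulrAC.
  under eq_bigr => i _ do rewrite sumrB.
  by rewrite sumrB [X in _ - X]anti subrr.
exists (fun i j => D i j + D1 i j) => i.
have -> : a i = a' i + \sum_j (D i j - D j i) * g j 0 by rewrite subrK.
rewrite eD1 addrC -big_split /=; apply: eq_bigr => j _.
by rewrite -mulrDl opprD addrACA.
Qed.

Lemma exact2_top r f tf e0 (g t : 'cV[R]_r) (e : 'I_r -> nat) :
  (forall i, ptop (e i) (sigma (g i 0)) (t i 0)) -> ptop e0 (sigma f) tf ->
  exact2 tf t -> exact2 f g.
Proof.
move=> hg hf [h1 h2]; split; first exact: exact_top h1.
apply: (@exact_top _ _ _ (fun i => if split i is inr j then e j else e0)) h2.
move=> k; rewrite -[k]splitK; case: (split k) => j; rewrite unsplitK /=.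
  by rewrite !col_mxEu ord1 !mxE eqxx.
by rewrite !col_mxEd.
Qed.
End Graded.

(** * Weights and coprime monomials *)
Section IdealMembership.
Variable R : comUnitRingType.
Lemma in_idealP r (g : 'cV[R]_r) p :
  in_ideal g p <-> exists c : 'I_r -> R, p = \sum_i c i * g i 0.
Proof.
split=> [[c /matrixP /(_ 0 0)]|[c ->]].
  by rewrite !mxE eqxx mulr1n => ->; exists (c 0).
exists (\row_i c i); rewrite row_col_mul; congr (_%:M).
by apply: eq_bigr => i _; rewrite mxE.
Qed.
Lemma in_ideal0 r (g : 'cV[R]_r) : in_ideal g 0.
Proof. by exists 0; rewrite mul0mx; apply/matrixP => i j; rewrite !mxE mul0rn. Qed.
Lemma in_idealD r (g : 'cV[R]_r) p s : in_ideal g p -> in_ideal g s -> in_ideal g (p + s).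
Proof. by move=> [c ec] [d ed]; exists (c + d); rewrite mulmxDl -ec -ed raddfD. Qed.
Lemma in_idealM r (g : 'cV[R]_r) p s : in_ideal g p -> in_ideal g (s * p).
Proof. by move=> [c ec]; exists (s *: c); rewrite -scalemxAl -ec scale_scalar_mx. Qed.
Lemma in_ideal_sum r (g : 'cV[R]_r) (I : Type) (s : seq I) (P : pred I) (F : I -> R) :
  (forall i, P i -> in_ideal g (F i)) -> in_ideal g (\sum_(i <- s | P i) F i).
Proof.
by move=> h; apply: (big_ind (in_ideal g)) => //; [exact: in_ideal0|move=> x y; apply: in_idealD].
Qed.
Lemma in_ideal_gen r (g : 'cV[R]_r) i : in_ideal g (g i 0).
Proof.
apply/in_idealP; exists (fun j => (j == i)%:R); rewrite (bigD1 i) //= eqxx mul1r big1 ?addr0 //.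
by move=> j /negPf->; rewrite mul0r.
Qed.
End IdealMembership.

Section Weights.
Variables (C : fieldType) (N : nat) (w : 'I_N -> nat).
Local Notation P := {mpoly C[N]}.

Definition wdeg (m : 'X_{1..N}) : nat := (\sum_k w k * m k)%N.
Definition wsub : P -> {poly P} :=
  mmap [the {rmorphism C -> {poly P}} of polyC \o @mpolyC N C]
       (fun k => ('X_k : P) *: 'X^(w k)).
HB.instance Definition _ := GRing.RMorphism.on wsub.

Lemma wsubE p : wsub p = \sum_(m <- msupp p) (p@_m *: 'X_[m]) *: 'X^(wdeg m).
Proof.
apply: eq_bigr => m _; rewrite /= /mmap1 mul_polyC -mul_mpolyC -scalerA; congr (_ *: _).
rewrite mpolyXE_id /wdeg expr_sum -mul_polyC rmorph_prod -big_split /=.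
by apply: eq_bigr => k _; rewrite -mul_polyC exprMn -exprM rmorphXn.
Qed.
Lemma wsubX m : wsub 'X_[m] = ('X_[m] : P) *: 'X^(wdeg m).
Proof. by rewrite wsubE msuppX big_seq1 mcoeffX eqxx scale1r. Qed.
Lemma wsubXU k : wsub 'X_k = ('X_k : P) *: 'X^(w k).
Proof.
rewrite wsubX; congr (_ *: 'X^_); rewrite /wdeg (bigD1 k) //= mnm1E eqxx muln1.
by rewrite big1 ?addn0 // => j jk; rewrite mnm1E eq_sym (negPf jk) muln0.
Qed.
Lemma wsub_horner p : (wsub p).[1] = p.
Proof.
rewrite wsubE horner_sum [RHS]mpolyE; apply: eq_bigr => m _.
by rewrite hornerZ hornerXn expr1n mulr1.
Qed.
Lemma wsub_coef p e :
  (wsub p)`_e = \sum_(m <- msupp p) (p@_m *: 'X_[m]) *+ (wdeg m == e).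
Proof.
rewrite wsubE coef_sum; apply: eq_bigr => m _.
by rewrite coefZ coefXn eq_sym mulr_natr.
Qed.
Lemma wsub_hom p e : wsub ((wsub p)`_e) = (wsub p)`_e *: 'X^e.
Proof.
rewrite wsub_coef rmorph_sum scaler_suml; apply: eq_bigr => m _.
case: eqP => [<-|_]; last by rewrite !mulr0n scale0r rmorph0.
rewrite /= !mulr1n [LHS]mmapZ [X in _ * X]wsubX /= mul_polyC scalerA.
by rewrite mul_mpolyC.
Qed.
End Weights.

Section Monomials.
Variables (C : fieldType) (N : nat).
Local Notation P := {mpoly C[N]}.
Definition coprime_mnm (m m' : 'X_{1..N}) := forall k, m k = 0 \/ m' k = 0.
Definition mono_col r (m : 'I_r -> 'X_{1..N}) : 'cV[P]_r := \col_i 'X_[m i].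

Lemma mcoeffMX_le (p : P) m k : (p * 'X_[m])@_k != 0 -> (m <= k)%MM.
Proof.
rewrite -mcoeff_msupp (perm_mem (msuppMX _ _)) => /mapP[u _ ->].
exact: lem_addr.
Qed.

(** Membership in a monomial ideal is tested on each monomial. *)
Lemma monomial_nzd r (m : 'I_r -> 'X_{1..N}) m0 p :
  (forall i, coprime_mnm m0 (m i)) ->
  in_ideal (mono_col m) ('X_[m0] * p) -> in_ideal (mono_col m) p.
Proof.
move=> cop /in_idealP[c ec]; rewrite [p]mpolyE big_seq; apply: in_ideal_sum => u hu.
have : ('X_[m0] * p)@_(m0 + u) != 0 by rewrite mulrC mcoeffMX -mcoeff_msupp.
rewrite ec raddf_sum => ne.
have [i ei] : exists i, (c i * mono_col m i 0)@_(m0 + u) != 0.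
  apply/existsP; apply: contraNT ne; rewrite negb_exists => /forallP h.
  by apply/eqP; apply: big1 => i _; apply/eqP; have := h i; rewrite negbK.
have le : (m i <= u)%MM.
  rewrite mxE in ei; have /mnm_lepP lek := mcoeffMX_le ei.
  apply/mnm_lepP => k; have := lek k; rewrite mnmDE.
  by case: (cop i k) => ->; rewrite // add0n.
rewrite -mul_mpolyC -(submK le) mpolyXD mulrA; apply: in_idealM.
by have := in_ideal_gen (mono_col m) i; rewrite mxE.
Qed.

Lemma exact_monomials r (m : 'I_r -> 'X_{1..N}) :
  (forall i j, i != j -> coprime_mnm (m i) (m j)) -> exact (mono_col m).
Proof.
elim: r m => [|r ih] m cop.
  by move=> a _; exists 0; apply/matrixP => -[].
have -> : mono_col m =
    col_mx ('X_[m ord0])%:M (mono_col (fun i => m (lift ord0 i))) :> 'cV_(1 + r).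
  apply/matrixP => k j; rewrite ord1 -[k]splitK; case: (split k) => i /=.
    rewrite col_mxEu ord1 !mxE eqxx mulr1n; congr ('X_[m _]); exact: val_inj.
  by rewrite col_mxEd !mxE; congr ('X_[m _]); apply: val_inj.
apply: exact_cons.
  by apply: ih => i j ij; apply: cop; rewrite (inj_eq lift_inj).
by move=> p; apply: monomial_nzd => i; apply: cop; rewrite neq_lift.
Qed.

Lemma exact2_monomials r (m : 'I_r -> 'X_{1..N}) m0 :
  (forall i j, i != j -> coprime_mnm (m i) (m j)) ->
  (forall i, coprime_mnm m0 (m i)) -> exact2 'X_[m0] (mono_col m).
Proof.
move=> cop cop0; split; first exact: exact_monomials.
by apply: exact_cons; [exact: exact_monomials|move=> p; apply: monomial_nzd].
Qed.
End Monomials.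

(** * Complete symmetric functions *)
Section CompleteSymmetric.
Variables (R : comUnitRingType) (d : nat -> R).

(** The complete symmetric function of degree k in the first m of the d's. *)
Fixpoint csym (m : nat) : nat -> R :=
  if m is m'.+1 then
    fix aux k := if k is k'.+1 then csym m' k'.+1 + d m' * aux k' else 1
  else fun k => (k == 0%N)%:R.
Definition psum (m i : nat) : R := \sum_(j < m) d j ^+ i.

Lemma csym0 m : csym m 0 = 1. Proof. by case: m. Qed.
Lemma csymS m k : csym m.+1 k.+1 = csym m k.+1 + d m * csym m.+1 k. Proof. by []. Qed.

Lemma csym_nil k : csym 0 k = (k == 0%N)%:R. Proof. by []. Qed.
Arguments csym : simpl never.

Lemma csym_expand m k : csym m.+1 k = \sum_(i < k.+1) csym m (k - i) * d m ^+ i.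
Proof.
elim: k => [|k ih]; first by rewrite big_ord_recl big_ord0 expr0 mulr1 addr0 subn0 !csym0.
rewrite csymS ih [RHS]big_ord_recl expr0 mulr1 subn0 mulr_sumr; congr (_ + _).
by apply: eq_bigr => i _; rewrite mulrCA -exprS.
Qed.

(** Newton's identities, by induction on the number of variables. *)
Lemma csym_newton m k : csym m k *+ k = \sum_(i < k) csym m (k - i.+1) * psum m i.+1.
Proof.
elim: m k => [|m ih] k.
  case: k => [|k]; first by rewrite big_ord0.
  rewrite csym_nil mul0rn big1 // => i _.
  by rewrite /psum big_ord0 mulr0.
elim: k => [|k ihk]; first by rewrite big_ord0.
pose Q i := psum m.+1 i.
transitivity (\sum_(i < k.+1) csym m (k - i) * Q i.+1 +
   d m * \sum_(i < k) csym m.+1 (k - i.+1) * Q i.+1).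
  rewrite -ihk csymS mulrnDl mulrS [d m * _ *+ k.+1]mulrS -mulrnAr addrA; congr (_ + _).
  rewrite /Q; under [RHS]eq_bigr => i _ do rewrite /psum big_ord_recr mulrDr -/(psum m i.+1).
  rewrite big_split /= -mulrS ih; congr (_ + _).
  rewrite csym_expand mulr_sumr; apply: eq_bigr => i _.
  by rewrite mulrCA -exprS.
rewrite big_ord_recr [RHS]big_ord_recr /= !subnn !csym0 addrAC; congr (_ + _).
rewrite mulr_sumr -big_split /=; apply: eq_bigr => i _.
by rewrite subSS -(subnSK (ltn_ord i)) csymS mulrDl mulrA.
Qed.

(** Dropping variables changes these functions by a unitriangular system. *)
Lemma csym_drop n s k : (s <= k)%N -> (s <= n)%N -> exists u : nat -> R,
  csym (n - s) k.+1 = csym n k.+1 + \sum_(j < k) u j * csym n j.+1.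
Proof.
elim: s k => [|s ih] k.
  by exists (fun=> 0); rewrite subn0 big1 ?addr0 // => j _; rewrite mul0r.
case: k => // k; rewrite ltnS => sk sn.
have [u eu] := ih k.+1 (leqW sk) (ltnW sn).
have [u' eu'] := ih k sk (ltnW sn).
have e : (n - s)%N = (n - s.+1).+1 by rewrite subnSK.
exists (fun j => u j - d (n - s.+1) * (if j == k then 1 else u' j)).
have -> : csym (n - s.+1) k.+2 = csym (n - s) k.+2 - d (n - s.+1) * csym (n - s) k.+1.
  by rewrite e csymS addrK.
rewrite eu eu' -addrA; congr (_ + _).
under [RHS]eq_bigr => j _ do rewrite mulrBl.
rewrite sumrB; congr (_ - _).
rewrite big_ord_recr /= eqxx mulr1 mulrDr addrC; congr (_ + _).
rewrite mulr_sumr; apply: eq_bigr => j _.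
by rewrite ltn_eqF // mulrA.
Qed.

Section Top.
Variables (n : nat) (sigma : {rmorphism R -> {poly R}}).
Hypothesis sigma_d : forall i, (i < n)%N -> sigma (d i) = d i *: 'X^(i.+1).
(** With weights increasing in the index, the last variable dominates. *)
Lemma csym_top m k : (m <= n)%N ->
  ptop (k * m) (sigma (csym m k)) (if m is m'.+1 then d m' ^+ k else (k == 0%N)%:R).
Proof.
have p1 : ptop 0 (sigma 1) 1 by rewrite rmorph1 -polyC1; apply: ptopC.
elim: m k => [|m ih] k mn.
  rewrite muln0 csym_nil; case: k => [|k]; first exact: p1.
  by rewrite rmorph0; apply: ptop0.
elim: k => [|k ihk]; first by rewrite csym0.
rewrite csymS rmorphD rmorphM -[d m ^+ _]add0r exprS; apply: ptopD.
  by apply: (ptop_lt (ih k.+1 (ltnW mn))); rewrite mulnS -[X in (X < _)%N]add0n ltn_add2r.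
rewrite sigma_d // mulSn; apply: ptopM => //.
exact: ptop_Xn.
Qed.
End Top.

(** Power sums, complete symmetric functions of all the variables, and complete
    symmetric functions of fewer variables as the degree grows, are related by
    unitriangular systems. The last ones have powers of single variables as leading
    forms. *)
Lemma exact2_psum f n : (forall k, k.+1%:R \is a @GRing.unit R) ->
  exact2 f (\col_(k < n) csym (n - k) k.+1) -> exact2 f (\col_(k < n) psum n k.+1).
Proof.
move=> char0 h.
apply/(@exact2_trig _ _ f _ (\col_(k < n) csym n k.+1)); last first.
  apply/(@exact2_trig _ _ f _ (\col_(k < n) csym (n - k) k.+1)) => // k.
  have [u eu] := @csym_drop n k k (leqnn k) (ltnW (ltn_ord k)).
  exists 1, u; split; first exact: unitr1.
  rewrite !mxE eu mul1r (@big_ord_widen _ _ _ k n (fun j => u j * csym n j.+1) (ltnW (ltn_ord k))); congr (_ + _).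
  by apply: eq_bigr => j _; rewrite mxE.
move=> k; exists (k.+1%:R^-1), (fun j => k.+1%:R^-1 * csym n (k - j)).
split; first by rewrite unitrV.
have e : k.+1%:R * csym n k.+1 = \sum_(i < k) csym n (k.+1 - i.+1) * psum n i.+1 + psum n k.+1.
  by rewrite mulr_natl csym_newton big_ord_recr /= subnn csym0 mul1r.
rewrite !mxE -[csym n k.+1](mulKr (char0 k)) e mulrDr addrC; congr (_ + _).
rewrite mulr_sumr (@big_ord_widen _ _ _ k n (fun j => k.+1%:R^-1 * (csym n (k.+1 - j.+1) * psum n j.+1))).
  by apply: eq_bigr => j _; rewrite mxE subSS mulrA.
exact: ltnW (ltn_ord k).
Qed.
End CompleteSymmetric.

(** * Traces of powers of the generic matrix *)
Section GenericMatrix.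
Variables (C : fieldType) (n' : nat).
Local Notation n := n'.+1.
Local Notation N := (n * n)%N.
Local Notation P := {mpoly C[N]}.
Local Notation X := (generic_mx C n).

(** The first grading makes the diagonal dominate, so that the leading forms of
    the traces are power sums of the diagonal entries, and gives the subdiagonal
    just enough weight to lead in the determinant of the Krylov matrix. *)
Definition weight1 (k : 'I_N) : nat :=
  let: (i, j) := vpair k in
  if i == j then (2 * n)%N else if (i == j.+1 :> nat) then (2 * n).-1 else 0%N.
(** The second grading separates the diagonal entries from each other. *)
Definition weight2 (k : 'I_N) : nat :=
  let: (i, j) := vpair k in if i == j then i.+1 else 0%N.

Definition diag_entry (i : nat) : P := if insub i is Some j then X j j else 0.
Definition trace_col : 'cV[P]_n := \col_(k < n) \tr (X ^+ k.+1).
Definition krylov : 'M[P]_n := \matrix_(i, k) (X ^+ k) i ord0.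
Definition subdiag (l : nat) : P := X (inord l.+1) (inord l).
Definition subdiag_prod (k : nat) : P := \prod_(l < k) subdiag l.

Lemma generic_mxE i j : X i j = 'X_(mxvec_index i j). Proof. by rewrite mxE. Qed.

Lemma diag_entryE (i : 'I_n) : diag_entry i = X i i.
Proof. by rewrite /diag_entry valK. Qed.

Local Notation sigma := (wsub weight1).

Lemma wsub1X i j : sigma (X i j) = X i j *:
  'X^(if i == j then (2 * n)%N else if (i == j.+1 :> nat) then (2 * n).-1 else 0%N).
Proof. by rewrite generic_mxE wsubXU /weight1 vpair_mxvec. Qed.

Lemma top_entry i j : ptop (2 * n) (sigma (X i j)) (X i j *+ (i == j)).
Proof.
rewrite wsub1X; case: eqP => [_|_]; first exact: ptop_Xn.
by apply: (ptop_lt (@ptop_Xn _ _ _)); case: ifP; rewrite ?muln_gt0 // ltn_predL muln_gt0.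
Qed.

Lemma top_power k i j : ptop (2 * n * k) (sigma ((X ^+ k) i j)) (X i i ^+ k *+ (i == j)).
Proof.
elim: k i j => [|k ih] i j.
  rewrite muln0 !expr0 mxE; case: (i == j); last by rewrite !mulr0n rmorph0; apply: ptop0.
  by rewrite /= mulr1n rmorph1 -polyC1; apply: ptopC.
rewrite exprS mxE rmorph_sum (mulnS (2 * n) k).
have -> : X i i ^+ k.+1 *+ (i == j) =
    \sum_l (X i l *+ (i == l)) * (X l l ^+ k *+ (l == j)).
  under eq_bigr => l _ do rewrite mulrnAl.
  by rewrite big_delta mulrnAr -exprS.
apply: ptop_sum => l _; rewrite rmorphM.
by apply: ptopM; [exact: top_entry|exact: ih].
Qed.

Lemma top_trace (k : 'I_n) :
  ptop (2 * n * k.+1) (sigma (trace_col k 0)) (psum diag_entry n k.+1).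
Proof.
rewrite mxE rmorph_sum; apply: ptop_sum => i _.
by rewrite diag_entryE; have := top_power k.+1 i i; rewrite eqxx mulr1n.
Qed.

(** An entry of X^k counts paths of length k, and a path reaches i fastest, at the
    least loss of weight, along the subdiagonal. The power of the parameter in front
    of the entry keeps all weights nonnegative. *)
Lemma top_krylov k (i : 'I_n) : (k < n)%N ->
  ptop ((2 * n).+1 * k) ('X^(2 * i) * sigma ((X ^+ k) i ord0)) (subdiag_prod k *+ (i == k :> nat)).
Proof.
elim: k i => [|k ih] i kn.
  rewrite muln0 expr0 mxE -val_eqE /=; have [i0|_] := eqVneq (i : nat) 0%N; last first.
    by rewrite mulr0n rmorph0 mulr0; apply: ptop0.
  rewrite i0 muln0 expr0 mul1r mulr1n rmorph1 /subdiag_prod big_ord0 -polyC1.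
  exact: ptopC.
have -> : subdiag_prod k.+1 *+ (i == k.+1 :> nat) =
    \sum_(l < n) (X i l *+ (i == l.+1 :> nat)) * (subdiag_prod k *+ (l == k :> nat)).
  rewrite (bigD1 (inord k)) //= inordK ?(ltnW kn) // eqxx mulr1n big1 ?addr0; last first.
    move=> l lk; have -> : (l == k :> nat) = false.
      by apply/negbTE; apply: contraNneq lk => <-; rewrite inord_val.
    by rewrite mulr0n mulr0.
  rewrite mulrnAl; have [ik|_] := eqVneq (i : nat) k.+1; last by rewrite !mulr0n.
  rewrite !mulr1n /subdiag_prod big_ord_recr /= mulrC; congr (X _ _ * _).
  by apply: val_inj; rewrite /= inordK // -ik.
rewrite exprS mxE rmorph_sum mulr_sumr; apply: ptop_sum => l _.
apply/(ptop_XnM (2 * l)); rewrite rmorphM.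
rewrite mulrCA [X in _ * X]mulrCA mulrA (mulnS (2 * n).+1 k) addnA; apply: ptopM; last exact: (ih l (ltnW kn)).
rewrite [X in _ * X](wsub1X i l) -scalerAr -exprD.
have [il|il] := eqVneq (i : nat) l.+1.
  have -> : (i == l) = false by rewrite -val_eqE /= il eqn_leq ltnn.
  rewrite mulr1n [(2 * l + _)%N](_ : _ = (2 * i + (2 * n).-1)%N); first exact: ptop_Xn.
  by rewrite il mulnS mulnS /= addnS -addnS !addSn -!addnS addnC addnCA addnC.
rewrite mulr0n; apply: (ptop_lt (@ptop_Xn _ _ _)).
case: eqP => [->|_]; first by rewrite addnS ltnS.
rewrite addn0 addnS ltnS; apply: leq_trans (leq_addl _ _).
by rewrite leq_mul2l ltnW.
Qed.

Definition mu_mnm : 'X_{1..N} :=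
  (\sum_(k < n) \sum_(l < k) U_(mxvec_index (inord l.+1 : 'I_n) (inord l : 'I_n)))%MM.

Lemma mu_mnmE : 'X_[mu_mnm] = \prod_(k < n) subdiag_prod k :> P.
Proof.
rewrite /mu_mnm -mprodXE; apply: eq_bigr => k _; rewrite -mprodXE.
by apply: eq_bigr => l _; rewrite /subdiag generic_mxE.
Qed.

Lemma mu_mnm_diag (i : 'I_n) : mu_mnm (mxvec_index i i) = 0%N.
Proof.
rewrite /mu_mnm mnm_sumE big1 // => k _; rewrite mnm_sumE big1 // => l _.
rewrite mnm1E; apply/eqP; rewrite eqb0; apply/eqP => /(congr1 (@vpair n)).
rewrite !vpair_mxvec => -[e1 e2].
have : (inord l.+1 : 'I_n) = (inord l : 'I_n) by rewrite e1 e2.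
have ln : (l.+1 < n)%N := leq_ltn_trans (ltn_ord l) (ltn_ord k).
by move/(congr1 val); rewrite /= !inordK ?(ltnW ln) // => /esym /n_Sn.
Qed.

Lemma top_det_krylov : ptop (\sum_(k < n) (2 * n).-1 * k) (sigma (\det krylov)) 'X_[mu_mnm].
Proof.
apply/(ptop_XnM (\sum_(i < n) 2 * i)%N).
have -> : (\sum_(i < n) 2 * i + \sum_(k < n) (2 * n).-1 * k = \sum_(k < n) (2 * n).+1 * k)%N.
  rewrite -big_split /=; apply: eq_bigr => k _; rewrite -mulnDl; congr (_ * _)%N.
pose M : 'M[{poly P}]_n := \matrix_(i, k) ('X^(2 * i) * sigma (krylov i k)).
have -> : 'X^(\sum_(i < n) 2 * i) * sigma (\det krylov) = \det M.
  have -> : M = diag_mx (\row_i 'X^(2 * i)) *m map_mx sigma krylov.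
    by apply/matrixP => i k; rewrite mul_diag_mx !mxE.
  rewrite det_mulmx det_diag det_map_mx expr_sum; congr (_ * _).
  by apply: eq_bigr => i _; rewrite mxE.
pose t : 'M[P]_n := diag_mx (\row_k subdiag_prod k).
have -> : 'X_[mu_mnm] = \det t.
  by rewrite det_diag mu_mnmE; apply: eq_bigr => k _; rewrite mxE.
apply: ptop_det => i k; rewrite !mxE.
have := top_krylov i (ltn_ord k); rewrite val_eqE.
by case: eqP => [->|].
Qed.

Local Notation sigma2 := (wsub weight2).

Lemma exact2_csym : exact2 ('X_[mu_mnm] : P) (\col_(k < n) csym diag_entry (n - k) k.+1).
Proof.
have s1 := @wsub_horner C N weight2; have s2 := @wsub_hom C N weight2.
have idx (k : 'I_n) : (n - k.+1 < n)%N by rewrite subSS ltnS leq_subr.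
pose m (k : 'I_n) : 'X_{1..N} :=
  (U_(mxvec_index (Ordinal (idx k)) (Ordinal (idx k))) *+ k.+1)%MM.
have minj (k l : 'I_n) : k != l -> mxvec_index (Ordinal (idx k)) (Ordinal (idx k)) !=
    mxvec_index (Ordinal (idx l)) (Ordinal (idx l)).
  apply: contraNneq => /(congr1 (@vpair n)); rewrite !vpair_mxvec => -[e _].
  by apply/eqP/val_inj/eqP; rewrite -eqSS -(eqn_sub2lE (ltn_ord k) (ltn_ord l)) e.
have h : exact2 ('X_[mu_mnm] : P) (mono_col C m).
  apply: exact2_monomials => [i j ij u|i u].
    rewrite /m !mulmnE !mnm1E; have [<-|_] := eqVneq (mxvec_index (Ordinal (idx i)) (Ordinal (idx i))) u.
      by right; rewrite eq_sym (negPf (minj _ _ ij)).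
    by left.
  rewrite /m mulmnE mnm1E; have [<-|_] := eqVneq (mxvec_index (Ordinal (idx i)) (Ordinal (idx i))) u; last by right.
  by left; apply: mu_mnm_diag.
apply: (exact2_top s1 s2 (e := fun k => (k.+1 * (n - k))%N) (e0 := 0%N)) h.
  move=> k; rewrite !mxE.
  have sd (i : nat) : (i < n)%N -> sigma2 (diag_entry i) = diag_entry i *: 'X^(i.+1).
    move=> hi; rewrite (diag_entryE (Ordinal hi)) generic_mxE wsubXU /weight2 vpair_mxvec.
    by rewrite eqxx.
  have := csym_top sd k.+1 (leq_subr k n).
  rewrite -(subnSK (ltn_ord k)) (diag_entryE (Ordinal (idx k))) generic_mxE.
  by rewrite -mpolyXn.
rewrite [X in ptop _ X](@wsubX C N weight2 mu_mnm) (_ : wdeg _ _ = 0%N); first exact: ptop_Xn.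
rewrite /wdeg big1 // => k _; rewrite /weight2.
case ek : (vpair k) => [i j]; case: eqP => // ij; move: ek; rewrite -ij => ek.
by rewrite -[k]vpairK ek mu_mnm_diag muln0.
Qed.

Hypothesis C0 : [pchar C] =i pred0.

Lemma natr_unit k : k.+1%:R \is a @GRing.unit P.
Proof.
rewrite -(rmorph_nat (@mpolyC N C)); apply: rmorph_unit.
by rewrite unitfE (iffLR (pcharf0P C) C0).
Qed.

(** The first grading leads from the traces to the power sums of the diagonal
    entries, the second from symmetric functions to powers of single entries. *)
Lemma exact2_trace : exact2 (\det krylov) trace_col.
Proof.
have s1 := @wsub_horner C N weight1; have s2 := @wsub_hom C N weight1.
apply: (exact2_top s1 s2 (t := \col_(k < n) psum diag_entry n k.+1) _ top_det_krylov).
  by move=> k; rewrite [X in ptop _ _ X]mxE; apply: top_trace.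
by apply: exact2_psum; [exact: natr_unit|exact: exact2_csym].
Qed.
End GenericMatrix.

(** * The ideal of the nilpotent cone *)
Section Newton.
Variables (R : comNzRingType) (n : nat) (A : 'M[R]_n).
Local Notation chi := (char_poly A).

Lemma deriv_prod (J : eqType) (t : seq J) (G : J -> {poly R}) :
  uniq t -> (\prod_(i <- t) G i)^`() = \sum_(i <- t) (G i)^`() * \prod_(k <- t | k != i) G k.
Proof.
elim: t => [|j t ih] /=; first by rewrite !big_nil derivC.
case/andP=> jt ut; rewrite big_cons derivM ih // big_cons big_cons eqxx /=; congr (_ * _ + _).
  rewrite big_seq [RHS]big_seq_cond; apply: eq_bigl => k; case kt: (k \in t) => //=.
  by apply/esym; apply: contraNneq jt => <-.
rewrite mulr_sumr; apply: eq_big_seq => k kt.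
rewrite big_cons ifT; first by rewrite mulrCA.
by apply: contraNneq jt => ->.
Qed.

(** Differentiating the row i of the characteristic matrix leaves the cofactor of
    its diagonal entry. *)
Lemma deriv_char_poly : chi^`() = \tr (\adj (char_poly_mx A)).
Proof.
set M := char_poly_mx A.
have dM i j : (M i j)^`() = (i == j)%:R.
  by rewrite !mxE derivB derivC subr0 derivMn derivX.
rewrite /char_poly -/M /determinant raddf_sum /=.
have step (s : 'S_n) : ((-1) ^+ s * \prod_i M i (s i))^`() =
    \sum_i ((-1) ^+ s * \prod_(k | k != i) M k (s k)) *+ (s i == i).
  have -> : (-1) ^+ s = ((-1) ^+ s)%:P :> {poly R} by rewrite rmorphXn rmorphN rmorph1.
  rewrite derivM derivC mul0r add0r (deriv_prod _ (index_enum_uniq _)) // mulr_sumr.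
  by apply: eq_bigr => i _; rewrite dM eq_sym; case: eqP => _; rewrite ?mul1r ?mul0r ?mulr0.
under eq_bigr => s _ do rewrite step.
rewrite exchange_big /=; apply: eq_bigr => i _.
rewrite mxE expand_cofactor [RHS]big_mkcond /=; apply: eq_bigr => s _.
by case: (s i == i); rewrite ?mulr0n // mulr1n; congr (_ * _); apply: eq_bigl => k; rewrite eq_sym.
Qed.

(** The coefficients of the adjugate of the characteristic matrix, by Horner's
    recursion; the recursion ending in 0 gives both Newton's identities and the
    Cayley-Hamilton relation. *)
Definition adj_coef (i : nat) : 'M[R]_n :=
  \matrix_(a, b) ('X * \adj (char_poly_mx A) a b)`_i.

Lemma adj_coef0 : adj_coef 0 = 0.
Proof. by apply/matrixP => a b; rewrite !mxE coefXM. Qed.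
Lemma adj_coef_rec i : adj_coef i = (chi`_i)%:M + A *m adj_coef i.+1.
Proof.
apply/matrixP => a b; pose Q := \adj (char_poly_mx A).
have e : ('X * Q a b - (map_mx polyC A *m Q) a b)`_i = (chi *+ (a == b))`_i.
  have -> : 'X * Q a b - (map_mx polyC A *m Q) a b = (char_poly_mx A *m Q) a b.
    by rewrite mulmxBl mul_scalar_mx [RHS]mxE [X in _ = X + _]mxE [X in _ = _ + X]mxE.
  by rewrite mul_mx_adj mxE.
move/eqP: e; rewrite coefB subr_eq coefMn => /eqP e.
rewrite mxE e [RHS]mxE [X in _ = X + _]mxE; congr (_ + _).
rewrite mxE coef_sum [RHS]mxE; apply: eq_bigr => c _.
by rewrite mxE coefCM [X in _ = _ * X]mxE coefXM.
Qed.

Lemma adj_coef_expand k i :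
  adj_coef i = \sum_(j < k) chi`_(i + j) *: A ^+ j + A ^+ k *m adj_coef (i + k).
Proof.
elim: k => [|k ih]; first by rewrite big_ord0 add0r addn0 expr0 mul1mx.
rewrite ih big_ord_recr /= -addrA; congr (_ + _).
rewrite adj_coef_rec mulmxDr mul_mx_scalar addnS exprSr mulmxA.
by [].
Qed.

Lemma adj_coef_sum : exists M, (n < M)%N /\
  forall i, adj_coef i = \sum_(j < M) chi`_(i + j) *: A ^+ j.
Proof.
pose sz a b := size ('X * \adj (char_poly_mx A) a b).
pose M := (n + (\max_a \max_b sz a b).+1)%N.
exists M; split; first by rewrite /M -addSnnS leq_addr.
move=> i; rewrite (adj_coef_expand M) [X in _ + A ^+ M *m X](_ : _ = 0) ?mulmx0 ?addr0 //.
apply/matrixP => a b; rewrite mxE [RHS]mxE nth_default //.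
apply: leq_trans (leq_addl _ _); apply: leq_trans (leq_addl _ _); apply: leqW.
exact: leq_trans (leq_bigmax (F := sz a) b) (leq_bigmax (F := fun a => \max_b sz a b)%N a).
Qed.

Lemma adj_coef_trace i : \tr (adj_coef i) = chi`_i *+ i.
Proof.
transitivity (('X * chi^`())`_i).
  rewrite deriv_char_poly mulr_sumr coef_sum; apply: eq_bigr => a _.
  by rewrite mxE.
by rewrite coefXM; case: i => [|i] //=; rewrite ?mulr0n // coef_deriv.
Qed.
End Newton.

Section VanishingPolynomials.
Variables (C : fieldType) (N : nat).
Local Notation P := {mpoly C[N]}.

Lemma digits_inj (D k : nat) (a b : nat -> nat) :
  (forall i, (i < k)%N -> (a i < D)%N) -> (forall i, (i < k)%N -> (b i < D)%N) ->
  (\sum_(i < k) D ^ i * a i = \sum_(i < k) D ^ i * b i)%N ->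
  forall i, (i < k)%N -> a i = b i.
Proof.
elim: k a b => // k ih a b ha hb.
have shift (c : nat -> nat) : (\sum_(i < k.+1) D ^ i * c i = c 0 + (\sum_(i < k) D ^ i * c i.+1) * D)%N.
  rewrite big_ord_recl /= expn0 mul1n big_distrl /=; congr (_ + _)%N.
  by apply: eq_bigr => i _; rewrite /bump /= add1n expnS -mulnA mulnC.
rewrite !shift => e.
have D0 : (0 < D)%N by apply: leq_ltn_trans (ha 0%N _).
have e0 : a 0%N = b 0%N.
  have := congr1 (fun x => x %% D)%N e; rewrite /= !(addnC (_ 0%N)) !modnMDl.
  by rewrite !modn_small ?ha ?hb.
case=> // i ik; apply: (ih (fun i => a i.+1) (fun i => b i.+1)) => // [j|j|].
- exact: (ha j.+1).
- exact: (hb j.+1).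
by move/eqP: e; rewrite e0 eqn_add2l eqn_pmul2r // => /eqP.
Qed.

Lemma poly_vanish (Q : {poly C}) : [pchar C] =i pred0 -> (forall t, Q.[t] = 0) -> Q = 0.
Proof.
move=> C0 hQ; apply: (@roots_geq_poly_eq0 _ _ [seq k%:R | k <- iota 0 (size Q)]).
- by apply/allP => t _; apply/eqP/hQ.
- rewrite map_inj_uniq ?iota_uniq // => k l /eqP.
  wlog kl : k l / (k <= l)%N.
    by move=> wl e; case: (leqP k l) => h; [apply: wl|apply/esym/wl; rewrite 1?eq_sym // ltnW].
  rewrite eq_sym -subr_eq0 -natrB // (iffLR (pcharf0P C) C0) subn_eq0 => lk.
  by apply/eqP; rewrite eqn_leq kl.
- by rewrite size_map size_iota.
Qed.

(** Kronecker's substitution of powers of one variable reduces the vanishing of a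
    polynomial to one variable. *)
Lemma mpoly_vanish (p : P) : [pchar C] =i pred0 -> (forall v : 'I_N -> C, p.@[v] = 0) -> p = 0.
Proof.
move=> C0 hp; pose D := msize p; pose wt (m : 'X_{1..N}) := (\sum_(k < N) D ^ k * m k)%N.
pose Q : {poly C} := \sum_(m <- msupp p) p@_m *: 'X^(wt m).
have Q0 : Q = 0.
  apply: poly_vanish => // t; rewrite -[RHS](hp (fun k => t ^+ (D ^ k))) mevalE horner_sum.
  apply: eq_bigr => m _; rewrite hornerZ hornerXn /wt expr_sum; congr (_ * _).
  by apply: eq_bigr => k _; rewrite exprM.
apply/mpolyP => m; rewrite mcoeff0; apply/eqP.
rewrite mcoeff_eq0; apply/negP => hm.
have small m' : m' \in msupp p -> forall k, (m' k < D)%N.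
  move=> hm' k; apply: leq_trans (msize_mdeg_lt hm'); rewrite ltnS mdegE.
  by rewrite (bigD1 k) //= leq_addr.
have inj m' : m' \in msupp p -> wt m' = wt m -> m' = m.
  move=> hm' e; apply/mnmP => k.
  pose f (u : 'X_{1..N}) i := if insub i is Some j then u j else 0%N.
  have fE (u : 'X_{1..N}) (j : 'I_N) : f u j = u j by rewrite /f valK.
  have := @digits_inj D N (f m') (f m).
  have fs (u : 'X_{1..N}) : u \in msupp p -> forall i, (i < N)%N -> (f u i < D)%N.
    by move=> hu i hi; rewrite (fE u (Ordinal hi)) small.
  move/(_ (fs _ hm') (fs _ hm)).
  have wE (u : 'X_{1..N}) : (\sum_(i < N) D ^ i * f u i)%N = wt u.
    by apply: eq_bigr => i _; rewrite fE.
  by rewrite !wE => /(_ e k (ltn_ord k)); rewrite !fE.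
have : Q`_(wt m) = p@_m.
  rewrite coef_sum (bigD1_seq m) //= ?msupp_uniq // coefZ coefXn eqxx mulr1.
  rewrite big_seq_cond big1 ?addr0 // => m' /andP[hm' m'm].
  rewrite coefZ coefXn; case: eqP => [/esym/(inj _ hm') e|_]; last by rewrite mulr0.
  by rewrite e eqxx in m'm.
by rewrite Q0 coef0 => /esym /eqP; rewrite mcoeff_eq0 hm.
Qed.
End VanishingPolynomials.

Section Kostant.
Variables (C : fieldType) (n' : nat).
Local Notation n := n'.+1.
Local Notation N := (n * n)%N.
Local Notation P := {mpoly C[N]}.
Local Notation X := (generic_mx C n).
Local Notation K := (krylov C n').
Local Notation z := (trace_col C n').
Hypothesis C0 : [pchar C] =i pred0.

Lemma in_idealN r (g : 'cV[P]_r) p : in_ideal g p -> in_ideal g (- p).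
Proof. by rewrite -mulN1r; apply: in_idealM. Qed.
Lemma in_idealMr r (g : 'cV[P]_r) p s : in_ideal g p -> in_ideal g (p * s).
Proof. by rewrite mulrC; apply: in_idealM. Qed.

Lemma in_ideal_trace j : (0 < j <= n)%N -> in_ideal z (\tr (X ^+ j)).
Proof.
case: j => // j /= jn; have := in_ideal_gen z (Ordinal jn).
by rewrite mxE.
Qed.

Lemma char_coef_big (j : nat) : (n < j)%N -> (char_poly X)`_j = 0.
Proof. by move=> nj; rewrite nth_default // size_char_poly. Qed.

(** Newton's identities give n - i times this coefficient as a combination of the
    traces. *)
Lemma char_coef_ideal (i : nat) : (i < n)%N -> in_ideal z (char_poly X)`_i.
Proof.
move=> ilt; have [M [nM e]] := adj_coef_sum X.
have := adj_coef_trace X i; rewrite e raddf_sum /=.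
case: M nM {e} => // M nM; rewrite big_ord_recl /= addn0 linearZ /= expr0 mxtrace1.
move=> e; have u : (n - i)%:R \is a @GRing.unit P.
  by case: (n - i)%N (subn_gt0 i n) => [|k _]; [rewrite ilt|exact: natr_unit].
suff h : in_ideal z ((n - i)%:R * (char_poly X)`_i).
  by rewrite -[(char_poly X)`_i](mulKr u); apply: in_idealM.
have -> : (n - i)%:R * (char_poly X)`_i = - \sum_(j < M) \tr ((char_poly X)`_(i + bump 0 j) *: X ^+ bump 0 j).
  rewrite natrB ?(ltnW ilt) // mulrBl [n%:R * _]mulrC [i%:R * _]mulr_natl -e.
  by rewrite opprD addrA subrr add0r.
apply/in_idealN/in_ideal_sum => j _; rewrite linearZ /=.
have [jn|jn] := leqP (bump 0 j) n; first by apply/in_idealM/in_ideal_trace.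
rewrite char_coef_big; last by apply: leq_trans jn _; rewrite leq_addl.
by rewrite mul0r; apply: in_ideal0.
Qed.

(** Cayley-Hamilton, with all coefficients but the leading one in the ideal. *)
Lemma power_ideal a b : in_ideal z ((X ^+ n) a b).
Proof.
have [M [nM /(_ 0%N)]] := adj_coef_sum X; rewrite adj_coef0 => /matrixP /(_ a b).
rewrite mxE summxE (bigD1 (Ordinal nM)) //= add0n !mxE.
have -> : (char_poly X)`_n = 1.
  by have := char_poly_monic X; rewrite monicE /lead_coef size_char_poly => /eqP.
rewrite mul1r => /eqP; rewrite eq_sym addr_eq0 => /eqP ->.
apply/in_idealN/in_ideal_sum => j jn; rewrite mxE; apply: in_idealMr.
have [lt|gt|e] := ltngtP (j : nat) n; first exact: char_coef_ideal.
  by rewrite char_coef_big //; apply: in_ideal0.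
by case/eqP: jn; apply: val_inj.
Qed.

Definition jordan (R : pzRingType) : 'M[R]_n := \matrix_(i, k) (i == k.+1 :> nat)%:R.

Lemma jordan_power (R : pzRingType) m :
  jordan R ^+ m = \matrix_(i, k) (i == (k + m)%N :> nat)%:R.
Proof.
elim: m => [|m ih]; first by apply/matrixP => i k; rewrite expr0 !mxE addn0.
apply/matrixP => i k; rewrite exprS ih mxE.
under eq_bigr => l _ do rewrite !mxE.
have [km|km] := ltnP (k + m) n.
  rewrite (bigD1 (Ordinal km)) //= eqxx mulr1 big1 ?addr0 ?mxE ?addnS // => l lk.
  by rewrite [(l : nat) == _](_ : _ = false) ?mulr0 //; apply/negbTE.
rewrite mxE big1 => [|l _].
  by rewrite ltn_eqF // (leq_trans (ltn_ord i)) // (leq_trans km) // addnS.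
by rewrite [(l : nat) == _]ltn_eqF ?mulr0 // (leq_trans (ltn_ord l)).
Qed.

Lemma jordan_nilpotent (R : pzRingType) : jordan R ^+ n = 0.
Proof.
by apply/matrixP => i k; rewrite jordan_power !mxE ltn_eqF // ltn_addl.
Qed.

(** The characteristic polynomial divides a power of the variable. *)
Lemma trace_nilpotent m (y : 'M[C]_n) : y ^+ m = 0 -> \tr y = 0.
Proof.
move=> y0.
have [k ek] : exists k, char_poly y %| 'X^k.
  exists (m * n)%N.
  have : \det (char_poly_mx y * \sum_(i < m) 'X%:M ^+ (m.-1 - i) * (map_mx polyC y) ^+ i) = 'X^(m * n).
    have cm : GRing.comm ('X%:M : 'M[{poly C}]_n) (map_mx polyC y).
      exact/esym/scalar_mxC.
    have := subrXX_comm m cm.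
    have -> : (map_mx polyC y) ^+ m = 0 by rewrite -rmorphXn y0 rmorph0.
    rewrite subr0 => <-.
    by rewrite -rmorphXn /= det_scalar -exprM.
  rewrite det_mulmx => <-; exact: dvdp_mulr.
have : char_poly y %= 'X^n.
  have : char_poly y %| ('X - 0%:P) ^+ k by rewrite subr0.
  move/dvdp_exp_XsubCP => [l _]; rewrite subr0 => e.
  have el : l = n by have := eqp_size e; rewrite size_char_poly size_polyXn => -[<-].
  by rewrite el in e.
rewrite eqp_monic ?char_poly_monic ?monicXn // => /eqP e.
have := char_poly_trace y (ltn0Sn n'); rewrite e coefXn /= ltn_eqF // => /esym/eqP.
by rewrite oppr_eq0 => /eqP.
Qed.

Lemma mx_eval_generic (x : 'M[C]_n) : map_mx (mx_eval x) X = x.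
Proof. by apply/matrixP => i j; rewrite !mxE mx_evalX. Qed.

Lemma mx_eval_trace (x : 'M[C]_n) k : mx_eval x (\tr (X ^+ k)) = \tr (x ^+ k).
Proof.
rewrite /mx_eval -trace_map_mx rmorphXn /=.
by rewrite -[map_mx _ X]/(map_mx (mx_eval x) X) mx_eval_generic.
Qed.

Lemma trace_vanish (x : 'M[C]_n) k : nilpotent_set x -> mx_eval x (\tr (X ^+ k.+1)) = 0.
Proof.
case=> m xm; rewrite mx_eval_trace; apply: (@trace_nilpotent m).
by rewrite -exprM mulnC exprM xm expr0n.
Qed.

Lemma krylov_det_neq0 : \det K != 0.
Proof.
have [_ e] := top_det_krylov C n'; apply/eqP => K0.
move: e; rewrite K0 rmorph0 coef0 => /(congr1 (mcoeff (mu_mnm n'))).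
by rewrite mcoeff0 mcoeffX eqxx => /eqP; rewrite eq_sym oner_eq0.
Qed.

(** On the basis of the Krylov vectors the generic matrix acts, modulo the traces,
    as a nilpotent Jordan block. *)
Lemma krylov_conj a b :
  in_ideal z (\det K * X a b - (K *m jordan P *m \adj K) a b).
Proof.
have e : \det K *: X = X *m K *m \adj K by rewrite -mulmxA mul_mx_adj mul_mx_scalar.
have -> : \det K * X a b = (\det K *: X) a b by rewrite [RHS]mxE.
have -> : (\det K *: X) a b - (K *m jordan P *m \adj K) a b = ((X *m K - K *m jordan P) *m \adj K) a b.
  by rewrite e mulmxBl [RHS]mxE [X in _ = _ + X]mxE.
rewrite mxE; apply: in_ideal_sum => c _; apply: in_idealMr.
have -> : (X *m K - K *m jordan P) a c =
   (X ^+ c.+1) a ord0 - (X ^+ c.+1) a ord0 *+ (c.+1 < n)%N.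
  rewrite mxE [X in _ + X]mxE; congr (_ - _).
    by rewrite exprS !mxE; apply: eq_bigr => l _; rewrite !mxE.
  rewrite mxE; have [cn|cn] := ltnP c.+1 n.
    rewrite (bigD1 (Ordinal cn)) //= !mxE eqxx mulr1 big1 ?addr0 // => l lc.
    by rewrite !mxE [(l : nat) == _](_ : _ = false) ?mulr0 //; apply/negbTE.
  rewrite big1 // => l _; rewrite !mxE [(l : nat) == _]ltn_eqF ?mulr0 //.
  exact: leq_trans (ltn_ord l) cn.
case: ltnP => cn; first by rewrite mulr1n subrr; apply: in_ideal0.
rewrite mulr0n subr0; have -> : c.+1 = n by apply/eqP; rewrite eqn_leq cn ltn_ord.
exact: power_ideal.
Qed.

Lemma cong_prod (I : Type) (s : seq I) (F G : I -> P) :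
  (forall i, in_ideal z (F i - G i)) ->
  in_ideal z (\prod_(i <- s) F i - \prod_(i <- s) G i).
Proof.
move=> h; elim: s => [|i s ih]; first by rewrite !big_nil subrr; apply: in_ideal0.
rewrite !big_cons; set f := \prod_(_ <- _) F _; set g := \prod_(_ <- _) G _.
have -> : F i * f - G i * g = (F i - G i) * f + G i * (f - g).
  by rewrite mulrBl mulrBr addrA subrK.
by apply: in_idealD; [apply: in_idealMr|apply: in_idealM].
Qed.
Lemma cong_exp (f g : P) k : in_ideal z (f - g) -> in_ideal z (f ^+ k - g ^+ k).
Proof. by move=> h; rewrite subrXX; apply: in_idealMr. Qed.

(** Where the Krylov vectors form a basis, the conjugate of the Jordan block by them
    is nilpotent, so p vanishes there. Clearing denominators, some power of the
    Krylov determinant multiplies p into the ideal of the traces; this determinant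
    is regular modulo the ideal. *)
Theorem nilpotent_ideal (p : P) :
  (forall x, nilpotent_set x -> mx_eval x p = 0) -> in_ideal z p.
Proof.
move=> hp; pose f := \det K; pose M := K *m jordan P *m \adj K.
pose Mk (k : 'I_N) := M (vpair k).1 (vpair k).2.
pose kap := msize p.
pose H := \sum_(m <- msupp p) p@_m *: (f ^+ (kap - mdeg m) * \prod_k Mk k ^+ m k).
have degm m : m \in msupp p -> (mdeg m <= kap)%N.
  by move/msize_mdeg_lt/ltnW.
have H0 : H = 0.
  suff : f * H = 0 by move/eqP; rewrite mulf_eq0 (negPf krylov_det_neq0) => /eqP.
  apply: mpoly_vanish => // v.
  pose x : 'M[C]_n := vec_mx (\row_k v k).
  pose ex := meval v : P -> C.
  rewrite mevalM; pose y := map_mx (meval v) K.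
  have fy : meval v f = \det y by rewrite /f -det_map_mx.
  have [dy|dy] := eqVneq (\det y) 0; first by rewrite fy dy mul0r.
  have uy : y \in unitmx by rewrite unitmxE unitfE.
  pose u := y *m jordan C *m invmx y.
  have eM : map_mx (meval v) M = \det y *: u.
    rewrite /M !map_mxM map_mx_adj -/y /u.
    have -> : map_mx (meval v) (jordan P) = jordan C.
      by apply/matrixP => i j; rewrite !mxE rmorph_nat.
    by rewrite /invmx uy -scalemxAr scalerA mulfV // scale1r.
  have nil_u : nilpotent_set u.
    exists n; suff hu m : u ^+ m = y *m jordan C ^+ m *m invmx y.
      by rewrite hu jordan_nilpotent mulmx0 mul0mx.
    elim: m => [|m ih]; first by rewrite !expr0 mulmx1 mulmxV.
    rewrite exprS ih /u -mulmxE !mulmxA (mulmxKV uy) exprS -mulmxE !mulmxA //.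
  suff -> : meval v H = (\det y) ^+ kap * mx_eval u p by rewrite hp // mulr0 mulr0.
  rewrite /H raddf_sum /mx_eval [X in _ = _ * X]mevalE mulr_sumr big_seq [RHS]big_seq.
  apply: eq_bigr => m hm; rewrite /= mevalZ mevalM [RHS]mulrCA; congr (_ * _).
  rewrite [X in X * _](rmorphXn (meval v)) /= fy [X in _ * X](rmorph_prod (meval v)) -[in RHS](subnK (degm m hm)) exprD -mulrA; congr (_ * _).
  rewrite mdegE expr_sum -big_split /=; apply: eq_bigr => k _.
  rewrite rmorphXn -exprMn mxvec_vpair /Mk; congr (_ ^+ _).
  by have /matrixP /(_ (vpair k).1 (vpair k).2) := eM; rewrite !mxE.
have fkp : in_ideal z (f ^+ kap * p).
  rewrite -[f ^+ kap * p]subr0 -H0 {1}[p]mpolyE mulr_sumr -sumrB big_seq.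
  apply: in_ideal_sum => m hm; rewrite -scalerAr -scalerBr -mul_mpolyC; apply: in_idealM.
  rewrite -(subnK (degm m hm)) exprD -mulrA addnK -mulrBr; apply: in_idealM.
  rewrite mdegE expr_sum mpolyXE_id -big_split /=; apply: cong_prod => k.
  rewrite -exprMn; apply: cong_exp; rewrite /Mk -{1}[k]vpairK -generic_mxE.
  exact: krylov_conj.
have [_ hf] := exact2_trace n' C0.
elim: kap fkp {H H0 degm} => [|k ih]; first by rewrite expr0 mul1r.
by rewrite exprS -mulrA => /(exact_cons_nzd hf)/ih.
Qed.
End Kostant.

(** * Degree truncation of polynomials *)
Section Truncation.
Variables (C : fieldType) (N : nat).
Local Notation P := {mpoly C[N]}.
Local Notation grade := (@wsub C N (fun=> 1%N)).

Definition trunc (d : nat) (p : P) : P := \sum_(0 <= j < d) (grade p)`_j.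

Lemma trunc_coef d p m : (trunc d p)@_m = p@_m *+ (mdeg m < d)%N.
Proof.
have c j : ((grade p)`_j)@_m = p@_m *+ (mdeg m == j).
  rewrite wsub_coef raddf_sum /=.
  have wd m' : @wdeg N (fun=> 1%N) m' = mdeg m'.
    by rewrite mdegE; apply: eq_bigr => k _; rewrite mul1n.
  transitivity (\sum_(m' <- msupp p) (p@_m' * (m' == m)%:R) *+ (mdeg m == j)).
    apply: eq_bigr => m' _; rewrite raddfMn /= mcoeffZ mcoeffX wd.
    by case: (eqVneq m' m) => [->|_] //; rewrite mulr0 !mul0rn.
  rewrite sumrMnl; congr (_ *+ _); rewrite [in RHS](mpolyE p) raddf_sum.
  by apply: eq_bigr => m' _; rewrite /= mcoeffZ mcoeffX.
rewrite raddf_sum /=; under eq_bigr => j _ do rewrite c.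
elim: d => [|d ih]; first by rewrite big_nil ltn0.
rewrite big_nat_recr //= ih ltnS.
by case: (ltngtP (mdeg m) d) => _; rewrite /= ?mulr0n ?addr0 ?add0r.
Qed.

Lemma trunc_sum d (I : Type) (r : seq I) (F : I -> P) :
  trunc d (\sum_(i <- r) F i) = \sum_(i <- r) trunc d (F i).
Proof.
apply/mpolyP => m; rewrite trunc_coef !raddf_sum -sumrMnl.
by apply: eq_bigr => i _; exact/esym/trunc_coef.
Qed.

Lemma trunc_msize d p : (msize (trunc d p) <= d)%N.
Proof.
rewrite msizeE; apply/bigmax_leqP_seq => m; rewrite mcoeff_msupp trunc_coef => + _.
by case: ltnP => //; rewrite mulr0n eqxx.
Qed.

Lemma trunc_id d p : (msize p <= d)%N -> trunc d p = p.
Proof.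
move=> hp; apply/mpolyP => m; rewrite trunc_coef; case: ltnP => //= dm.
rewrite mulr0n; apply/esym/eqP; rewrite mcoeff_eq0.
exact/msize_mdeg_ge/(leq_trans hp).
Qed.

Lemma trunc_hom d e p z : grade z = z *: 'X^e -> trunc d (p * z) = trunc (d - e) p * z.
Proof.
move=> hz; rewrite /trunc mulr_suml.
have c j : (grade (p * z))`_j = (if (j < e)%N then 0 else (grade p)`_(j - e)) * z.
  rewrite rmorphM -[X in _ * X]/(grade z) hz -scalerAr coefZ coefMXn mulrC.
  by [].
under eq_bigr => j _ do rewrite c.
have [de|ed] := leqP d e.
  rewrite (eqP de) [RHS]big_geq // big_nat big1 // => j /= jd.
  by rewrite (leq_trans jd de) mul0r.
rewrite (big_cat_nat (n := e)) ?(ltnW ed) //= big_nat big1 ?add0r.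
  rewrite -{1}[e]add0n big_addn; apply: eq_bigr => j _.
  by rewrite addnK ltnNge leq_addl.
by move=> j /= ->; rewrite mul0r.
Qed.
End Truncation.

Section LinearCombinations.
Variables (C : fieldType) (V : lmodType (Kq C)) (S : V -> Prop).
Local Notation K := (Kq C).
Lemma sum_widen_seq (s u : seq V) (c : V -> K) : uniq s -> uniq u -> {subset s <= u} ->
  \sum_(x <- s) c x *: x = \sum_(x <- u) (if x \in s then c x else 0) *: x.
Proof.
move=> us uu su.
transitivity (\sum_(x <- u | x \in s) c x *: x).
  rewrite -[RHS]big_filter; apply: perm_big; apply: uniq_perm => //.
    exact: filter_uniq.
  by move=> x; rewrite mem_filter; case xs: (x \in s); rewrite //= su.
rewrite big_mkcond; apply: eq_bigr => x _.
by case: (x \in s); rewrite // scale0r.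
Qed.

Lemma Span_spans v : Span S v -> exists (s : seq V) (c : V -> K),
  [/\ uniq s, forall x, x \in s -> S x & v = \sum_(x <- s) c x *: x].
Proof.
elim=> [|x y _ [s [c [us hs ->]]] _ [t [d [ut ht ->]]]|k x hx].
- by exists [::], (fun=> 0); rewrite big_nil.
- pose u := undup (s ++ t); have uu : uniq u := undup_uniq _.
  exists u, (fun x => (if x \in s then c x else 0) + (if x \in t then d x else 0)); split=> //.
    by move=> w; rewrite mem_undup mem_cat => /orP[/hs|/ht].
  have su : {subset s <= u} by move=> w ws; rewrite mem_undup mem_cat ws.
  have tu : {subset t <= u} by move=> w ws; rewrite mem_undup mem_cat ws orbT.
  rewrite (sum_widen_seq _ us uu su) (sum_widen_seq _ ut uu tu) -big_split /=.
  by apply: eq_bigr => w _; rewrite scalerDl.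
- by exists [:: x], (fun=> k); rewrite big_seq1; split=> // w; rewrite inE => /eqP->.
Qed.
End LinearCombinations.

(** * Algebras deforming a polynomial ring, and their central quotients *)
Section Deformation.
Variables (C : fieldType) (N : nat) (L : pzAlg (Kq C)) (l : 'I_N -> L).
Local Notation K := (Kq C).
Local Notation ev := (@kq_ev1 C).
Local Notation h := (kq_h C).
Local Notation V := (words_le l).
Local Notation hV := (words_h l).
Local Notation P := {mpoly C[N]}.
Local Notation PA := (alg_pzAlg P).
Local Notation evR := [the {rmorphism K -> C} of ev].
Local Notation W := (mono_val l).

Hypothesis l_swap : forall i j, hV 2 (l i * l j - l j * l i).
Variable f : L -> PA.
Hypotheses (hf : semialg_morphism evR f) (fl : forall k, f (l k) = ('X_k : P)).

Lemma classical_mono m : f (W m) = ('X_[m] : P).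
Proof.
rewrite /mono_val /word_val (sam_prod hf).
transitivity (\prod_(k <- mono_word m) ('X_k : P)).
  by apply: eq_bigr => k _; exact: fl.
rewrite mpolyXE_id /mono_word big_flatten big_map big_enum /=.
by apply: eq_bigr => k _; rewrite big_nseq_cond /= iter_mulr_1.
Qed.

Lemma classical_sum (I : Type) (r : seq I) (m : I -> 'X_{1..N}) (c : I -> K) :
  f (\sum_(i <- r) c i *: W (m i)) = (\sum_(i <- r) ev (c i) *: 'X_[m i] : P).
Proof.
rewrite (sam_sum hf); apply: eq_bigr => i _.
by rewrite (samZ hf) classical_mono.
Qed.

(** An element of filtration degree d with zero classical limit is divisible by
    q - 1 within the same degree. *)
Lemma classical_kernel d x : V d x -> f x = 0 -> hV d x.
Proof.
move=> /(pbw_span l_swap) Vx.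
have [c ->] : exists c : 'X_{1..N < d.+1} -> K, x = \sum_m c m *: W m.
  apply: Span_fin; apply: Span_sub Vx => z [m [hm ->]]; apply: SpanG.
  have hm' : (mdeg m < d.+1)%N by []; by exists (BMultinom hm').
rewrite classical_sum => e.
apply: words_h_sum => m _.
have [|y ->] := @ev_eq0P C (c m).
  have := congr1 (mcoeff m) e; rewrite mcoeff0 raddf_sum (bigD1 m) //= big1.
    by rewrite addr0 mcoeffZ mcoeffX eqxx mulr1.
  move=> m' m'm; rewrite mcoeffZ mcoeffX (_ : (m' : 'X_{1..N}) == m = false) ?mulr0 //.
  by apply/negbTE.
rewrite -scalerA; exists (y *: W m); split=> //; apply: SpanZs; apply: words_le_word.
by rewrite size_mono_word -ltnS bmdeg.
Qed.

Lemma classical_lift (p : P) d : (msize p <= d.+1)%N -> exists2 x, V d x & f x = p.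
Proof.
move=> szp; have /boolp.choice [k hk] : forall m : 'X_{1..N}, exists k : K, ev k = p@_m.
  by move=> m; apply: ev_surj.
exists (\sum_(m <- msupp p) k m *: W m).
  rewrite big_seq; apply: Span_sum => m hm; apply: SpanZs; apply: words_le_word.
  by rewrite size_mono_word -ltnS; apply: leq_trans szp; apply: msize_mdeg_lt.
rewrite classical_sum [RHS]mpolyE; apply: eq_bigr => m _.
by rewrite hk.
Qed.

Lemma classical_surj (p : P) : exists x, f x = p.
Proof. by have [|x _ <-] := @classical_lift p (msize p); [exact: leqW|exists x]. Qed.

Hypothesis L_words : forall x, exists d, V d x.
Hypothesis L_torsion_free : forall x : L, h *: x = 0 -> x = 0.

Lemma classical_kernel_h x : f x = 0 -> exists y, x = h *: y.
Proof.
have [d Vx] := L_words x => /(classical_kernel Vx)[y [_ ->]].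
by exists y.
Qed.

Variables (r : nat) (Z : 'I_r -> L) (z : 'cV[P]_r) (e : 'I_r -> nat).
Hypothesis Z_central : forall k x, x * Z k = Z k * x.
Hypothesis fZ : forall k, f (Z k) = z k 0.
Hypothesis Z_words : forall k, V (e k) (Z k).
Hypothesis z_hom : forall k, wsub (fun=> 1%N) (z k 0) = z k 0 *: 'X^(e k).
Hypothesis z_exact : exact z.

Variables (F : pzAlg K) (pi : L -> F).
Hypotheses (hpi : alg_morphism pi) (pi_surj : forall y, exists x, y = pi x).
Hypothesis pi_ker : forall x, pi x = 0 <-> exists a : 'I_r -> L, x = \sum_k a k * Z k.

(** A relation between the classical limits of the central elements is trivial, so
    it lifts to a trivial relation between the central elements themselves. *)
Lemma quotient_torsion_free (y : F) : h *: y = 0 -> y = 0.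
Proof.
have [x ->] := pi_surj y; rewrite -(samZ hpi) => /pi_ker[a ea].
have e0 : \sum_k (f (a k) : P) * z k 0 = 0.
  transitivity (f (h *: x) : P); last by rewrite (samZ hf) /= ev_h; exact: scale0r.
  rewrite ea (sam_sum hf); apply: eq_bigr => k _.
  by rewrite (samM hf) fZ.
have [D eD] := iffLR (exactP z) z_exact _ e0.
have /boolp.choice [B hB] : forall ij : 'I_r * 'I_r, exists b, f b = D ij.1 ij.2.
  by move=> ij; apply: classical_surj.
have /boolp.choice [c hc] : forall k, exists c,
    a k - \sum_j (B (k, j) - B (j, k)) * Z j = h *: c.
  move=> k; apply: classical_kernel_h.
  rewrite (samB hf) (sam_sum hf) [X in X - _](eD k); apply/eqP; rewrite subr_eq0; apply/eqP.
  by apply: eq_bigr => j _; rewrite (samM hf) (samB hf) fZ !hB.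
apply/pi_ker; exists c.
apply/eqP; rewrite -subr_eq0; apply/eqP; apply: L_torsion_free.
rewrite scalerBr ea; apply/eqP; rewrite subr_eq0; apply/eqP.
transitivity (\sum_k (h *: c k) * Z k + \sum_k (\sum_j (B (k, j) - B (j, k)) * Z j) * Z k).
  by rewrite -big_split /=; apply: eq_bigr => k _; rewrite -hc -mulrDl subrK.
rewrite scaler_sumr [X in _ + X](_ : _ = 0) ?addr0.
  by apply: eq_bigr => k _; rewrite pz_scalerAl.
transitivity (\sum_k \sum_j B (k, j) * (Z j * Z k) - \sum_k \sum_j B (j, k) * (Z k * Z j)).
  rewrite -sumrB; apply: eq_bigr => k _; rewrite mulr_suml -sumrB; apply: eq_bigr => j _.
  by rewrite -mulrA mulrBl (Z_central k (Z j)).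
by rewrite [X in _ - X]exchange_big subrr.
Qed.

Lemma quotient_kernel x : in_ideal z (f x) -> exists y, pi x = h *: y.
Proof.
move=> /in_idealP[c ec].
have /boolp.choice [a ha] : forall k, exists a, f a = c k by move=> k; apply: classical_surj.
have [|y ey] := @classical_kernel_h (x - \sum_k a k * Z k).
  rewrite (samB hf) (sam_sum hf) [X in X - _]ec; apply/eqP; rewrite subr_eq0; apply/eqP.
  by apply: eq_bigr => k _; rewrite (samM hf) fZ ha.
exists (pi y); rewrite -(samZ hpi) -ey (samB hpi) [X in _ - X](iffRL (pi_ker _)) ?subr0 //.
by exists a.
Qed.

Local Notation lF := (fun k => pi (l k)).
Local Notation WF := (mono_val lF).

Lemma pi_word s : pi (word_val l s) = word_val lF s.
Proof. by rewrite /word_val (sam_prod hpi). Qed.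
Lemma pi_words d x : V d x -> words_le lF d (pi x).
Proof.
elim=> [|u v _ hu _ hv|k u [s [hs ->]]].
- by rewrite (sam0 hpi); apply: Span0.
- by rewrite (samD hpi); apply: SpanD.
by rewrite (samZ hpi); apply: SpanZ; exists s; rewrite pi_word.
Qed.
Lemma pi_words_h d x : hV d x -> words_h lF d (pi x).
Proof. by move=> [y [hy ->]]; exists (pi y); rewrite (samZ hpi); split=> //; apply: pi_words. Qed.

Lemma quotient_swap i j : words_h lF 2 (lF i * lF j - lF j * lF i).
Proof. by rewrite -!(samM hpi) -(samB hpi); apply: pi_words_h. Qed.

(** By a theorem of Macaulay these monomials form a basis of the quotient by the
    ideal; the basis of the deformation is made of the same monomials. *)
Definition standard (m : 'X_{1..N}) : Prop :=
  forall p, in_ideal z p -> p != 0 -> mlead p != m.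

(** A leading monomial of the classical ideal can be rewritten, up to a multiple of
    q - 1 of no larger degree: truncating the coefficients of a combination of the
    homogeneous z's gives lifts that respect the filtration. *)
Lemma standard_rewrite d m : (mdeg m <= d)%N -> ~ standard m ->
  exists x y, [/\ WF m = x + y,
    Span (fun w => exists m', (m' < m)%O /\ w = WF m') x & words_h lF d y].
Proof.
move=> md nst.
have [p [Ip p0 lp]] : exists p, [/\ in_ideal z p, p != 0 & mlead p = m].
  apply: contrapT => H; apply: nst => p Ip p0; apply/negP => /eqP lp.
  by apply: H; exists p.
have szp : (msize p <= d.+1)%N by rewrite -(mlead_deg p0) lp.
pose p1 := (mleadc p)^-1 *: p.
have c0 : mleadc p != 0 by rewrite mleadc_eq0.
have I1 : in_ideal z p1 by rewrite /p1 -mul_mpolyC; apply: in_idealM.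
have sz1 : (msize p1 <= d.+1)%N by apply: leq_trans (msizeZ_le _ _) szp.
have [a ea] := iffLR (in_idealP z p1) I1.
have ea' : p1 = \sum_k trunc (d.+1 - e k) (a k) * z k 0.
  rewrite -(trunc_id sz1) {1}ea trunc_sum; apply: eq_bigr => k _.
  exact: trunc_hom.
have /boolp.choice [A hA] : forall k, exists A, V d (A * Z k) /\ f A = trunc (d.+1 - e k) (a k).
  move=> k; have [ke|ek] := ltnP d (e k).
    exists 0; rewrite mul0r; split; first exact: Span0.
    by rewrite (eqP (_ : (d.+1 - e k)%N == 0%N)) ?subn_eq0 // /trunc big_geq // (sam0 hf).
  have [|A VA fA] := @classical_lift (trunc (d.+1 - e k) (a k)) (d - e k).
    by rewrite -subSn //; apply: trunc_msize.
  exists A; split=> //; rewrite -(subnK ek); exact: words_leM.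
have /boolp.choice [c hc] : forall m' : 'X_{1..N}, exists c : K, ev c = p1@_m'.
  by move=> m'; apply: ev_surj.
have p1m : p1@_m = 1 by rewrite mcoeffZ -lp mulVf.
have hm : m \in msupp p1 by rewrite mcoeff_msupp p1m oner_eq0.
pose x0 := \sum_(m' <- rem m (msupp p1)) c m' *: W m'.
pose u := W m + x0 - \sum_k A k * Z k.
have Vu : V d u.
  apply: SpanB; last by apply: Span_sum => k _; case: (hA k).
  apply: SpanD; first by apply: words_le_word; rewrite size_mono_word.
  rewrite /x0 big_seq; apply: Span_sum => m' /mem_rem hm'; apply: SpanZs.
  apply: words_le_word; rewrite size_mono_word -ltnS.
  exact: leq_trans (msize_mdeg_lt hm') sz1.
have fu : f u = 0.
  rewrite /u (samB hf) (samD hf) classical_mono classical_sum (sam_sum hf).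
  apply/eqP; rewrite subr_eq0; apply/eqP.
  transitivity (\sum_k trunc (d.+1 - e k) (a k) * z k 0); last first.
    by apply: eq_bigr => k _; rewrite (samM hf) fZ; case: (hA k) => _ ->.
  rewrite -ea' [RHS]mpolyE (perm_big _ (perm_to_rem hm)) big_cons p1m scale1r.
  by congr (_ + _); apply: eq_bigr => m' _; rewrite hc.
have piu : pi u = WF m + pi x0.
  rewrite /u (samB hpi) (samD hpi) [X in _ - X](iffRL (pi_ker _)) ?subr0 ?pi_word //.
  by exists A.
exists (- pi x0), (pi u); split; first by rewrite piu addrC addrK.
  rewrite -scaleN1r; apply: SpanZs; rewrite /x0 big_seq (sam_sum hpi); apply: Span_sum => m' hm'.
  rewrite (samZ hpi) pi_word; apply: SpanZ; exists m'; split=> //.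
  have hm'' := mem_rem hm'.
  have le : (m' <= m)%O.
    rewrite -lp -(mleadZ p (invr_neq0 c0)); exact: msupp_le_mlead.
  rewrite Order.POrderTheory.lt_neqAle le andbT; apply: contraTneq hm' => ->.
  by rewrite mem_rem_uniqF ?msupp_uniq.
by apply/pi_words_h/classical_kernel.
Qed.

Lemma standard_spans (y : F) : Span (fun w => exists2 m, standard m & w = WF m) y.
Proof.
have [x ->] := pi_surj y; have [d Vx] := L_words x.
apply: Span_sub (standard_span quotient_swap (@standard_rewrite d) (pi_words Vx)).
by move=> w [m [sm _ ->]]; apply: SpanG; exists m.
Qed.

(** The classical limit of a relation lies in the ideal, where no leading monomial
    is standard, so all coefficients are divisible by q - 1; without torsion, the
    relation can be divided by q - 1, again and again. *)
Lemma standard_independent (s : seq 'X_{1..N}) (c : 'X_{1..N} -> K) : uniq s ->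
  (forall m, m \in s -> standard m) -> \sum_(m <- s) c m *: WF m = 0 ->
  forall m, m \in s -> c m = 0.
Proof.
move=> us st e0.
pose Q (u : 'X_{1..N} -> K) := \sum_(m <- s) u m *: WF m = 0 /\ forall m, m \notin s -> u m = 0.
pose c' m := if m \in s then c m else 0.
suff H : forall m, c' m = 0 by move=> m ms; rewrite -[RHS](H m) /c' ms.
have Qev u : Q u -> forall m, ev (u m) = 0.
  move=> [eu u0] m; have [ms|/u0 ->] := boolP (m \in s); last exact: ev0.
  have [a ea] : exists a : 'I_r -> L, \sum_(m <- s) u m *: W m = \sum_k a k * Z k.
    apply/pi_ker; rewrite (sam_sum hpi) -[RHS]eu; apply: eq_bigr => m' _.
    by rewrite (samZ hpi) pi_word.
  pose p : P := \sum_(m <- s) ev (u m) *: 'X_[m].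
  have Ip : in_ideal z p.
    apply/in_idealP; exists (fun k => f (a k)); rewrite /p -classical_sum ea (sam_sum hf).
    by apply: eq_bigr => k _; rewrite (samM hf) fZ.
  have pc m' : p@_m' = if m' \in s then ev (u m') else 0.
    rewrite /p raddf_sum /=; case: ifP => hm'.
      rewrite (bigD1_seq m') //= mcoeffZ mcoeffX eqxx mulr1 big1 ?addr0 // => m2 /negPf ne.
      by rewrite mcoeffZ mcoeffX ne mulr0.
    rewrite big_seq big1 // => m2 hm2; rewrite mcoeffZ mcoeffX.
    by case: eqP => [em|_]; [rewrite -em hm2 in hm'|rewrite mulr0].
  have p0 : p = 0.
    apply/eqP; apply: contraT => np.
    have := mlead_supp np; rewrite mcoeff_msupp pc; case: ifP => [ls _|_]; last by rewrite eqxx.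
    by have := st _ ls p Ip np; rewrite eqxx.
  by have := pc m; rewrite ms p0 mcoeff0.
have Qh u : Q (fun m => h * u m) -> Q u.
  move=> [eu u0]; split; last by move=> m ms; apply: kq_mulh_eq0; apply: u0.
  apply: quotient_torsion_free; rewrite scaler_sumr -[RHS]eu.
  by apply: eq_bigr => m _; rewrite scalerA.
have Qc : Q c'.
  split; last by move=> m /negPf ms; rewrite /c' ms.
  by rewrite -[RHS]e0; apply: eq_big_seq => m ms; rewrite /c' ms.
exact: h_descent Qev Qh _ Qc.
Qed.

Lemma quotient_free : free_module F.
Proof.
exists (fun w => exists2 m, standard m & w = WF m); split.
  by move=> v; have [t [c [_ ht ev]]] := Span_spans (standard_spans v); exists t, c.
move=> s c us hs e0 x xs.
have /boolp.choice [mm hmm] : forall w, exists m, w \in s -> standard m /\ w = WF m.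
  move=> w; have [ws|] := boolP (w \in s); last by exists 0%MM.
  by have [m sm ew] := hs w ws; exists m.
have minj : {in s &, injective mm}.
  by move=> u w us' ws emm; have [_ ->] := hmm u us'; have [_ ->] := hmm w ws; rewrite emm.
have := @standard_independent (map mm s) (fun m => c (WF m)).
rewrite map_inj_in_uniq // => /(_ us) H.
have [_ {1}->] := hmm x xs; apply: H (map_f mm xs).
  by move=> m /mapP[w ws ->]; case: (hmm w ws).
rewrite big_map -[RHS]e0; apply: eq_big_seq => w ws; have [_ <-] := hmm w ws.
by [].
Qed.
End Deformation.

(** * Signs of permutations *)
Section PermutationSign.
Variables (n : nat) (s : 'S_n).
Import Num.Theory.

(** Both parities are the sign of the Vandermonde determinant of the permuted
    sequence. *)
Lemma odd_perm_length : odd (perm_length s) = s.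
Proof.
pose a : 'rV[int]_n := \row_i (i : nat)%:Z; pose b : 'rV[int]_n := \row_i (s i : nat)%:Z.
have eb : Vandermonde n b = col_perm s (Vandermonde n a).
  by apply/matrixP => i j; rewrite !mxE.
have sg_prod (I : Type) (r : seq I) (P : pred I) (F : I -> int) :
    Num.sg (\prod_(i <- r | P i) F i) = \prod_(i <- r | P i) Num.sg (F i).
  by apply: (big_morph _ (@sgrM _)); apply: sgr1.
have sga : Num.sg (\det (Vandermonde n a)) = 1.
  rewrite det_Vandermonde sg_prod big1 // => i _; rewrite sg_prod big1 // => j ij.
  by apply: gtr0_sg; rewrite !mxE subr_gt0 ltz_nat.
have sgb : Num.sg (\det (Vandermonde n b)) = (-1) ^+ perm_length s.
  rewrite det_Vandermonde sg_prod.
  transitivity (\prod_(i < n) \prod_(j < n | (i < j)%N) (-1 : int) ^+ (s j < s i)%N).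
    apply: eq_bigr => i _; rewrite sg_prod; apply: eq_bigr => j ij; rewrite !mxE.
    case: (ltngtP (s j) (s i)) => [lt|gt|e].
    - by apply: ltr0_sg; rewrite subr_lt0 ltz_nat.
    - by apply: gtr0_sg; rewrite subr_gt0 ltz_nat.
    - by move: ij; rewrite (perm_inj (val_inj e)) ltnn.
  under eq_bigr => i _ do rewrite -expr_sum.
  rewrite -expr_sum; congr (_ ^+ _).
  rewrite pair_big_dep /= /perm_length cardsE -sum1_card big_mkcondr /=.
  by apply: eq_bigr => p _; case: (s p.2 < s p.1)%N.
have := congr1 Num.sg (congr1 (fun M : 'M[int]_n => \det M) eb).
have sg_sign (c : bool) : Num.sg ((-1 : int) ^+ c) = (-1) ^+ c.
  by case: c; rewrite ?expr1 ?expr0 ?sgrN1 ?sgr1.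
rewrite sgb col_permE det_mulmx sgrM sga mul1r det_perm sg_sign odd_permV -signr_odd.
exact: signr_inj.
Qed.
End PermutationSign.

(** * Coordinate rings *)
Section CoordinateRings.
Variables (C : fieldType) (n : nat).
Local Notation P := {mpoly C[n * n]}.
Local Notation K := (Kq C).
Local Notation ev := (@kq_ev1 C).
Local Notation evR := [the {rmorphism K -> C} of ev].
Local Notation CA := (alg_pzAlg C^o).

Lemma coord_ring_mulC (V : set 'M[C]_n) (x y : coord_ring V) : x * y = y * x.
Proof.
have [p ->] := quot_pi_surj x; have [r ->] := quot_pi_surj y.
by rewrite -!quot_piM; congr (quot_pi _ _); exact: (@mulrC P).
Qed.

Lemma ideal_gen_vanishing (V : set 'M[C]_n) (p : alg_pzAlg P) :
  ideal_gen (vanishing V) p -> vanishing V p.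
Proof.
case=> s [hs ->] x Vx; elim: s hs => [|t s ih] hs.
  by rewrite big_nil; exact: meval0.
rewrite big_cons [LHS]mx_evalD ih; last by move=> u us; apply: hs; rewrite inE us orbT.
have e : mx_eval x t.1.2 = 0 by apply: hs; rewrite ?mem_head.
transitivity (mx_eval x t.1.1 * mx_eval x t.1.2 * mx_eval x t.2); last first.
  by rewrite e mulr0 mul0r.
by rewrite addr0 [LHS]mx_evalM; congr (_ * _); exact: mx_evalM.
Qed.

Lemma coord_pi_eq0 (V : set 'M[C]_n) (p : alg_pzAlg P) :
  quot_pi (vanishing V) p = 0 <-> vanishing V p.
Proof.
split=> [e|]; last exact: quot_pi_eq0.
by apply/ideal_gen_vanishing/quot_pi_eq0P.
Qed.

Lemma coord_ev_inj (V : set 'M[C]_n) (f : coord_ring V) :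
  (forall x, V x -> coord_ev f x = 0) -> f = 0.
Proof.
have [p ->] := quot_pi_surj f => h; apply/coord_pi_eq0 => x Vx.
by rewrite -(coord_ev_pi Vx) h.
Qed.

Lemma coord_ev_morphism (V : set 'M[C]_n) x : V x ->
  @alg_morphism C (coord_ring V) CA (fun f => coord_ev f x).
Proof.
move=> Vx; split=> [f g||k f].
- by rewrite -scaleN1r coord_evD // coord_evZ // mulN1r.
- split=> [|f g]; last exact: coord_evM.
  by rewrite (coord_ev_pi Vx 1); exact: meval1.
- exact: coord_evZ.
Qed.

Section TensorValues.
Variable V : set 'M[C]_n.
Local Notation F2 := (tensor (coord_ring V) (coord_ring (@SLset C n))).

Lemma coord_ev2_morphism v g : V v -> SLset g ->
  @alg_morphism C F2 CA (fun x => coord_ev2 x v g).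
Proof.
move=> Vv Sg.
have Z (k : C) (x : F2) : coord_ev2 (k *: x) v g = k * coord_ev2 x v g.
  elim/tens_ind: x => [|x y hx hy|a b].
  - by rewrite scaler0 coord_ev20 // mulr0.
  - by rewrite scalerDr !coord_ev2D // hx hy mulrDr.
  - by rewrite tensZl !coord_ev2_tens // coord_evZ // mulrA.
split=> [x y||k x]; last exact: Z.
  by rewrite -scaleN1r coord_ev2D // Z mulN1r.
split=> [|x y]; last exact: coord_ev2M.
transitivity (coord_ev2 ((1 : coord_ring V) \ox (1 : coord_ring (@SLset C n))) v g); first by [].
rewrite coord_ev2_tens // (sam1 (coord_ev_morphism Vv)) (sam1 (coord_ev_morphism Sg)).
exact: mulr1.
Qed.

Lemma tens_sumP (L : comNzRingType) (A B : pzAlg L) (x : tensor A B) :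
  exists s : seq (A * B), x = \sum_(p <- s) p.1 \ox p.2.
Proof.
elim/tens_ind: x => [|x y [s ->] [t ->]|a b].
- by exists [::]; rewrite big_nil.
- by exists (s ++ t); rewrite big_cat.
- by exists [:: (a, b)]; rewrite big_seq1.
Qed.

(** If the second factor of some term does not vanish at a point, evaluating there
    expresses the first factor of this term by the others, which shortens the sum. *)
Lemma tensor_separated (x : F2) :
  (forall v g, V v -> SLset g -> coord_ev2 x v g = 0) -> x = 0.
Proof.
have [s ->] := tens_sumP x; have [k] := ubnP (size s); elim: k s => // k ih [|[a0 b0] s].
  by rewrite big_nil.
rewrite /= ltnS => ks; rewrite big_cons /=.
have [[g0 [Sg0 ne]] hx|nb hx] := pselect (exists g0, SLset g0 /\ coord_ev b0 g0 <> 0).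
  pose c (p : coord_ring V * coord_ring (@SLset C n)) := coord_ev p.2 g0 / coord_ev b0 g0.
  have ne' : coord_ev b0 g0 != 0 by apply/eqP.
  have ea : a0 = - \sum_(p <- s) c p *: p.1.
    apply/eqP; rewrite -addr_eq0; apply/eqP; apply: coord_ev_inj => v Vv.
    rewrite coord_evD // (sam_sum (coord_ev_morphism Vv)).
    have := hx v g0 Vv Sg0; rewrite coord_ev2D // coord_ev2_tens // coord_ev2_sum // => e.
    apply: (mulIf ne'); rewrite mul0r -[RHS]e mulrDl; congr (_ + _).
    rewrite mulr_suml; apply: eq_bigr => p _; rewrite coord_evZ // coord_ev2_tens //.
    by rewrite /c mulrAC divfK // mulrC.
  pose t := [seq (p.1, p.2 - c p *: b0) | p <- s].
  have et : a0 \ox b0 + \sum_(p <- s) p.1 \ox p.2 = \sum_(p <- t) p.1 \ox p.2.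
    rewrite ea -scaleN1r -tensZl tens_suml scaleN1r -sumrN -big_split big_map /=.
    apply: eq_bigr => p _.
    have tN (a : coord_ring V) (b : coord_ring (@SLset C n)) : a \ox (- b) = - (a \ox b).
      by apply: (addrI (a \ox b)); rewrite -tensDr !subrr tens0r.
    by rewrite tensDr tN tensZm addrC.
  by rewrite et; apply: ih; rewrite ?size_map // -et.
have b00 : b0 = 0.
  by apply: coord_ev_inj => g Sg; apply: contrapT => ne; apply: nb; exists g.
move: hx; rewrite b00 tens0r add0r => hx.
exact: ih.
Qed.
End TensorValues.

(** * The classical limit of the quantized coordinate ring of the group *)

Lemma classical_RTT (A : pzAlg C) (X : 'M[A]_n) :
  (forall i j k l, X i j * X k l = X k l * X i j) -> RTT evR X.
Proof.
move=> XC; apply: mxtens_eqP => s u b t.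
rewrite -mulmxA classical_mulRl classical_mulRr !mul_leg1l.
under eq_bigr => r _ do rewrite leg2E mulrnAr.
under [RHS]eq_bigr => r _ do rewrite leg2E mulrnAr.
by rewrite !big_delta' XC.
Qed.

Lemma piG_exists : exists piG, @natural_surjection_G C n piG.
Proof.
pose Y : 'M[coord_ring (@SLset C n)]_n := \matrix_(i, j) coord (@SLset C n) i j.
have [|f [hf fX]] := @FqM_lift n C C evR (coord_ring (@SLset C n)) Y.
  by apply: classical_RTT => i j k l; apply: coord_ring_mulC.
have kill x : FqG_rels x -> f x = 0.
  move=> ->; rewrite (samB hf) (sam1 hf) /qdet (sam_sum hf).
  have hp := quot_pi_morphism (vanishing (@SLset C n)).
  pose X : 'M[P]_n := \matrix_(i, j) 'X_(mxvec_index i j).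
  transitivity (quot_pi (vanishing (@SLset C n)) (\det X - 1 : P)); last first.
    apply/coord_pi_eq0 => g Sg; rewrite /mx_eval mevalB meval1.
    rewrite -[X in X - _]det_map_mx (_ : map_mx _ X = g) ?Sg ?subrr //.
    by apply/matrixP => i j; rewrite !mxE [LHS]mx_evalX.
  rewrite (samB hp) (sam1 hp); congr (_ - _).
  rewrite /determinant (sam_sum hp); apply: eq_bigr => s _.
  rewrite (samZ hf) /= rmorphXn rmorphN /= ev_q -[X in X *: _]signr_odd odd_perm_length.
  have -> : f (\prod_(i < n) xq C i (s i)) =
      quot_pi (vanishing (@SLset C n)) (\prod_i X i (s i) : P).
    rewrite (sam_prod hf) (sam_prod hp); apply: eq_bigr => i _.
    by rewrite fX !mxE.
  rewrite -quot_piZ; congr (quot_pi _ _).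
  rewrite -[LHS]/((-1 : C) ^+ s *: (\prod_i X i (s i) : P)).
  by case: (odd_perm s); rewrite ?expr1 ?expr0 ?scaleN1r ?scale1r ?mulN1r ?mul1r.
exists (qlift f); split; first exact: (qlift_morphism hf kill).
by move=> i j; rewrite (qlift_pi hf kill) fX mxE.
Qed.
End CoordinateRings.

(** * The quantized nilpotent cone *)

Section CentralIdeal.
Variables (K : comNzRingType) (A : pzAlg K) (S : set A).

Lemma central_ideal r (Z : 'I_r -> A) x : (forall y, S y <-> exists k, y = Z k) ->
  (forall k y, y * Z k = Z k * y) ->
  ideal_gen S x <-> exists a : 'I_r -> A, x = \sum_k a k * Z k.
Proof.
move=> SZ Zc; split=> [[s [hs ->]]|[a ->]]; last first.
  apply: (big_ind (ideal_gen S)) => [|y y'|k _]; first exact: ideal_gen0.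
    exact: ideal_genD.
  by apply/ideal_genMl/ideal_gen_sub/SZ; exists k.
elim: s hs => [|t s ih] hs.
  by exists (fun=> 0); rewrite big_nil big1 // => k _; rewrite mul0r.
have [|a ea] := ih; first by move=> u us; apply: hs; rewrite inE us orbT.
have [k0 et] : exists k, t.1.2 = Z k by apply/SZ/hs/mem_head.
exists (fun k => t.1.1 * t.2 *+ (k == k0) + a k).
under [RHS]eq_bigr => k _ do rewrite mulrDl mulrnAl.
rewrite big_split /= big_delta' big_cons ea; congr (_ + _).
by rewrite et -!mulrA Zc.
Qed.
End CentralIdeal.

Section NilpotentDeformation.
Variables (C : fieldType) (n' : nat).
Local Notation n := n'.+1.
Local Notation N := (n * n)%N.
Local Notation K := (Kq C).
Local Notation ev := (@kq_ev1 C).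
Local Notation evR := [the {rmorphism K -> C} of ev].
Local Notation h := (kq_h C).
Local Notation P := {mpoly C[N]}.
Local Notation PA := (alg_pzAlg P).
Local Notation CA := (alg_pzAlg C^o).
Local Notation FG := (FqG C n).
Local Notation LM := (LqM C n).
Local Notation FN := (FqN C n).
Local Notation L := (lq C n).
Local Notation piN := (quot_pi (@FqN_rels C n)).
Local Notation X := (generic_mx C n).
Local Notation Nil := (@nilpotent_set C n).
Local Notation ON := (coord_ring Nil).
Local Notation OG := (coord_ring (@SLset C n)).
Hypothesis C0 : [pchar C] =i pred0.

Lemma qtrace_central d (x : LM) : x * qtrace (L ^+ d) = qtrace (L ^+ d) * x.
Proof.
elim/LqM_ind: x => [x y ex ey|x y ex ey|k x ex||i j].
- by rewrite mulrDl mulrDr ex ey.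
- exact: (esym (commrM (esym ex) (esym ey))).
- by rewrite -pz_scalerAl -pz_scalerAr ex.
- by rewrite mul1r mulr1.
- exact: (esym (qtrace_comm (lq_RE n C) d i j)).
Qed.

Lemma FqN_kernel (x : LM) : piN x = 0 <->
  exists a : 'I_n -> LM, x = \sum_k a k * qtrace (L ^+ k.+1).
Proof.
rewrite quot_pi_eq0P; apply: central_ideal => [y|k y]; last exact: qtrace_central.
split=> [[d [/andP[d0 dn] ->]]|[k ->]]; last by exists k.+1; split; first exact: ltn_ord.
by case: d d0 dn => // d _ dn; exists (Ordinal dn).
Qed.

Section Classical.
Variable f : LM -> PA.
Hypotheses (hf : semialg_morphism evR f) (fl : forall i j, f (L i j) = X i j).

Lemma classical_letter k : f (lq_letter C k) = ('X_k : P).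
Proof. by rewrite fl mxE vpairK. Qed.

Lemma classical_power d i j : f ((L ^+ d) i j) = (X ^+ d) i j.
Proof.
elim: d i j => [|d ih] i j.
  rewrite !expr0 !mxE; case: (i == j); [exact: (sam1 hf)|exact: (sam0 hf)].
rewrite !exprS [(X * _) i j]mxE.
have -> : (L * L ^+ d) i j = \sum_k L i k * (L ^+ d) k j by rewrite [LHS]mxE.
rewrite (sam_sum hf); apply: eq_bigr => k _.
by rewrite (samM hf) ih fl.
Qed.

Lemma classical_qtrace d : f (qtrace (L ^+ d)) = (\tr (X ^+ d) : P).
Proof.
rewrite qtraceE (sam_sum hf); apply: eq_bigr => i _.
rewrite (samZ hf) classical_power /qweight /= rmorphXz ?kq_q_unit //= ev_q exp1rz.
exact: scale1r.
Qed.
End Classical.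

Lemma power_words d i j : words_le (@lq_letter C n) d ((L ^+ d) i j).
Proof.
elim: d i j => [|d ih] i j.
  rewrite expr0 mxE; case: (i == j); last exact: Span0.
  by rewrite -(wv_nil (@lq_letter C n)); apply: words_le_word.
rewrite exprS [(L * _) i j]mxE; apply: Span_sum => k _.
by apply: (@words_leM _ _ _ _ 1 d); [exact: entry_le1|exact: ih].
Qed.

Lemma qtrace_words d : words_le (@lq_letter C n) d (qtrace (L ^+ d)).
Proof.
rewrite qtraceE; apply: Span_sum => i _; apply: SpanZs.
exact: power_words.
Qed.

Lemma trace_hom d : wsub (fun=> 1%N) (\tr (X ^+ d)) = (\tr (X ^+ d) : P) *: 'X^d.
Proof.
have e i j : wsub (fun=> 1%N) ((X ^+ d) i j) = ((X ^+ d) i j : P) *: 'X^d.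
  elim: d i j => [|d ih] i j.
    by rewrite !expr0 mxE scaler_nat rmorph_nat.
  rewrite exprS mxE rmorph_sum scaler_suml; apply: eq_bigr => k _.
  rewrite rmorphM -[X in _ * X]/(wsub (fun=> 1%N) ((X ^+ d) k j)) ih.
  rewrite generic_mxE [X in X * _](@wsubXU C N (fun=> 1%N)) /=.
  by rewrite -scalerAl -scalerAr scalerA -exprS.
by rewrite /mxtrace rmorph_sum scaler_suml; apply: eq_bigr => i _; exact: e.
Qed.

Lemma FqN_free : free_module FN.
Proof.
have [f [hf fl]] := classical_exists C n.
apply: (@quotient_free C N LM (@lq_letter C n) (@lq_letter_swap C n) f hf
  (classical_letter fl) (@words_le_all C n) (LqM_torsion_free C0) n
  (fun k => qtrace (L ^+ k.+1)) (trace_col C n') (fun k => k.+1)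
  (fun k => qtrace_central k.+1) _ (fun k => qtrace_words k.+1) _
  (exact2_trace n' C0).1 FN piN (quot_pi_morphism _) (@quot_pi_surj _ _ _)).
- by move=> k; rewrite (classical_qtrace hf fl) mxE.
- by move=> k; rewrite mxE; apply: trace_hom.
- exact: FqN_kernel.
Qed.

(** The kernel is found through the ideal of the nilpotent cone: classically it is
    generated by the traces, whose quantum versions are 0 here. *)
Lemma chi_exists : exists chi : FN -> ON,
  [/\ semialg_morphism evR chi,
      forall i j, chi (piN (L i j)) = coord Nil i j,
      forall y, exists x, chi x = y
    & forall x, chi x = 0 -> exists y, x = h *: y].
Proof.
have [f [hf fl]] := classical_exists C n.
have hv := quot_pi_morphism (vanishing Nil).
have hc := sam_comp hf hv.
have kill x : FqN_rels x -> (quot_pi (vanishing Nil) \o f) x = 0.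
  move=> [d [/andP[d0 _] ->]]; case: d d0 => // d _; apply/coord_pi_eq0 => v Nv.
  rewrite (classical_qtrace hf fl); exact: (trace_vanish d Nv).
have chiE x : qlift (quot_pi (vanishing Nil) \o f) (piN x) = quot_pi (vanishing Nil) (f x).
  exact: (qlift_pi hc kill).
exists (qlift (quot_pi (vanishing Nil) \o f)); split.
- exact: (qlift_morphism hc kill).
- by move=> i j; rewrite chiE fl mxE.
- move=> y; have [p ->] := quot_pi_surj y.
  have [x ex] := @classical_surj C N LM (@lq_letter C n) f hf (classical_letter fl) p.
  by exists (piN x); rewrite chiE ex.
move=> y; have [x ->] := quot_pi_surj y; rewrite chiE => /coord_pi_eq0 vx.
apply: (@quotient_kernel C N LM (@lq_letter C n) (@lq_letter_swap C n) f hf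
  (classical_letter fl) (@words_le_all C n) n
  (fun k => qtrace (L ^+ k.+1)) (trace_col C n') _ FN piN (quot_pi_morphism _)).
- by move=> k; rewrite (classical_qtrace hf fl) mxE.
- exact: FqN_kernel.
- exact: (nilpotent_ideal C0).
Qed.

Lemma nilpotent_conj (v g : 'M[C]_n) : g \in unitmx -> Nil v ->
  Nil (invmx g *m v *m g).
Proof.
move=> gu [k vk]; exists k.
suff e m : (invmx g *m v *m g) ^+ m = invmx g *m v ^+ m *m g.
  by rewrite e vk mulmx0 mul0mx.
elim: m => [|m ih]; first by rewrite !expr0 mulmx1 mulVmx.
by rewrite !exprS ih -!mulmxE !mulmxA (mulmxK gu).
Qed.

Variables (Delta : FG -> tensor FG FG) (eps : FG -> K) (S : FG -> FG).
Hypothesis hopfG : FqG_hopf Delta eps S.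

Lemma antipode_value (piG : FG -> OG) (g : 'M[C]_n) i a :
  natural_surjection_G piG -> SLset g ->
  coord_ev (piG (S (tq C i a))) g = invmx g i a.
Proof.
move=> [hG tG] Sg; have gu : g \in unitmx by rewrite unitmxE Sg unitr1.
have hE := sam_comp hG (coord_ev_morphism Sg).
pose A : 'M[C]_n := \matrix_(i, a) coord_ev (piG (S (tq C i a))) g.
suff eA : A *m g = 1%:M.
  have eI : A = invmx g by rewrite -[A](mulmxK gu) eA mul1mx.
  by rewrite -eI mxE.
apply/matrixP => k j; rewrite mxE.
have e := congr1 (fun M : 'M_n => coord_ev (piG (M k j)) g) (tq_antipodel hopfG).
rewrite mxE /= in e.
have es := sam_sum hE (index_enum _) xpredT (fun l => antipode_mx (tq_mx n C) S k l * tq_mx n C l j).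
rewrite /= in es; rewrite es in e.
transitivity (coord_ev (piG ((1%:M : 'M[FG]_n) k j)) g); last first.
  rewrite !mxE; case: (k == j); [exact: (sam1 hE)|exact: (sam0 hE)].
rewrite -e; apply: eq_bigr => l _.
have eM := samM hE (antipode_mx (tq_mx n C) S k l) (tq_mx n C l j); rewrite /= in eM.
by rewrite eM !mxE tG coord_ev_coord.
Qed.

(** Elements of the tensor product are compared by their values at a nilpotent
    matrix and a group element; such a value is an algebra morphism of the first
    argument, so the generators suffice. *)
Lemma FqN_deformation (beta : LM -> tensor LM FG) (phi : FN -> tensor FN FG) :
  adjoint_coaction S beta -> (forall x, phi (piN x) = tmap piN id (beta x)) ->
  comodule_algebra Delta eps phi ->
  quantum_deformation Delta eps (@conj_coaction C n Nil) phi.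
Proof.
move=> [hb bE] phiE hphi; split; [exact: hphi|exact: FqN_free|].
have [chi [hchi chil chi_surj chi_ker]] := chi_exists.
have [piG hpiG] := piG_exists C n.
have h1 := quot_pi_morphism (@q1_rels C FN).
have kill x : q1_rels x -> chi x = 0.
  by move=> ->; rewrite (samZ hchi) /= ev_h; exact: scale0r.
have hpsi := qlift_morphism hchi kill.
have psiE x : qlift chi (quot_pi (@q1_rels C FN) x) = chi x by exact: (qlift_pi hchi kill).
exists (qlift chi), piG; split; [exact: hpsi| |exact: hpiG|].
  have surj (y : ON) : exists x : quot_alg (@q1_rels C FN), qlift chi x = y.
    by have [x <-] := chi_surj y; exists (quot_pi (@q1_rels C FN) x).
  pose g y := sval (cid (surj y)).
  have hg y : qlift chi (g y) = y := svalP (cid (surj y)).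
  exists g; last exact: hg.
  have inj (x : quot_alg (@q1_rels C FN)) : qlift chi x = 0 -> x = 0.
    have [y ->] := quot_pi_surj x; rewrite psiE => /chi_ker[w ->].
    have -> : h *: w = h *: (1 : FN) * w by rewrite -pz_scalerAl mul1r.
    rewrite (samM h1) (quot_pi_eq0 (S := @q1_rels C FN)); first exact: mul0r.
    by [].
  move=> x; apply/eqP; rewrite -subr_eq0; apply/eqP/inj.
  by rewrite (samB hpsi) hg subrr.
move=> x; rewrite psiE.
have -> : (fun y => qlift chi (quot_pi (@q1_rels C FN) y)) = chi by apply/funext => y.
apply/eqP; rewrite -subr_eq0; apply/eqP/tensor_separated => v g Nv Sg.
have gu : g \in unitmx by rewrite unitmxE Sg unitr1.
have Nv' := nilpotent_conj gu Nv.
have hE2 := coord_ev2_morphism Nv Sg.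
have e2 := samB hE2 (tmap chi piG (phi x)) (conj_coaction (chi x)).
apply: etrans e2 _; apply/eqP; rewrite subr_eq0; apply/eqP.
have -> : coord_ev2 (conj_coaction (chi x)) v g = coord_ev (chi x) (invmx g *m v *m g).
  exact: (svalP (cid (conj_coaction_exists (chi x))) v g Nv Sg).
have [hG tG] := hpiG.
have ht := tmap_morphism hchi hG.
have m1 := sam_comp (coaction_morphism hphi) (sam_comp ht hE2).
have m2 := sam_comp hchi (coord_ev_morphism Nv').
move: x; apply: (FqN_morph_eq (sigma := ev) (B := CA) m1 m2) => i j /=.
rewrite chil coord_ev_coord // phiE bE.
have hpi := tmap_morphism (quot_pi_morphism (@FqN_rels C n)) (sam_id FG).
have m3 := sam_comp hpi (sam_comp ht hE2).
have m3s := sam_sum m3; rewrite /= in m3s.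
rewrite m3s -mulmxA mxE; apply: eq_bigr => a _.
rewrite m3s mxE mulr_sumr; apply: eq_bigr => b _.
rewrite (tmap_tens (quot_pi_morphism (@FqN_rels C n)) (sam_id FG)) (tmap_tens hchi hG).
rewrite coord_ev2_tens // chil coord_ev_coord //.
have eM := samM hG (S (tq C i a)) (tq C b j).
rewrite [piG _]eM coord_evM // (antipode_value _ _ hpiG Sg) tG coord_ev_coord //.
by rewrite mulrCA.
Qed.
End NilpotentDeformation.

Local Open Scope complex_scope.

Theorem theorem2p2 (R : realType) (n : nat) (n_gt0 : (0 < n)%N)
    (Delta : FqG R[i] n -> tensor (FqG R[i] n) (FqG R[i] n))
    (eps : FqG R[i] n -> Kq R[i]) (S : FqG R[i] n -> FqG R[i] n)
    (hopfG : FqG_hopf Delta eps S) :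
  exists (beta : LqM R[i] n -> tensor (LqM R[i] n) (FqG R[i] n))
         (phi : FqN R[i] n -> tensor (FqN R[i] n) (FqG R[i] n)),
    [/\ comodule_algebra Delta eps beta,
        adjoint_coaction S beta,
        forall x : LqM R[i] n,
          phi (quot_pi (@FqN_rels R[i] n) x) =
          tmap (quot_pi (@FqN_rels R[i] n)) id (beta x)
      & quantum_deformation Delta eps
          (@conj_coaction R[i] n (@nilpotent_set R[i] n)) phi].
Proof.
have [beta [phi [hbeta bE phiE hphi]]] := coaction_exists hopfG.
exists beta, phi; split; [exact: hbeta|exact: bE|exact: phiE|].
case: n n_gt0 Delta eps S hopfG beta phi hbeta bE phiE hphi => // n' _.
move=> Delta eps S hopfG beta phi hbeta bE phiE hphi.
exact: (FqN_deformation (@Num.Theory.pchar_num R[i]) hopfG bE phiE hphi).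
Qed.
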